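(* Let $0<\beta<\alpha<\mu\le1$, let $k$ satisfy the kernel regularity assumption with exponent $\mu$ given in the context, and let $\lambda\in\mathbb C$ satisfy $\ker(I-\lambda K)=\{0\}$ in $X_\beta$. Fix the spline order $m\in\{2,3,4\}$. Let $f\in X_\alpha$, let $\varphi$ be the unique solution of $\varphi-\lambda K\varphi=f$, let $\varphi_h=u_h+J_f$ be the exact B-spline--Heaviside collocation solution, where $u_h\in S_h$ is defined by $$(u_h-\lambda Ku_h)(t_i^B)=(f_C+\lambda KJ_f)(t_i^B),\qquad i=1,\ldots,n_B,$$ and let $\varphi_h^{\mathrm{it}}:=f+\lambda K\varphi_h$ be its iterated extension. Then, for all sufficiently small $h$, $$\|\varphi-\varphi_h\|_\infty\le C_\lambda h^\alpha\|f\|_{X_\alpha}$$ and $$\|\varphi-\varphi_h^{\mathrm{it}}\|_{H_\mu(\Gamma)}\le C_\lambda h^\alpha\|f\|_{X_\alpha},$$ with constants $C_\lambda$ independent of $h$ and $f$. Consequently, the second bound also holds with $H_\mu(\Gamma)$ replaced by $C(\Gamma)$ (uniform norm) and by every $H_\sigma(\Gamma)$ with $0<\sigma\le\mu$.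
   Context: **Contour.** $\Gamma\subset\mathbb C$ is a simple, closed, positively oriented contour of class $C^2$ with a regular $C^2$, $2\pi$-periodic parametrization $\gamma:\mathbb R\to\Gamma$ (so $\gamma(\theta+2\pi)=\gamma(\theta)$, $\gamma'(\theta)\ne0$, $\gamma$ injective on $[0,2\pi)$). $\mathcal D=\{t_1^d,\ldots,t_{n_d}^d\}\subset\Gamma$, $n_d\ge1$, is a set of distinct points, $t_j^d=\gamma(\theta_j^d)$ with $0<\theta_1^d<\cdots<\theta_{n_d}^d<2\pi$; the point $t_*=\gamma(0)=\gamma(2\pi)\notin\mathcal D$ is the cut. The continuity arcs are the $n_d$ open arcs of $\Gamma\setminus\mathcal D$. For a function $v$ with one-sided limits, $v(t_j^d\pm0)$ denote the limits along the orientation ($-$: incoming, $+$: outgoing), $[v]_{t_j^d}:=v(t_j^d+0)-v(t_j^d-0)$, and functions are represented by incoming values $v(t_j^d)=v(t_j^d-0)$. **Spaces.** For $0<\sigma<1$, $X_\sigma=PH_\sigma(\Gamma,\mathcal D)$ is the space of complex functions that are $\sigma$-Hölder on every continuity arc and have finite lateral limits at all points of $\mathcal D$, with norm $\|v\|_{X_\sigma}=\max_I(\|v\|_{\infty,I}+[v]_{\sigma,I})$, the maximum over the continuity arcs $I$; here $\overline I^{\,\ell}$ is $I$ completed by its two endpoints carrying the lateral values, $\|v\|_{\infty,I}=\sup_{\overline I^{\,\ell}}|v|$ and $[v]_{\sigma,I}=\sup_{t\ne s\in\overline I^{\,\ell}}|v(t)-v(s)|/|t-s|^\sigma$. If $n_d=1$,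 the distance $|t-s|$ in this seminorm is understood as the distance along the (single) completed arc. $\|\cdot\|_\infty$ is the supremum norm over $\Gamma$. $H_\sigma(\Gamma)$ ($0<\sigma\le1$) is the space of globally $\sigma$-Hölder (Lipschitz if $\sigma=1$) functions on $\Gamma$ with norm $\sup_\Gamma|v|+\sup_{t\ne s\in\Gamma}|v(t)-v(s)|/|t-s|^\sigma$. **Kernel regularity assumption.** There are constants $M_0,M_\mu$ with $|k(t,\tau)|\le M_0$ and $|k(t,\tau)-k(s,\tau)|\le M_\mu|t-s|^\mu$ for all $t,s,\tau\in\Gamma$, and a modulus of continuity $\omega_k$ with $\omega_k(r)\to0$ as $r\downarrow0$ such that $|k(t,\tau)-k(t,\zeta)|\le\omega_k(|\tau-\zeta|)$ for all $t,\tau,\zeta\in\Gamma$. **Operator.** $(Kv)(t)=\int_\Gamma k(t,\tau)v(\tau)\,d\tau$ (complex contour integral). The solution $\varphi$ exists uniquely in $X_\beta$ and lies in $X_\alpha$. **Generators and decomposition of the data.** For $0\le\theta<2\pi$: $H_j(\gamma(\theta))=0$ if $0\le\theta\le\theta_j^d$ and $=1$ if $\theta_j^d<\theta<2\pi$; $R(\gamma(\theta))=\theta/(2\pi)$; $G_j:=H_j-R$. For $f\in X_\alpha$: $J_f=\sum_{j=1}^{n_d}[f]_{t_j^d}G_j$ and $f_C=f-J_f\in H_\alpha(\Gamma)$. **Splines.** For an integer $n_B\ge4$ put $h=2\pi/n_B$ and choose a phase $\rho_h\in[0,h)$ with $\operatorname{dist}(\theta_j^d-\rho_h,h\mathbb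 Z)\ge\eta h$ for $j=1,\ldots,n_d$, where $0<\eta<1/(2n_d)$ is fixed. Put $\theta_i^B=\rho_h+(i-1)h\ (\mathrm{mod}\ 2\pi)$, $t_i^B=\gamma(\theta_i^B)$, $i=1,\ldots,n_B$. Let $N_m$ be the centered cardinal B-spline of order $m$ (degree $m-1$, support $[-m/2,m/2]$, $\sum_{r\in\mathbb Z}N_m(x-r)=1$), $B_j(\gamma(\theta))=\sum_{\ell\in\mathbb Z}N_m\big((\theta-\theta_j^B)/h-\ell n_B\big)$, and $S_h=\operatorname{span}\{B_1,\ldots,B_{n_B}\}$. The parameter $h$ ranges over the values $2\pi/n_B$; for all sufficiently small $h$ the spline $u_h$ exists uniquely. *)

(* Defs.v *)
From Stdlib Require Import Reals ZArith List ClassicalEpsilon.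
From Coquelicot Require Export Coquelicot.
Open Scope R_scope.

(** * Contour *)

(* Componentwise derivative of a curve [R -> C] with respect to its real
   parameter (Coquelicot's [C_derive] is the complex derivative). *)
Definition curve_deriv (g : R -> C) (x : R) : C :=
  (Derive (fun s => fst (g s)) x, Derive (fun s => snd (g s)) x).

Definition class_C2 (u : R -> R) : Prop :=
  forall x : R,
    ex_derive u x /\ ex_derive (Derive u) x /\ continuous (Derive (Derive u)) x.

Definition on_contour (g : R -> C) (t : C) : Prop := exists x : R, t = g x.

(* Contour integral of [F] along [g]. *)
Definition contour_int (g : R -> C) (F : C -> C) : C :=
  RInt (V := C_R_CompleteNormedModule)
    (fun x => (F (g x) * curve_deriv g x)%C) 0 (2 * PI).

Definition winding (g : R -> C) (z : C) : C :=
  (contour_int g (fun tau => / (tau - z)) / (2 * PI * Ci))%C.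

Definition joined_off (g : R -> C) (z w : C) : Prop :=
  exists p : R -> C,
    (forall s : R, continuous p s) /\ p 0 = z /\ p 1 = w /\
    (forall s : R, 0 <= s <= 1 -> ~ on_contour g (p s)).

(* The bounded component of the complement of the contour. *)
Definition inside (g : R -> C) (z : C) : Prop :=
  ~ on_contour g z /\
  exists M : R, forall w : C, joined_off g z w -> Cmod w <= M.

Record contour (g : R -> C) : Prop := {
  contour_re_C2 : class_C2 (fun x => fst (g x));
  contour_im_C2 : class_C2 (fun x => snd (g x));
  contour_regular : forall x : R, curve_deriv g x <> RtoC 0;
  contour_periodic : forall x : R, g (x + 2 * PI) = g x;
  contour_simple : forall x y : R,
    0 <= x < 2 * PI -> 0 <= y < 2 * PI -> g x = g y -> x = y;
  contour_positive : forall z : C, inside g z -> winding g z = RtoC 1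
}.

(* The parameter in [0, 2 PI) of a point of the contour. *)
Definition param (g : R -> C) (t : C) : R :=
  epsilon (inhabits 0) (fun x => 0 <= x < 2 * PI /\ g x = t).

(** * Discontinuity points

    The [nd] discontinuity points are [g (th 0), ..., g (th (nd - 1))]. *)

Definition disc_params (nd : nat) (th : nat -> R) : Prop :=
  (1 <= nd)%nat /\
  (forall j, (j < nd)%nat -> 0 < th j < 2 * PI) /\
  (forall i j, (i < j)%nat -> (j < nd)%nat -> th i < th j).

(* The j-th continuity arc is the image of the open interval
   (th j, arc_end j); the last one runs across the cut [g 0 = g (2 PI)]. *)
Definition arc_end (nd : nat) (th : nat -> R) (j : nat) : R :=
  if Nat.ltb (S j) nd then th (S j) else th 0%nat + 2 * PI.

(* Lateral limits along the orientation. [lim] is a total operator, which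
   returns the limit whenever there is one. *)
Definition lat_in (g : R -> C) (v : C -> C) (x : R) : C :=
  lim (T := C_R_CompleteNormedModule) (filtermap (fun s => v (g s)) (at_left x)).
Definition lat_out (g : R -> C) (v : C -> C) (x : R) : C :=
  lim (T := C_R_CompleteNormedModule) (filtermap (fun s => v (g s)) (at_right x)).

Definition jump (g : R -> C) (v : C -> C) (x : R) : C :=
  (lat_out g v x - lat_in g v x)%C.

(** * Spaces and norms

    Functions on the contour are total functions [C -> C], of which only the
    values on the contour matter. [Rpower 0 s] is 1 in the standard library, so
    Hölder quotients are only formed for distinct points. Suprema are taken in
    [Rbar], so that an unbounded function has norm [p_infty]. *)

(* Distance of the points with parameters x < y of one completed arc: the chord,
   or the arc length when there is only one arc (whose endpoints coincide
   in the plane). *)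
Definition arc_dist (g : R -> C) (nd : nat) (x y : R) : R :=
  if Nat.eqb nd 1 then RInt (fun s => Cmod (curve_deriv g s)) x y
  else Cmod (g x - g y)%C.

(* Values are incoming values: [v (g (th j)) = v (t_j - 0)]. *)
Definition in_X (g : R -> C) (nd : nat) (th : nat -> R) (s : R) (v : C -> C)
  : Prop :=
  forall j, (j < nd)%nat ->
    filterlim (fun x => v (g x)) (at_left (th j)) (locally (v (g (th j)))) /\
    (exists l : C, filterlim (fun x => v (g x)) (at_right (th j)) (locally l)) /\
    (exists M : R, forall x y : R,
        th j < x -> x < y -> y < arc_end nd th j ->
        Cmod (v (g x) - v (g y))%C <= M * Rpower (arc_dist g nd x y) s).

(* [v] on the j-th completed arc, with lateral values at the two endpoints. *)
Definition arc_val (g : R -> C) (nd : nat) (th : nat -> R) (j : nat)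
  (v : C -> C) (x : R) : C :=
  if Req_EM_T x (th j) then lat_out g v x
  else if Req_EM_T x (arc_end nd th j) then lat_in g v x
  else v (g x).

Definition arc_sup (g : R -> C) (nd : nat) (th : nat -> R) (j : nat)
  (v : C -> C) : Rbar :=
  Lub_Rbar (fun r => exists x : R,
    th j <= x <= arc_end nd th j /\ r = Cmod (arc_val g nd th j v x)).

Definition arc_holder (g : R -> C) (nd : nat) (th : nat -> R) (s : R) (j : nat)
  (v : C -> C) : Rbar :=
  Lub_Rbar (fun r => exists x y : R,
    th j <= x /\ x < y /\ y <= arc_end nd th j /\
    r = Cmod (arc_val g nd th j v x - arc_val g nd th j v y)%C
        / Rpower (arc_dist g nd x y) s).

(* Real-valued: for [v] in the space all the suprema involved are finite. *)
Definition X_norm (g : R -> C) (nd : nat) (th : nat -> R) (s : R) (v : C -> C)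
  : R :=
  fold_right Rmax 0
    (map (fun j => real (arc_sup g nd th j v) + real (arc_holder g nd th s j v))
       (seq 0 nd)).

Definition sup_norm (g : R -> C) (v : C -> C) : Rbar :=
  Lub_Rbar (fun r => exists t : C, on_contour g t /\ r = Cmod (v t)).

Definition holder_norm (g : R -> C) (s : R) (v : C -> C) : Rbar :=
  Rbar_plus (sup_norm g v)
    (Lub_Rbar (fun r => exists t t' : C,
       on_contour g t /\ on_contour g t' /\ t <> t' /\
       r = Cmod (v t - v t')%C / Rpower (Cmod (t - t')%C) s)).

(** * Integral operator *)

Definition kernel_regular (g : R -> C) (k : C -> C -> C) (mu : R) : Prop :=
  exists (M0 Mmu : R) (omega : R -> R),
    (forall t tau, on_contour g t -> on_contour g tau -> Cmod (k t tau) <= M0) /\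
    (forall t t' tau, on_contour g t -> on_contour g t' -> on_contour g tau ->
       t <> t' ->
       Cmod (k t tau - k t' tau)%C <= Mmu * Rpower (Cmod (t - t')%C) mu) /\
    filterlim omega (at_right 0) (locally 0) /\
    (forall t tau zeta,
       on_contour g t -> on_contour g tau -> on_contour g zeta ->
       Cmod (k t tau - k t zeta)%C <= omega (Cmod (tau - zeta)%C)).

Definition opK (g : R -> C) (k : C -> C -> C) (v : C -> C) (t : C) : C :=
  contour_int g (fun tau => (k t tau * v tau)%C).

(** * Jump generators *)

Definition gen_H (g : R -> C) (th : nat -> R) (j : nat) (t : C) : R :=
  if Rle_dec (param g t) (th j) then 0 else 1.
Definition gen_R (g : R -> C) (t : C) : R := param g t / (2 * PI).
Definition gen_G (g : R -> C) (th : nat -> R) (j : nat) (t : C) : R :=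
  gen_H g th j t - gen_R g t.

Definition jump_part (g : R -> C) (nd : nat) (th : nat -> R) (f : C -> C) (t : C)
  : C :=
  sum_n (fun j => (jump g f (th j) * RtoC (gen_G g th j t))%C) (nd - 1).
Definition cont_part (g : R -> C) (nd : nat) (th : nat -> R) (f : C -> C) (t : C)
  : C :=
  (f t - jump_part g nd th f t)%C.

(** * Splines *)

Definition mesh (n : nat) : R := 2 * PI / INR n.

(* The centered cardinal B-spline of order m >= 2, as the m-th central
   difference of the truncated power x_+^(m-1) / (m-1)!. *)
Definition cardinal_bspline (m : nat) (x : R) : R :=
  sum_f_R0 (fun i => (-1) ^ i * Binomial.C m i
                     * Rmax 0 (x + INR m / 2 - INR i) ^ (m - 1)) m
  / INR (fact (m - 1)).

Definition series_Z (a : Z -> R) : R :=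
  Series (fun l => a (Z.of_nat l)) + Series (fun l => a (- Z.of_nat (S l))%Z).

(* Nodes are numbered from 0. For 0 <= rho < mesh n and i < n they lie in
   [0, 2 PI), so that no reduction modulo 2 PI is needed. *)
Definition node (n : nat) (rho : R) (i : nat) : R := rho + INR i * mesh n.

Definition bspline_basis (g : R -> C) (m n : nat) (rho : R) (j : nat) (t : C)
  : R :=
  series_Z (fun l =>
    cardinal_bspline m
      ((param g t - node n rho j) / mesh n - IZR l * INR n)).

Definition in_spline_space (g : R -> C) (m n : nat) (rho : R) (u : C -> C)
  : Prop :=
  exists c : nat -> C, forall t : C, on_contour g t ->
    u t = sum_n (fun j => (c j * RtoC (bspline_basis g m n rho j t))%C) (n - 1).

(* 0 <= rho < h and dist (th j - rho, h Z) >= eta h for all j. *)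
Definition admissible_phase (nd : nat) (th : nat -> R) (eta : R) (n : nat)
  (rho : R) : Prop :=
  0 <= rho < mesh n /\
  (forall j, (j < nd)%nat -> forall z : Z,
     eta * mesh n <= Rabs (th j - rho - IZR z * mesh n)).

Definition is_collocation_spline (g : R -> C) (k : C -> C -> C) (lambda : C)
  (nd : nat) (th : nat -> R) (m n : nat) (rho : R) (f u : C -> C) : Prop :=
  in_spline_space g m n rho u /\
  (forall i, (i < n)%nat ->
     let t := g (node n rho i) in
     (u t - lambda * opK g k u t)%C =
     (cont_part g nd th f t + lambda * opK g k (jump_part g nd th f) t)%C).

(* Main.v *)
(* Idea. Put e = phi - phi_h. Subtracting J_f from both solutions leaves a
   globally Hölder residual: with q = f_C + lambda K phi - lambda K e one has
   e - lambda K e = q - u, and the collocation equations say exactly that the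
   spline u interpolates q at the nodes. The interpolation matrix is strictly
   diagonally dominant and K maps bounded functions to mu-Hölder ones, so the
   residual is O(h^alpha |f| + h^mu |e|). Injectivity of I - lambda K and
   compactness of K bound |e| by the residual; for small h the term h^mu |e| is
   absorbed. The iterated error is lambda K e. *)

Require Import Defs.
From Stdlib Require Import Lra Lia ZArith List ClassicalEpsilon Classical.
From Stdlib Require Import FunctionalExtensionality.
From Stdlib Require Import Reals.
From Coquelicot Require Import Coquelicot.
Open Scope R_scope.

(** The error is controlled only as a bounded integrable function, while injectivity is assumed in
    [X_beta]. The bridge is smoothing: a bounded solution of the limiting homogeneous equation
    equals lambda K of itself, hence is mu-Hölder and lies in [X_beta]. Stability is therefore
    obtained by contradiction and compactness, and its constant is not explicit. The generator G_j
    has a unit jump at t_j and vanishes on both sides of the cut, so f_C is Hölder across the cut as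
    well. K phi is Hölder, so phi and f have the same jumps, and the spline only has to match a
    globally Hölder function. For orders 2, 3, 4 the central B-spline value is at least 2/3. Since
    the basis is a partition of unity, this exceeds the sum of the other weights in an interpolation
    row and gives a bound independent of h. That bound involves only the oscillation of q over
    distance 2 h, where 2 is the largest support radius. It thus applies to lambda K e although e is
    merely bounded, and produces the factor that tends to 0. *)

(** * Limits and Riemann integrals of complex-valued functions *)

Lemma norm_C_R (z : C) : norm (V := C_R_NormedModule) z = Cmod z.
Proof.
  unfold norm; simpl; unfold prod_norm, Cmod.
  change (sqrt (Rabs (fst z) ^ 2 + Rabs (snd z) ^ 2) = sqrt (fst z ^ 2 + snd z ^ 2)).
  rewrite !pow2_abs. reflexivity.
Qed.

(** The uniform structure of [C] is the product one, with componentwise balls; this is its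
    translation into the modulus. *)
Lemma filterlim_C {T} (F : (T -> Prop) -> Prop) {FF : Filter F} (f : T -> C) (l : C) :
  filterlim f F (locally l) <->
  forall eps, 0 < eps -> F (fun x => Cmod (f x - l)%C < eps).
Proof.
  rewrite (filterlim_locally_ball_norm (K := R_AbsRing) (U := C_R_NormedModule)). split; intros H.
  - intros eps He. generalize (H (mkposreal eps He)). apply filter_imp. intros x Hx.
    unfold ball_norm in Hx. rewrite norm_C_R in Hx. exact Hx.
  - intros eps. generalize (H eps (cond_pos eps)). apply filter_imp. intros x Hx.
    unfold ball_norm. rewrite norm_C_R. exact Hx.
Qed.

Lemma filterlim_C_pair {T} (F : (T -> Prop) -> Prop) {FF : Filter F}
  (f1 f2 : T -> R) (l1 l2 : R) :
  filterlim f1 F (locally l1) -> filterlim f2 F (locally l2) ->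
  filterlim (fun x => (f1 x, f2 x) : C) F (locally ((l1, l2) : C)).
Proof.
  intros H1 H2. apply filterlim_locally. intros eps.
  generalize (filter_and _ _ (proj1 (filterlim_locally _ _) H1 eps) (proj1 (filterlim_locally _ _) H2 eps)).
  apply filter_imp. intros x [Hx Hy]. split; assumption.
Qed.

Lemma filterlim_C_mult {T} (F : (T -> Prop) -> Prop) {FF : Filter F}
  (f1 f2 : T -> C) (l1 l2 : C) :
  filterlim f1 F (locally l1) -> filterlim f2 F (locally l2) ->
  filterlim (fun x => f1 x * f2 x)%C F (locally (l1 * l2)%C).
Proof.
  rewrite !(filterlim_C F). intros H1 H2 eps He.
  pose proof (Cmod_ge_0 l1) as P1. pose proof (Cmod_ge_0 l2) as P2.
  (* With both factors within d <= 1 of their limits, the three terms of the expansion below are at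
     most d, d |l2| and |l1| d, and these add up to d S <= eps. *)
  set (S := 1 + Cmod l1 + Cmod l2). assert (HS : 0 < S) by (unfold S; lra).
  assert (Hd : 0 < Rmin 1 (eps / S)).
  { apply Rmin_case; [lra | apply Rdiv_lt_0_compat; lra]. }
  generalize (filter_and _ _ (H1 _ Hd) (H2 _ Hd)). apply filter_imp.
  intros x [A B].
  assert (Hm1 := Rmin_l 1 (eps / S)). assert (Hm2 := Rmin_r 1 (eps / S)).
  set (d := Rmin 1 (eps / S)) in *.
  replace (f1 x * f2 x - l1 * l2)%C
    with ((f1 x - l1) * (f2 x - l2) + ((f1 x - l1) * l2 + l1 * (f2 x - l2)))%C by ring.
  eapply Rle_lt_trans; [apply Cmod_triangle|].
  eapply Rle_lt_trans; [apply Rplus_le_compat_l, Cmod_triangle|].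
  rewrite !Cmod_mult.
  pose proof (Cmod_ge_0 (f1 x - l1)%C). pose proof (Cmod_ge_0 (f2 x - l2)%C).
  assert (d * S <= eps).
  { apply Rmult_le_reg_r with (/ S). apply Rinv_0_lt_compat; lra.
    rewrite Rmult_assoc, Rinv_r, Rmult_1_r by lra. exact Hm2. }
  unfold S in *.
  set (a := Cmod (f1 x - l1)%C) in *. set (b := Cmod (f2 x - l2)%C) in *.
  set (p := Cmod l1) in *. set (q := Cmod l2) in *. 
  assert (a * b <= a * d) by (apply Rmult_le_compat_l; lra).
  assert (a * d <= a * 1) by (apply Rmult_le_compat_l; lra).
  assert (a * q <= d * q) by (apply Rmult_le_compat_r; lra).
  assert (p * b <= p * d) by (apply Rmult_le_compat_l; lra).
  lra.
Qed.

Lemma filterlim_C_minus {T} (F : (T -> Prop) -> Prop) {FF : Filter F}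
  (f1 f2 : T -> C) (l1 l2 : C) :
  filterlim f1 F (locally l1) -> filterlim f2 F (locally l2) ->
  filterlim (fun x => f1 x - f2 x)%C F (locally (l1 - l2)%C).
Proof.
  rewrite !(filterlim_C F). intros H1 H2 eps He.
  assert (Hd : 0 < eps / 2) by lra.
  generalize (filter_and _ _ (H1 _ Hd) (H2 _ Hd)). apply filter_imp.
  intros x [A B].
  replace (f1 x - f2 x - (l1 - l2))%C with ((f1 x - l1) - (f2 x - l2))%C by ring.
  eapply Rle_lt_trans; [apply Cmod_triangle|]. rewrite Cmod_opp. lra.
Qed.

(** The bound [b] may vary along the filter: Hölder quotients at lateral values are limits of
    quotients in which the distance moves too. *)
Lemma Cmod_limit_le {T} (F : (T -> Prop) -> Prop) {FF : ProperFilter F}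
  (f : T -> C) (l : C) (b : T -> R) (M : R) :
  filterlim f F (locally l) -> filterlim b F (locally M) ->
  F (fun x => Cmod (f x) <= b x) -> Cmod l <= M.
Proof.
  rewrite (filterlim_C F), (filterlim_locally (F := F)). intros Hf Hb Hle.
  apply Rnot_lt_le; intros Hlt.
  assert (Hd : 0 < (Cmod l - M) / 2) by lra.
  destruct (filter_ex _ (filter_and _ _ Hle
    (filter_and _ _ (Hf _ Hd) (Hb (mkposreal _ Hd))))) as [x [H1 [H2 H3]]].
  apply (Rabs_def2 (b x - M)) in H3. simpl in H3.
  pose proof (Cmod_triangle (f x) (l - f x)%C) as H4.
  replace (f x + (l - f x))%C with l in H4 by ring.
  rewrite <- (Cmod_opp (l - f x)%C) in H4.
  replace (- (l - f x))%C with (f x - l)%C in H4 by ring. lra.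
Qed.

(** Continuing [F] by its one-sided limits gives a continuous function, and the integral does not
    see the endpoints. *)
Lemma ex_RInt_limits (F : R -> C) (a b : R) (la lb : C) :
  a < b ->
  (forall x, a < x < b -> continuous F x) ->
  filterlim F (at_right a) (locally la) ->
  filterlim F (at_left b) (locally lb) ->
  ex_RInt (V := C_R_NormedModule) F a b.
Proof.
  intros Hab Hc Ha Hb.
  (* The continuation is constant beyond both ends because continuity at [a] and [b] is required
     from both sides. *)
  set (Ft := fun x => if Rle_dec x a then la else if Rle_dec b x then lb else F x).
  apply ex_RInt_ext with Ft.
  { rewrite Rmin_left, Rmax_right by lra. intros x Hx. unfold Ft.
    destruct (Rle_dec x a); [lra|]. destruct (Rle_dec b x); [lra|]. reflexivity. }
  apply (ex_RInt_continuous (V := C_R_CompleteNormedModule)).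
  rewrite Rmin_left, Rmax_right by lra. intros x Hx.
  unfold continuous. apply (filterlim_C (locally x) Ft (Ft x)). intros eps He.
  destruct (Req_dec x a) as [->|Hxa]; [|destruct (Req_dec x b) as [->|Hxb]].
  - rewrite (filterlim_C (at_right a)) in Ha. destruct (Ha eps He) as [d Hd].
    assert (Hd' : 0 < Rmin d (b - a)) by (apply Rmin_case; [apply cond_pos | lra]).
    exists (mkposreal _ Hd'). intros y Hy.
    pose proof (Rmin_l d (b - a)). pose proof (Rmin_r d (b - a)).
    assert (Hy' := Hy). apply (Rabs_def2 (y - a)) in Hy'. simpl in Hy'.
    unfold Ft. destruct (Rle_dec a a); [|lra].
    destruct (Rle_dec y a).
    + replace (la - la)%C with (RtoC 0) by ring. rewrite Cmod_0. exact He.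
    + destruct (Rle_dec b y); [lra|]. apply Hd; [|lra].
      apply (Rabs_def1 (y - a)); lra.
  - rewrite (filterlim_C (at_left b)) in Hb. destruct (Hb eps He) as [d Hd].
    assert (Hd' : 0 < Rmin d (b - a)) by (apply Rmin_case; [apply cond_pos | lra]).
    exists (mkposreal _ Hd'). intros y Hy.
    pose proof (Rmin_l d (b - a)). pose proof (Rmin_r d (b - a)).
    assert (Hy' := Hy). apply (Rabs_def2 (y - b)) in Hy'. simpl in Hy'.
    unfold Ft. destruct (Rle_dec b a); [lra|]. destruct (Rle_dec b b); [|lra].
    destruct (Rle_dec y a); [lra|].
    destruct (Rle_dec b y).
    + replace (lb - lb)%C with (RtoC 0) by ring. rewrite Cmod_0. exact He.
    + apply Hd; [|lra]. apply (Rabs_def1 (y - b)); lra.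
  - assert (Hx' : a < x < b) by lra. specialize (Hc x Hx').
    unfold continuous in Hc. rewrite (filterlim_C (locally x)) in Hc.
    destruct (Hc eps He) as [d Hd].
    assert (Hd' : 0 < Rmin d (Rmin (x - a) (b - x))).
    { apply Rmin_case; [apply cond_pos | apply Rmin_case; lra]. }
    exists (mkposreal _ Hd'). intros y Hy.
    pose proof (Rmin_l d (Rmin (x - a) (b - x))).
    pose proof (Rmin_r d (Rmin (x - a) (b - x))).
    pose proof (Rmin_l (x - a) (b - x)). pose proof (Rmin_r (x - a) (b - x)).
    assert (Hy' := Hy). apply (Rabs_def2 (y - x)) in Hy'. simpl in Hy'.
    unfold Ft. destruct (Rle_dec x a); [lra|]. destruct (Rle_dec b x); [lra|].
    destruct (Rle_dec y a); [lra|]. destruct (Rle_dec b y); [lra|].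
    apply Hd. apply (Rabs_def1 (y - x)); lra.
Qed.

Lemma Cmod_RInt_le (F : R -> C) (a b M : R) :
  a <= b -> ex_RInt (V := C_R_NormedModule) F a b ->
  (forall x, a <= x <= b -> Cmod (F x) <= M) ->
  Cmod (RInt (V := C_R_CompleteNormedModule) F a b) <= (b - a) * M.
Proof.
  intros Hab Hex HM. rewrite <- norm_C_R.
  apply (norm_RInt_le_const (V := C_R_NormedModule) F a b _ M Hab).
  - intros x Hx. rewrite norm_C_R. apply HM, Hx.
  - apply (RInt_correct (V := C_R_CompleteNormedModule)), Hex.
Qed.

(** * The contour *)

Lemma contour_period (g : R -> C) : contour g ->
  forall (z : Z) (x : R), g (x + IZR z * (2 * PI)) = g x.
Proof.
  intros Hg. assert (Hn : forall (n : nat) x, g (x + INR n * (2 * PI)) = g x).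
  { induction n as [|n IH]; intros x.
    - simpl. f_equal. ring.
    - rewrite S_INR. replace (x + (INR n + 1) * (2 * PI)) with (x + INR n * (2 * PI) + 2 * PI) by ring.
      rewrite (contour_periodic g Hg). apply IH. }
  intros z x. destruct (Z.le_gt_cases 0 z) as [H|H].
  - rewrite <- (Z2Nat.id z H), <- INR_IZR_INZ. apply Hn.
  - rewrite <- (Hn (Z.to_nat (- z)) (x + IZR z * (2 * PI))). f_equal.
    rewrite INR_IZR_INZ, Z2Nat.id by lia. rewrite opp_IZR. ring.
Qed.

Lemma period_reduce (a x : R) :
  exists z : Z, a <= x + IZR z * (2 * PI) < a + 2 * PI.
Proof.
  pose proof PI_RGT_0 as HP.
  destruct (archimed ((x - a) / (2 * PI))) as [H1 H2].
  set (u := up ((x - a) / (2 * PI))) in *.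
  exists (1 - u)%Z. rewrite minus_IZR.
  assert (E : (x - a) = ((x - a) / (2 * PI)) * (2 * PI)) by (field; lra).
  set (y := (x - a) / (2 * PI)) in *.
  assert (y * (2 * PI) < IZR u * (2 * PI)) by (apply Rmult_lt_compat_r; lra).
  assert ((IZR u - y) * (2 * PI) <= 1 * (2 * PI)) by (apply Rmult_le_compat_r; lra).
  lra.
Qed.

Lemma on_contour_param (g : R -> C) (t : C) : contour g -> on_contour g t ->
  0 <= param g t < 2 * PI /\ g (param g t) = t.
Proof.
  intros Hg [x ->]. unfold param.
  apply (ClassicalEpsilon.epsilon_spec (inhabits 0)
    (fun y => 0 <= y < 2 * PI /\ g y = g x)).
  destruct (period_reduce 0 x) as [z Hz]. exists (x + IZR z * (2 * PI)).
  split; [lra|]. apply contour_period, Hg.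
Qed.

Lemma param_contour (g : R -> C) (x : R) : contour g -> 0 <= x < 2 * PI ->
  param g (g x) = x.
Proof.
  intros Hg Hx. destruct (on_contour_param g (g x) Hg) as [H1 H2]; [exists x; reflexivity|].
  apply (contour_simple g Hg); assumption.
Qed.

Lemma contour_deriv_continuous (g : R -> C) : contour g ->
  forall x, continuous (curve_deriv g) x.
Proof.
  intros Hg x. unfold continuous, curve_deriv.
  apply (filterlim_C_pair (locally x)).
  - apply (ex_derive_continuous (K := R_AbsRing) (V := R_NormedModule)), (contour_re_C2 g Hg x).
  - apply (ex_derive_continuous (K := R_AbsRing) (V := R_NormedModule)), (contour_im_C2 g Hg x).
Qed.

Lemma contour_continuous (g : R -> C) : contour g -> forall x, continuous g x.
Proof.
  intros Hg x. unfold continuous.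
  apply (filterlim_ext (fun y => (fst (g y), snd (g y)) : C)).
  { intros y. symmetry. apply surjective_pairing. }
  rewrite (surjective_pairing (g x)).
  apply (filterlim_C_pair (locally x)).
  - apply (ex_derive_continuous (K := R_AbsRing) (V := R_NormedModule) (fun x => fst (g x))), (contour_re_C2 g Hg x).
  - apply (ex_derive_continuous (K := R_AbsRing) (V := R_NormedModule) (fun x => snd (g x))), (contour_im_C2 g Hg x).
Qed.

Lemma speed_continuous (g : R -> C) : contour g ->
  forall x, continuous (fun s => Cmod (curve_deriv g s)) x.
Proof.
  intros Hg x. apply (continuous_ext (fun s => norm (V := C_R_NormedModule) (curve_deriv g s))).
  { intros y. apply norm_C_R. }
  apply (continuous_comp (curve_deriv g) (norm (V := C_R_NormedModule))).
  - apply contour_deriv_continuous, Hg.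
  - apply (filterlim_norm (V := C_R_NormedModule)).
Qed.

(** The window from -4 PI to 8 PI contains all parameters that occur: arcs end before 4 PI, and
    spline stencils leave [0, 2 PI] by at most one period. *)
Lemma contour_speed_bound (g : R -> C) : contour g ->
  exists L, 0 < L /\ forall x, -4 * PI <= x <= 8 * PI -> Cmod (curve_deriv g x) <= L.
Proof.
  intros Hg.
  destruct (bounded_continuity (V := C_R_NormedModule) (curve_deriv g) (-4 * PI) (8 * PI)) as [M HM].
  { intros x _. apply contour_deriv_continuous, Hg. }
  exists (Rmax 1 M). split; [eapply Rlt_le_trans; [|apply Rmax_l]; lra|].
  intros x Hx. eapply Rle_trans; [|apply Rmax_r].
  rewrite <- norm_C_R. apply Rlt_le, HM, Hx.
Qed.

(** The fundamental theorem of calculus in both components, followed by the norm inequality for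
    integrals. *)
Lemma contour_chord_le_arc (g : R -> C) : contour g -> forall x y, x <= y ->
  Cmod (g x - g y)%C <= RInt (fun s => Cmod (curve_deriv g s)) x y.
Proof.
  intros Hg x y Hxy.
  rewrite <- Cmod_opp. replace (- (g x - g y))%C with (minus (G := C_R_NormedModule) (g y) (g x)).
  2: { change (g y + - g x = - (g x - g y))%C. ring. }
  rewrite <- norm_C_R.
  apply (norm_RInt_le (V := C_R_NormedModule) (curve_deriv g) (fun s => Cmod (curve_deriv g s)) x y).
  - exact Hxy.
  - intros s _. rewrite norm_C_R. apply Rle_refl.
  - apply (is_RInt_fct_extend_pair (U := R_NormedModule) (V := R_NormedModule)).
    + apply (is_RInt_derive (V := R_CompleteNormedModule) (fun s => fst (g s))).
      * intros s _. apply Derive_correct, (contour_re_C2 g Hg s).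
      * intros s _. apply (ex_derive_continuous (K := R_AbsRing) (V := R_NormedModule)), (contour_re_C2 g Hg s).
    + apply (is_RInt_derive (V := R_CompleteNormedModule) (fun s => snd (g s))).
      * intros s _. apply Derive_correct, (contour_im_C2 g Hg s).
      * intros s _. apply (ex_derive_continuous (K := R_AbsRing) (V := R_NormedModule)), (contour_im_C2 g Hg s).
  - apply (RInt_correct (V := R_CompleteNormedModule)).
    apply (ex_RInt_continuous (V := R_CompleteNormedModule)). intros s _. apply speed_continuous, Hg.
Qed.

Lemma contour_arc_le (g : R -> C) (L : R) : contour g ->
  (forall x, -4 * PI <= x <= 8 * PI -> Cmod (curve_deriv g x) <= L) ->
  forall x y, -4 * PI <= x -> x <= y -> y <= 8 * PI ->
  RInt (fun s => Cmod (curve_deriv g s)) x y <= L * (y - x).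
Proof.
  intros Hg HL x y Hx Hxy Hy.
  apply Rle_trans with (RInt (fun _ => L) x y).
  - apply RInt_le; [exact Hxy| | |].
    + apply (ex_RInt_continuous (V := R_CompleteNormedModule)). intros s _. apply speed_continuous, Hg.
    + apply (ex_RInt_const (V := R_NormedModule)).
    + intros s Hs. apply HL. lra.
  - rewrite (RInt_const (V := R_CompleteNormedModule)). change (((y - x) * L) <= L * (y - x)). lra.
Qed.

(** * Powers of distances and moduli of differences *)

Ltac ring_C := match goal with |- @eq _ ?a ?b => change (@eq C a b); ring end.

(* [Rpower 0 s = 1]; [hpow] is the power function with [hpow 0 s = 0]. *)
Definition hpow (x s : R) : R := if Rle_dec x 0 then 0 else Rpower x s.

Lemma hpow_Rpower (x s : R) : 0 < x -> hpow x s = Rpower x s.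
Proof. intros H. unfold hpow. destruct (Rle_dec x 0); [lra | reflexivity]. Qed.

Lemma Rpower_pos (x s : R) : 0 < Rpower x s.
Proof. apply exp_pos. Qed.

Lemma hpow_0 (s : R) : hpow 0 s = 0.
Proof. unfold hpow. destruct (Rle_dec 0 0); [reflexivity | lra]. Qed.

Lemma hpow_ge_0 (x s : R) : 0 <= hpow x s.
Proof. unfold hpow. destruct (Rle_dec x 0); [lra | apply Rlt_le, Rpower_pos]. Qed.

Lemma hpow_le (x y s : R) : 0 <= s -> x <= y -> hpow x s <= hpow y s.
Proof.
  intros Hs Hxy. unfold hpow. destruct (Rle_dec x 0); destruct (Rle_dec y 0).
  - lra.
  - apply Rlt_le, Rpower_pos.
  - lra.
  - apply Rle_Rpower_l; lra.
Qed.

Lemma hpow_mult (x y s : R) : 0 <= x -> 0 <= y -> hpow (x * y) s = hpow x s * hpow y s.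
Proof.
  intros [Hx|<-] [Hy|<-].
  - rewrite !hpow_Rpower; auto using Rmult_lt_0_compat. symmetry; apply Rpower_mult_distr; auto.
  - rewrite Rmult_0_r, hpow_0. ring.
  - rewrite Rmult_0_l, hpow_0. ring.
  - rewrite Rmult_0_l, hpow_0. ring.
Qed.

Lemma hpow_small (s eps : R) : 0 < s -> 0 < eps ->
  exists d, 0 < d /\ forall x, x < d -> hpow x s < eps.
Proof.
  intros Hs He. exists (Rpower eps (/ s)). split; [apply Rpower_pos|].
  intros x Hx. unfold hpow. destruct (Rle_dec x 0); [exact He|].
  replace eps with (Rpower (Rpower eps (/ s)) s).
  - apply Rlt_Rpower_l; lra.
  - rewrite Rpower_mult, Rinv_l, Rpower_1; lra.
Qed.

(** On a set of diameter at most [D], a larger Hölder exponent is stronger: x^r = x^(r-s) x^s, and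
    x^(r-s) <= D^(r-s) <= D because 0 <= r - s <= 1 and D >= 1. *)
Lemma hpow_exponent_le (x D s r : R) : 0 <= s <= r -> r <= 1 -> 1 <= D -> x <= D ->
  hpow x r <= D * hpow x s.
Proof.
  intros Hs Hr HD Hx. unfold hpow. destruct (Rle_dec x 0) as [|Hx0]; [lra|].
  replace r with ((r - s) + s) by ring. rewrite Rpower_plus.
  apply Rmult_le_compat_r; [apply Rlt_le, Rpower_pos|].
  apply Rle_trans with (Rpower D (r - s)); [apply Rle_Rpower_l; lra|].
  apply Rle_trans with (Rpower D 1); [apply Rle_Rpower; lra|].
  rewrite Rpower_1; lra.
Qed.

Lemma Cmod_minus_sym (a b : C) : Cmod (a - b)%C = Cmod (b - a)%C.
Proof. rewrite <- Cmod_opp. f_equal. ring. Qed.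

Lemma Cmod_minus_triangle (a b c : C) : Cmod (a - c)%C <= Cmod (a - b)%C + Cmod (b - c)%C.
Proof. replace (a - c)%C with ((a - b) + (b - c))%C by ring. apply Cmod_triangle. Qed.

Lemma Cmod_minus_le (a b : C) : Cmod (a - b)%C <= Cmod a + Cmod b.
Proof. eapply Rle_trans; [apply Cmod_triangle|]. rewrite Cmod_opp. apply Rle_refl. Qed.

Lemma Cminus_diag (a : C) : (a - a)%C = RtoC 0.
Proof. ring. Qed.

(** Taking L >= 1 ensures L^s <= L for exponents s <= 1, so powers of [L] can be replaced by [L]
    later. *)
Lemma contour_lipschitz (g : R -> C) : contour g ->
  exists L, 1 <= L /\
   (forall x y, -4 * PI <= x -> x <= y -> y <= 8 * PI ->
    RInt (fun s => Cmod (curve_deriv g s)) x y <= L * (y - x)) /\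
   (forall x y, -4 * PI <= x <= 8 * PI -> -4 * PI <= y <= 8 * PI ->
    Cmod (g x - g y)%C <= L * Rabs (x - y)) /\
   (forall x, -4 * PI <= x <= 8 * PI -> Cmod (curve_deriv g x) <= L).
Proof.
  intros Hg. destruct (contour_speed_bound g Hg) as [L0 [HL0 HB0]].
  exists (Rmax 1 L0). 
  assert (HB : forall x, -4 * PI <= x <= 8 * PI -> Cmod (curve_deriv g x) <= Rmax 1 L0).
  { intros x Hx. eapply Rle_trans; [apply HB0, Hx | apply Rmax_r]. }
  split; [apply Rmax_l|]. 
  assert (HA := contour_arc_le g _ Hg HB).
  split; [exact HA|]. split; [|exact HB].
  intros x y Hx Hy. destruct (Rle_dec x y).
  - rewrite (Rabs_left1 (x - y)) by lra. 
    eapply Rle_trans; [apply contour_chord_le_arc; [exact Hg | lra]|].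
    eapply Rle_trans; [apply HA; lra|]. apply Req_le. ring.
  - rewrite (Rabs_right (x - y)) by lra. rewrite Cmod_minus_sym.
    eapply Rle_trans; [apply contour_chord_le_arc; [exact Hg | lra]|].
    apply HA; lra.
Qed.

(** * The integral operator *)

(** [RInt] is total, so linearity of [opK] needs integrability. Testing against every continuous
    weight covers the factor [k t (g x) * curve_deriv g x] for all [t] at once and avoids products
    of two discontinuous functions. *)
Definition integrable_along (g : R -> C) (v : C -> C) : Prop :=
  forall c : R -> C, (forall x, continuous c x) ->
    ex_RInt (V := C_R_NormedModule) (fun x => c x * v (g x))%C 0 (2 * PI).

Lemma integrable_along_minus (g : R -> C) (v w : C -> C) :
  integrable_along g v -> integrable_along g w ->
  integrable_along g (fun t => v t - w t)%C.
Proof.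
  intros Hv Hw c Hc.
  apply (ex_RInt_ext (V := C_R_NormedModule)
    (fun x => minus (G := C_R_NormedModule) (c x * v (g x))%C (c x * w (g x))%C)).
  - intros x _. change (c x * v (g x) - c x * w (g x) = c x * (v (g x) - w (g x)))%C. ring_C.
  - apply (ex_RInt_minus (V := C_R_NormedModule)); [apply Hv, Hc | apply Hw, Hc].
Qed.

Lemma integrable_along_scal (g : R -> C) (a : R) (v : C -> C) :
  integrable_along g v -> integrable_along g (fun t => RtoC a * v t)%C.
Proof.
  intros Hv c Hc.
  apply (ex_RInt_ext (V := C_R_NormedModule)
    (fun x => scal (V := C_R_NormedModule) a (c x * v (g x))%C)).
  - intros x _. transitivity (RtoC a * (c x * v (g x)))%C; [|ring_C].
    apply injective_projections; simpl; unfold scal; simpl; unfold mult; simpl; ring.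
  - apply (ex_RInt_scal (V := C_R_NormedModule)), Hv, Hc.
Qed.

Lemma integrable_along_ext (g : R -> C) (v w : C -> C) :
  (forall x, 0 < x < 2 * PI -> v (g x) = w (g x)) ->
  integrable_along g v -> integrable_along g w.
Proof.
  intros E Hv c Hc. apply (ex_RInt_ext (V := C_R_NormedModule) (fun x => c x * v (g x))%C).
  - pose proof PI_RGT_0. rewrite Rmin_left, Rmax_right by lra.
    intros x Hx. rewrite E by exact Hx. reflexivity.
  - apply Hv, Hc.
Qed.

Lemma integrable_along_continuous (g : R -> C) (v : C -> C) (V : R -> C) :
  (forall x, 0 <= x <= 2 * PI -> continuous V x) ->
  (forall x, 0 < x < 2 * PI -> v (g x) = V x) ->
  integrable_along g v.
Proof.
  intros HV E c Hc. pose proof PI_RGT_0.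
  apply (ex_RInt_ext (V := C_R_NormedModule) (fun x => c x * V x)%C).
  - rewrite Rmin_left, Rmax_right by lra. intros x Hx. rewrite E by exact Hx. reflexivity.
  - apply (ex_RInt_continuous (V := C_R_CompleteNormedModule)).
    rewrite Rmin_left, Rmax_right by lra. intros x Hx.
    apply (filterlim_C_mult (locally x)); [apply Hc | apply HV, Hx].
Qed.

Lemma kernel_slice_continuous (g : R -> C) (k : C -> C -> C) (mu : R) (t : C) :
  contour g -> kernel_regular g k mu -> on_contour g t ->
  forall x, continuous (fun x => k t (g x) * curve_deriv g x)%C x.
Proof.
  intros Hg [M0 [Mmu [om [_ [_ [Hom Hk]]]]]] Ht x.
  apply (filterlim_C_mult (locally x)); [|apply contour_deriv_continuous, Hg].
  apply (filterlim_C (locally x)). intros eps He.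
  rewrite filterlim_locally in Hom. destruct (Hom (mkposreal eps He)) as [d Hd].
  pose proof (contour_continuous g Hg x) as Hc. unfold continuous in Hc.
  rewrite (filterlim_C (locally x)) in Hc.
  generalize (Hc d (cond_pos d)). apply filter_imp. intros y Hy.
  (* Coincident points are set apart: the limit of [om] at 0 is one-sided and says nothing about
     [om 0]. *)
  destruct (Req_dec (Cmod (g y - g x)%C) 0) as [E|E].
  - apply Cmod_eq_0 in E. replace (g y) with (g x).
    + rewrite Cminus_diag, Cmod_0. exact He.
    + replace (g y) with ((g y - g x) + g x)%C by ring. rewrite E. ring.
  - pose proof (Cmod_ge_0 (g y - g x)%C).
    eapply Rle_lt_trans; [apply Hk; [exact Ht | exists y; reflexivity | exists x; reflexivity]|].
    assert (Hb : ball 0 d (Cmod (g y - g x)%C)).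
    { apply (Rabs_def1 (Cmod (g y - g x)%C - 0)); lra. }
    specialize (Hd _ Hb ltac:(lra)).
    apply (Rabs_def2 (om (Cmod (g y - g x)%C) - 0)) in Hd. simpl in Hd. lra.
Qed.

Lemma opK_ex_RInt (g : R -> C) (k : C -> C -> C) (mu : R) (v : C -> C) (t : C) :
  contour g -> kernel_regular g k mu -> on_contour g t -> integrable_along g v ->
  ex_RInt (V := C_R_NormedModule) (fun x => k t (g x) * v (g x) * curve_deriv g x)%C 0 (2 * PI).
Proof.
  intros Hg Hk Ht Hv.
  apply (ex_RInt_ext (V := C_R_NormedModule)
    (fun x => (k t (g x) * curve_deriv g x) * v (g x))%C).
  - intros x _. ring_C.
  - apply Hv, (kernel_slice_continuous g k mu t Hg Hk Ht).
Qed.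

Lemma opK_minus (g : R -> C) (k : C -> C -> C) (mu : R) (v w : C -> C) (t : C) :
  contour g -> kernel_regular g k mu -> on_contour g t ->
  integrable_along g v -> integrable_along g w ->
  opK g k (fun s => v s - w s)%C t = (opK g k v t - opK g k w t)%C.
Proof.
  intros Hg Hk Ht Hv Hw. unfold opK, contour_int.
  rewrite <- (RInt_minus (V := C_R_CompleteNormedModule)
    (fun x => k t (g x) * v (g x) * curve_deriv g x)%C
    (fun x => k t (g x) * w (g x) * curve_deriv g x)%C)
    by (apply (opK_ex_RInt g k mu); assumption).
  apply (RInt_ext (V := C_R_CompleteNormedModule)). intros x _.
  change (k t (g x) * (v (g x) - w (g x)) * curve_deriv g x =
    k t (g x) * v (g x) * curve_deriv g x - k t (g x) * w (g x) * curve_deriv g x)%C. ring_C.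
Qed.

Lemma opK_scal (g : R -> C) (k : C -> C -> C) (mu : R) (a : R) (v : C -> C) (t : C) :
  contour g -> kernel_regular g k mu -> on_contour g t -> integrable_along g v ->
  opK g k (fun s => RtoC a * v s)%C t = (RtoC a * opK g k v t)%C.
Proof.
  intros Hg Hk Ht Hv. unfold opK, contour_int.
  assert (E : forall z : C, scal (V := C_R_NormedModule) a z = (RtoC a * z)%C).
  { intros z. apply injective_projections; simpl; unfold scal; simpl; unfold mult; simpl; ring. }
  rewrite <- E.
  rewrite <- (RInt_scal (V := C_R_CompleteNormedModule)
    (fun x => k t (g x) * v (g x) * curve_deriv g x)%C)
    by (apply (opK_ex_RInt g k mu); assumption).
  apply (RInt_ext (V := C_R_CompleteNormedModule)). intros x _.
  transitivity (RtoC a * (k t (g x) * v (g x) * curve_deriv g x))%C; [ring_C | symmetry; apply E].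
Qed.

(** The Hölder estimate of [k] in its first variable passes under the integral, so [v] enters only
    through its supremum. One constant serves both bounds, and A >= 1 allows division by it. *)
Lemma opK_smoothing (g : R -> C) (k : C -> C -> C) (mu : R) :
  contour g -> kernel_regular g k mu ->
  exists A, 1 <= A /\
  forall (v : C -> C) (B : R), integrable_along g v ->
    (forall t, on_contour g t -> Cmod (v t) <= B) ->
    (forall t, on_contour g t -> Cmod (opK g k v t) <= A * B) /\
    (forall t s, on_contour g t -> on_contour g s ->
       Cmod (opK g k v t - opK g k v s)%C <= A * B * hpow (Cmod (t - s)%C) mu).
Proof.
  intros Hg Hk. assert (Hk' := Hk). destruct Hk' as [M0 [Mmu [om [H0 [Hmu _]]]]].
  destruct (contour_lipschitz g Hg) as [L [HL [_ [_ HD]]]].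
  pose proof PI_RGT_0 as HP.
  set (M := Rmax 1 (Rmax (Rabs M0) (Rabs Mmu))).
  assert (HM : 1 <= M /\ M0 <= M /\ Mmu <= M).
  { unfold M. split; [apply Rmax_l|].
    split; (eapply Rle_trans; [|apply Rmax_r]).
    - eapply Rle_trans; [apply Rle_abs|apply Rmax_l].
    - eapply Rle_trans; [apply Rle_abs|apply Rmax_r]. }
  assert (HPI : 1 <= 2 * PI) by (pose proof PI2_1; lra).
  assert (HML : 1 <= M * L) by (rewrite <- (Rmult_1_l 1); apply Rmult_le_compat; lra).
  exists (2 * PI * (M * L)). split.
  { rewrite <- (Rmult_1_l 1). apply Rmult_le_compat; lra. }
  intros v B Hv HB.
  assert (HB0 : 0 <= B).
  { eapply Rle_trans; [apply Cmod_ge_0 | apply (HB (g 0)); exists 0; reflexivity]. }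
  split.
  - intros t Ht. unfold opK, contour_int.
    eapply Rle_trans; [apply (Cmod_RInt_le _ 0 (2 * PI) (M * B * L))|].
    + lra.
    + apply (opK_ex_RInt g k mu); assumption.
    + intros x Hx. rewrite !Cmod_mult.
      assert (on_contour g (g x)) by (exists x; reflexivity).
      apply Rmult_le_compat; [apply Rmult_le_pos; apply Cmod_ge_0 | apply Cmod_ge_0 | |apply HD; lra].
      apply Rmult_le_compat; [apply Cmod_ge_0 | apply Cmod_ge_0 | |apply HB; assumption].
      eapply Rle_trans; [apply H0; assumption | tauto].
    + apply Req_le. ring.
  - intros t s Ht Hs.
    destruct (Ceq_dec t s) as [<-|Hts].
    { rewrite !Cminus_diag, Cmod_0, hpow_0. lra. }
    unfold opK, contour_int.
    assert (E : forall a b : C, (a - b)%C = minus (G := C_R_NormedModule) a b) by reflexivity.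
    rewrite E. rewrite <- (RInt_minus (V := C_R_CompleteNormedModule)
      (fun x => k t (g x) * v (g x) * curve_deriv g x)%C
      (fun x => k s (g x) * v (g x) * curve_deriv g x)%C)
      by (apply (opK_ex_RInt g k mu); assumption).
    assert (Hpos : 0 < Cmod (t - s)%C).
    { apply Cmod_gt_0. intros E'. apply Hts.
      replace t with ((t - s) + s)%C by ring. rewrite E'. ring. }
    eapply Rle_trans; [apply (Cmod_RInt_le _ 0 (2 * PI) (M * hpow (Cmod (t - s)%C) mu * B * L))|].
    + lra.
    + apply (ex_RInt_minus (V := C_R_NormedModule)); apply (opK_ex_RInt g k mu); assumption.
    + intros x Hx. rewrite <- E.
      replace (k t (g x) * v (g x) * curve_deriv g x - k s (g x) * v (g x) * curve_deriv g x)%C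
        with ((k t (g x) - k s (g x)) * v (g x) * curve_deriv g x)%C by ring.
      rewrite !Cmod_mult.
      assert (on_contour g (g x)) by (exists x; reflexivity).
      apply Rmult_le_compat; [apply Rmult_le_pos; apply Cmod_ge_0 | apply Cmod_ge_0 | |apply HD; lra].
      apply Rmult_le_compat; [apply Cmod_ge_0 | apply Cmod_ge_0 | |apply HB; assumption].
      eapply Rle_trans; [apply Hmu; assumption|]. rewrite hpow_Rpower by exact Hpos.
      apply Rmult_le_compat_r; [apply Rlt_le, Rpower_pos | tauto].
    + apply Req_le. ring.
Qed.

(** * Piecewise Hölder functions *)

Lemma filterlim_translate_left (x c : R) : filterlim (fun y => y + c) (at_left x) (at_left (x + c)).
Proof.
  intros P [d Hd]. exists d. intros y Hy Hlt. apply Hd; [|lra].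
  apply (Rabs_def2 (y - x)) in Hy. apply (Rabs_def1 (y + c - (x + c))); lra.
Qed.

Lemma filterlim_translate_right (x c : R) : filterlim (fun y => y + c) (at_right x) (at_right (x + c)).
Proof.
  intros P [d Hd]. exists d. intros y Hy Hlt. apply Hd; [|lra].
  apply (Rabs_def2 (y - x)) in Hy. apply (Rabs_def1 (y + c - (x + c))); lra.
Qed.

Lemma filterlim_translate (x c : R) : filterlim (fun y => y + c) (locally x) (locally (x + c)).
Proof.
  intros P [d Hd]. exists d. intros y Hy. apply Hd.
  apply (Rabs_def2 (y - x)) in Hy. apply (Rabs_def1 (y + c - (x + c))); lra.
Qed.

Lemma at_right_lt (a b : R) : a < b -> at_right a (fun x => a < x < b).
Proof.
  intros H. assert (Hd : 0 < b - a) by lra. exists (mkposreal _ Hd).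
  intros y Hy Hlt. apply (Rabs_def2 (y - a)) in Hy. simpl in Hy. lra.
Qed.

Lemma at_left_gt (a b : R) : a < b -> at_left b (fun x => a < x < b).
Proof.
  intros H. assert (Hd : 0 < b - a) by lra. exists (mkposreal _ Hd).
  intros y Hy Hlt. apply (Rabs_def2 (y - b)) in Hy. simpl in Hy. lra.
Qed.

Lemma filterlim_at_right_of_continuous (F : R -> C) (x : R) :
  continuous F x -> filterlim F (at_right x) (locally (F x)).
Proof. intros H. eapply filterlim_filter_le_1; [apply filter_le_within | exact H]. Qed.

Lemma filterlim_at_left_of_continuous (F : R -> C) (x : R) :
  continuous F x -> filterlim F (at_left x) (locally (F x)).
Proof. intros H. eapply filterlim_filter_le_1; [apply filter_le_within | exact H]. Qed.

(** [lim] is specified on Cauchy filters; a convergent filter is Cauchy, and its limit is unique. *)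
Lemma lim_eq {T} (F : (T -> Prop) -> Prop) {FF : ProperFilter F} (f : T -> C) (l : C) :
  filterlim f F (locally l) -> lim (T := C_R_CompleteNormedModule) (filtermap f F) = l.
Proof.
  intros H.
  apply (filterlim_locally_unique (K := R_AbsRing) (V := C_R_NormedModule) (F := F) f); [|exact H].
  apply (filterlim_locally (U := C_UniformSpace)). intros eps.
  apply (complete_cauchy (T := C_R_CompleteNormedModule) (filtermap f F)).
  - apply filtermap_proper_filter, FF.
  - intros e. exists l.
    apply (proj1 (filterlim_locally (U := C_UniformSpace) f l) H e).
Qed.

(** * Continuity arcs and one-sided limits *)

Lemma disc_params_bounds (nd : nat) (th : nat -> R) (j : nat) :
  disc_params nd th -> (j < nd)%nat ->
  0 < th j /\ th j < arc_end nd th j /\ arc_end nd th j < 4 * PI /\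
  arc_end nd th j <= th j + 2 * PI /\
  (nd <> 1%nat -> arc_end nd th j < th j + 2 * PI).
Proof.
  intros [H1 [H2 H3]] Hj. pose proof (H2 j Hj). pose proof (H2 0%nat ltac:(lia)).
  unfold arc_end. destruct (Nat.ltb_spec (S j) nd) as [Hlt|Hge].
  - pose proof (H2 (S j) Hlt). pose proof (H3 j (S j) ltac:(lia) Hlt). lra.
  - destruct (Nat.eq_dec j 0) as [->|Hj0].
    + split; [lra|]. split; [lra|]. split; [lra|]. split; [lra|]. intros; lia.
    + pose proof (H3 0%nat j ltac:(lia) Hj). lra.
Qed.

Lemma contour_injective (g : R -> C) (x y : R) : contour g ->
  x < y < x + 2 * PI -> g x <> g y.
Proof.
  intros Hg Hxy E. destruct (period_reduce 0 x) as [z Hz].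
  rewrite <- (contour_period g Hg z x), <- (contour_period g Hg z y) in E.
  destruct (Rlt_dec (y + IZR z * (2 * PI)) (2 * PI)).
  - apply (contour_simple g Hg) in E; lra.
  - replace (y + IZR z * (2 * PI)) with ((y + IZR z * (2 * PI) - 2 * PI) + 2 * PI) in E by ring.
    rewrite (contour_periodic g Hg) in E. apply (contour_simple g Hg) in E; lra.
Qed.

(** The chord between two points of a completed arc is positive when the arc is shorter than a full
    period, that is for nd >= 2. For a single arc, positivity comes from integrating the
    nonvanishing speed. *)
Lemma arc_dist_bounds (g : R -> C) (nd : nat) (th : nat -> R) (L : R) :
  contour g -> disc_params nd th ->
  (forall x y, -4 * PI <= x -> x <= y -> y <= 8 * PI ->
    RInt (fun s => Cmod (curve_deriv g s)) x y <= L * (y - x)) ->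
  forall j x y, (j < nd)%nat -> th j <= x -> x < y -> y <= arc_end nd th j ->
  0 < arc_dist g nd x y <= L * (y - x) /\ Cmod (g x - g y)%C <= arc_dist g nd x y.
Proof.
  intros Hg Hth HL j x y Hj Hx Hxy Hy.
  destruct (disc_params_bounds nd th j Hth Hj) as [B1 [B2 [B3 [B4 B5]]]].
  pose proof PI_RGT_0.
  pose proof (contour_chord_le_arc g Hg x y ltac:(lra)) as Hch.
  specialize (HL x y ltac:(lra) ltac:(lra) ltac:(lra)).
  unfold arc_dist. destruct (Nat.eqb_spec nd 1) as [E|E].
  - split; [|exact Hch]. split; [|exact HL].
    apply RInt_gt_0; [exact Hxy| |].
    + intros s _. apply Cmod_gt_0, (contour_regular g Hg).
    + intros s _. apply speed_continuous, Hg.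
  - split; [|apply Rle_refl]. split; [|lra]. apply Cmod_gt_0. intros E0.
    apply (contour_injective g x y Hg); [specialize (B5 E); lra|].
    replace (g x) with ((g x - g y) + g y)%C by ring. rewrite E0. ring.
Qed.

Lemma locate_arc (nd : nat) (th : nat -> R) (x : R) : disc_params nd th ->
  exists z j, (j < nd)%nat /\ th j < x + IZR z * (2 * PI) <= arc_end nd th j.
Proof.
  intros Hth. assert (Hth' := Hth). destruct Hth' as [H1 [H2 H3]].
  (* Reducing [- x] reverses the half-open window of [period_reduce]: an arc must own its right end,
     where functions carry the incoming value. *)
  destruct (period_reduce (- (th 0%nat + 2 * PI)) (- x)) as [z Hz].
  exists (- z)%Z. rewrite opp_IZR.
  set (y := x + - IZR z * (2 * PI)).
  assert (Hy : th 0%nat < y <= th 0%nat + 2 * PI) by (unfold y; lra).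
  assert (Hn : forall n, (n < nd)%nat -> th n < y \/
    exists j, (j < nd)%nat /\ th j < y <= arc_end nd th j).
  { induction n as [|n IH]; intros Hn; [left; lra|].
    destruct (IH ltac:(lia)) as [H|H]; [|right; exact H].
    destruct (Rlt_dec (th (S n)) y); [left; assumption|].
    right. exists n. split; [lia|]. unfold arc_end.
    destruct (Nat.ltb_spec (S n) nd); [lra | lia]. }
  destruct (Hn (nd - 1)%nat ltac:(lia)) as [H|H]; [|exact H].
  exists (nd - 1)%nat. split; [lia|]. unfold arc_end.
  destruct (Nat.ltb_spec (S (nd - 1)) nd); [lia | lra].
Qed.

Lemma in_X_continuous (g : R -> C) (nd : nat) (th : nat -> R) (s : R) (v : C -> C) :
  contour g -> disc_params nd th -> 0 < s -> in_X g nd th s v ->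
  forall z j x, (j < nd)%nat -> th j < x + IZR z * (2 * PI) < arc_end nd th j ->
  continuous (fun y => v (g y)) x.
Proof.
  intros Hg Hth Hs Hv z j x Hj Hx.
  destruct (Hv j Hj) as [_ [_ [M HM]]].
  destruct (contour_lipschitz g Hg) as [L [HL [HA _]]].
  unfold continuous.
  apply (filterlim_ext (fun y => v (g (y + IZR z * (2 * PI))))).
  { intros y. rewrite contour_period by exact Hg. reflexivity. }
  rewrite <- (contour_period g Hg z x).
  apply (filterlim_comp _ _ _ (fun y => y + IZR z * (2 * PI)) (fun y => v (g y)) (locally x)
    (locally (x + IZR z * (2 * PI)))); [apply filterlim_translate|].
  set (w := x + IZR z * (2 * PI)) in *. clearbody w.
  apply (filterlim_C (locally w)). intros eps He.
  assert (Hme : 0 < eps / (Rabs M + 1)).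
  { apply Rdiv_lt_0_compat; [lra|]. pose proof (Rabs_pos M). lra. }
  destruct (hpow_small s _ Hs Hme) as [d [Hd Hsm]].
  assert (Hr : 0 < Rmin (d / L) (Rmin (w - th j) (arc_end nd th j - w))).
  { apply Rmin_case; [apply Rdiv_lt_0_compat; lra|]. apply Rmin_case; lra. }
  exists (mkposreal _ Hr). intros y Hy. apply (Rabs_def2 (y - w)) in Hy. simpl in Hy.
  pose proof (Rmin_l (d / L) (Rmin (w - th j) (arc_end nd th j - w))).
  pose proof (Rmin_r (d / L) (Rmin (w - th j) (arc_end nd th j - w))).
  pose proof (Rmin_l (w - th j) (arc_end nd th j - w)).
  pose proof (Rmin_r (w - th j) (arc_end nd th j - w)).
  assert (HLd : forall r, 0 <= r -> r < d / L -> L * r < d).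
  { intros r _ Hr'. apply Rmult_lt_reg_r with (/ L); [apply Rinv_0_lt_compat; lra|].
    replace (L * r * / L) with r by (field; lra). exact Hr'. }
  assert (Hgen : forall a b, th j < a -> a < b -> b < arc_end nd th j -> b - a < d / L ->
    Cmod (v (g a) - v (g b))%C < eps).
  { intros a b Ha Hab Hb Hd'.
    destruct (arc_dist_bounds g nd th L Hg Hth HA j a b Hj) as [[D1 D2] _]; try lra.
    eapply Rle_lt_trans; [apply HM; lra|].
    rewrite <- hpow_Rpower by exact D1.
    pose proof (hpow_ge_0 (arc_dist g nd a b) s).
    specialize (Hsm (arc_dist g nd a b)).
    specialize (HLd (b - a) ltac:(lra) Hd').
    specialize (Hsm ltac:(lra)).
    pose proof (Rle_abs M). pose proof (Rabs_pos M).
    apply Rle_lt_trans with ((Rabs M + 1) * hpow (arc_dist g nd a b) s).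
    { apply Rmult_le_compat_r; lra. }
    apply Rlt_le_trans with ((Rabs M + 1) * (eps / (Rabs M + 1))).
    { apply Rmult_lt_compat_l; lra. }
    apply Req_le. field. lra. }
  destruct (Rtotal_order y w) as [Hlt|[->|Hgt]].
  - apply Hgen; lra.
  - rewrite Cminus_diag, Cmod_0. exact He.
  - rewrite Cmod_minus_sym. apply Hgen; lra.
Qed.

(** At the end of an arc this is the normalization by incoming values; at all other points it is
    continuity. *)
Lemma in_X_left (g : R -> C) (nd : nat) (th : nat -> R) (s : R) (v : C -> C) :
  contour g -> disc_params nd th -> 0 < s -> in_X g nd th s v ->
  forall x, filterlim (fun y => v (g y)) (at_left x) (locally (v (g x))).
Proof.
  intros Hg Hth Hs Hv x. destruct (locate_arc nd th x Hth) as [z [j [Hj Hx]]].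
  destruct (Rlt_dec (x + IZR z * (2 * PI)) (arc_end nd th j)) as [Hlt|Hge].
  - apply (filterlim_at_left_of_continuous (fun y => v (g y))).
    apply (in_X_continuous g nd th s v Hg Hth Hs Hv z j x Hj). lra.
  - assert (E : x + IZR z * (2 * PI) = arc_end nd th j) by lra.
    (* The end of the last arc is [th 0] one period later. *)
    assert (Ex : exists i z', (i < nd)%nat /\ x + IZR z' * (2 * PI) = th i).
    { unfold arc_end in E. destruct (Nat.ltb_spec (S j) nd).
      - exists (S j), z. split; [lia | exact E].
      - exists 0%nat, (z - 1)%Z. split; [lia|]. rewrite minus_IZR. lra. }
    destruct Ex as [i [z' [Hi E']]]. destruct (Hv i Hi) as [Hl _]. rewrite <- E' in Hl.
    rewrite contour_period in Hl by exact Hg.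
    apply (filterlim_ext (fun y => v (g (y + IZR z' * (2 * PI))))).
    { intros y. rewrite contour_period by exact Hg. reflexivity. }
    apply (filterlim_comp _ _ _ (fun y => y + IZR z' * (2 * PI)) (fun y => v (g y))
      _ (at_left (x + IZR z' * (2 * PI)))); [apply filterlim_translate_left | exact Hl].
Qed.

Lemma in_X_right (g : R -> C) (nd : nat) (th : nat -> R) (s : R) (v : C -> C) :
  contour g -> disc_params nd th -> 0 < s -> in_X g nd th s v ->
  forall x, exists l, filterlim (fun y => v (g y)) (at_right x) (locally l).
Proof.
  intros Hg Hth Hs Hv x. destruct (locate_arc nd th x Hth) as [z [j [Hj Hx]]].
  destruct (Rlt_dec (x + IZR z * (2 * PI)) (arc_end nd th j)) as [Hlt|Hge].
  - exists (v (g x)). apply (filterlim_at_right_of_continuous (fun y => v (g y))).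
    apply (in_X_continuous g nd th s v Hg Hth Hs Hv z j x Hj). lra.
  - assert (E : x + IZR z * (2 * PI) = arc_end nd th j) by lra.
    assert (Ex : exists i z', (i < nd)%nat /\ x + IZR z' * (2 * PI) = th i).
    { unfold arc_end in E. destruct (Nat.ltb_spec (S j) nd).
      - exists (S j), z. split; [lia | exact E].
      - exists 0%nat, (z - 1)%Z. split; [lia|]. rewrite minus_IZR. lra. }
    destruct Ex as [i [z' [Hi E']]]. destruct (Hv i Hi) as [_ [[l Hl] _]]. rewrite <- E' in Hl.
    exists l. apply (filterlim_ext (fun y => v (g (y + IZR z' * (2 * PI))))).
    { intros y. rewrite contour_period by exact Hg. reflexivity. }
    apply (filterlim_comp _ _ _ (fun y => y + IZR z' * (2 * PI)) (fun y => v (g y))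
      _ (at_right (x + IZR z' * (2 * PI)))); [apply filterlim_translate_right | exact Hl].
Qed.

(** The cut divides the last arc in two, so [0, 2 PI] consists of nd + 1 such pieces. The integer
    [z] moves a piece to the parameters of its arc. *)
Definition arc_piece (nd : nat) (th : nat -> R) (a b : R) : Prop :=
  0 <= a /\ a < b /\ b <= 2 * PI /\
  exists j z, (j < nd)%nat /\
    th j <= a + IZR z * (2 * PI) /\ b + IZR z * (2 * PI) <= arc_end nd th j.

(** The index of [P] counts the pieces joined, which lets a constant grow with their number;
    qualitative properties ignore it. *)
Lemma arc_piece_chain (nd : nat) (th : nat -> R) (P : nat -> R -> R -> Prop) :
  disc_params nd th ->
  (forall a b, arc_piece nd th a b -> P 1%nat a b) ->
  (forall i j a b c, a < b -> b < c -> P i a b -> P j b c -> P (i + j)%nat a c) ->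
  P (nd + 1)%nat 0 (2 * PI).
Proof.
  intros Hth H1 Ht. assert (Hth' := Hth). destruct Hth' as [D1 [D2 D3]].
  assert (Hn : forall n, (n < nd)%nat -> P (S n) 0 (th n)).
  { induction n as [|n IH]; intros Hn.
    - apply H1. pose proof (D2 0%nat Hn). pose proof (D2 (nd - 1)%nat ltac:(lia)).
      split; [lra|]. split; [lra|]. split; [lra|].
      (* The piece after the cut belongs to the last arc, whose parameters are larger by one period
         there. *)
      exists (nd - 1)%nat, 1%Z. split; [lia|]. unfold arc_end.
      destruct (Nat.ltb_spec (S (nd - 1)) nd); [lia|]. lra.
    - pose proof (D2 n ltac:(lia)). pose proof (D2 (S n) Hn).
      pose proof (D3 n (S n) ltac:(lia) Hn).
      replace (S (S n)) with (S n + 1)%nat by lia.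
      apply Ht with (th n); [lra | lra | apply IH; lia|]. apply H1.
      split; [lra|]. split; [lra|]. split; [lra|]. exists n, 0%Z. split; [lia|].
      unfold arc_end. destruct (Nat.ltb_spec (S n) nd); [lra|lia]. }
  pose proof (D2 (nd - 1)%nat ltac:(lia)). pose proof (D2 0%nat ltac:(lia)).
  apply Ht with (th (nd - 1)%nat); [lra | lra | |].
  - replace nd with (S (nd - 1)) at 1 by lia. apply Hn. lia.
  - apply H1. split; [lra|]. split; [lra|]. split; [lra|].
    exists (nd - 1)%nat, 0%Z. split; [lia|]. unfold arc_end.
    destruct (Nat.ltb_spec (S (nd - 1)) nd); [lia|]. lra.
Qed.

Lemma in_X_integrable (g : R -> C) (nd : nat) (th : nat -> R) (s : R) (v : C -> C) :
  contour g -> disc_params nd th -> 0 < s -> in_X g nd th s v -> integrable_along g v.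
Proof.
  intros Hg Hth Hs Hv c Hc.
  apply (arc_piece_chain nd th
    (fun _ a b => ex_RInt (V := C_R_NormedModule) (fun x => c x * v (g x))%C a b) Hth).
  - intros a b [Ha [Hab [Hb [j [z [Hj Hz]]]]]].
    destruct (in_X_right g nd th s v Hg Hth Hs Hv a) as [l Hl].
    apply (ex_RInt_limits _ a b (c a * l)%C (c b * v (g b))%C Hab).
    + intros x Hx. apply (filterlim_C_mult (locally x)); [apply Hc|].
      apply (in_X_continuous g nd th s v Hg Hth Hs Hv z j x Hj). lra.
    + apply (filterlim_C_mult (at_right a)); [|exact Hl].
      apply filterlim_at_right_of_continuous, Hc.
    + apply (filterlim_C_mult (at_left b)); [|apply (in_X_left g nd th s v Hg Hth Hs Hv)].
      apply filterlim_at_left_of_continuous, Hc.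
  - intros _ _ a b d _ _. apply (ex_RInt_Chasles (V := C_R_NormedModule)).
Qed.

Lemma contour_bounded_of_param (g : R -> C) (v : C -> C) (B : R) : contour g ->
  (forall x, 0 <= x < 2 * PI -> Cmod (v (g x)) <= B) ->
  forall t, on_contour g t -> Cmod (v t) <= B.
Proof.
  intros Hg H t Ht. destruct (on_contour_param g t Hg Ht) as [H1 H2].
  rewrite <- H2. apply H, H1.
Qed.

(** Riemann integrable functions are bounded, and the weight 1 recovers [v] itself. *)
Lemma integrable_along_bounded (g : R -> C) (v : C -> C) : contour g ->
  integrable_along g v -> exists B, forall t, on_contour g t -> Cmod (v t) <= B.
Proof.
  intros Hg Hv.
  destruct (ex_RInt_ub (V := C_R_NormedModule) _ 0 (2 * PI) (Hv (fun _ => RtoC 1)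
    (fun x => filterlim_const _))) as [M HM].
  exists M. apply contour_bounded_of_param; [exact Hg|]. intros x Hx.
  pose proof PI_RGT_0. rewrite Rmin_left, Rmax_right in HM by lra.
  specialize (HM x ltac:(lra)). rewrite norm_C_R, Cmult_1_l in HM. exact HM.
Qed.

(** * Finiteness and consequences of the norm of the piecewise Hölder space *)

(** The upper bound [B] is essential: [real] sends [p_infty] to 0. *)
Lemma real_Lub_Rbar_ge (E : R -> Prop) (r B : R) :
  E r -> (forall x, E x -> x <= B) -> r <= real (Lub_Rbar E).
Proof.
  intros Hr HB. destruct (Lub_Rbar_correct E) as [H1 H2].
  specialize (H1 r Hr). specialize (H2 (Finite B) (fun x Hx => HB x Hx)).
  destruct (Lub_Rbar E); simpl in *; tauto.
Qed.

Lemma Lub_Rbar_le (E : R -> Prop) (B : R) :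
  (forall x, E x -> x <= B) -> Rbar_le (Lub_Rbar E) (Finite B).
Proof. intros HB. apply (Lub_Rbar_correct E). intros x Hx. exact (HB x Hx). Qed.

Lemma fold_Rmax_ge (l : list R) (r : R) : In r l -> r <= fold_right Rmax 0 l.
Proof.
  induction l as [|a l IH]; [intros []|]. simpl. intros [->|H].
  - apply Rmax_l.
  - eapply Rle_trans; [apply IH, H | apply Rmax_r].
Qed.

Lemma filterlim_at_right_shift (x : R) : filterlim (fun e => x + e) (at_right 0) (at_right x).
Proof.
  intros P [d Hd]. exists d. intros e He Hlt. apply Hd; [|lra].
  apply (Rabs_def2 (e - 0)) in He. apply (Rabs_def1 (x + e - x)); lra.
Qed.

Lemma filterlim_at_left_shift (y : R) : filterlim (fun e => y - e) (at_right 0) (at_left y).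
Proof.
  intros P [d Hd]. exists d. intros e He Hlt. apply Hd; [|lra].
  apply (Rabs_def2 (e - 0)) in He. apply (Rabs_def1 (y - e - y)); lra.
Qed.

Lemma arc_val_right (g : R -> C) (nd : nat) (th : nat -> R) (s : R) (v : C -> C) (j : nat) (x : R) :
  contour g -> disc_params nd th -> 0 < s -> in_X g nd th s v -> (j < nd)%nat ->
  th j <= x < arc_end nd th j ->
  filterlim (fun y => v (g y)) (at_right x) (locally (arc_val g nd th j v x)).
Proof.
  intros Hg Hth Hs Hv Hj Hx. unfold arc_val.
  destruct (Req_EM_T x (th j)) as [->|H1].
  - destruct (Hv j Hj) as [_ [[l Hl] _]]. unfold lat_out.
    rewrite (lim_eq (at_right (th j)) (fun s => v (g s)) l Hl). exact Hl.
  - destruct (Req_EM_T x (arc_end nd th j)); [lra|].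
    apply (filterlim_at_right_of_continuous (fun y => v (g y))).
    apply (in_X_continuous g nd th s v Hg Hth Hs Hv 0 j x Hj). lra.
Qed.

Lemma arc_val_left (g : R -> C) (nd : nat) (th : nat -> R) (s : R) (v : C -> C) (j : nat) (x : R) :
  contour g -> disc_params nd th -> 0 < s -> in_X g nd th s v -> (j < nd)%nat ->
  th j < x <= arc_end nd th j ->
  filterlim (fun y => v (g y)) (at_left x) (locally (arc_val g nd th j v x)).
Proof.
  intros Hg Hth Hs Hv Hj Hx. unfold arc_val.
  destruct (Req_EM_T x (th j)); [lra|].
  pose proof (in_X_left g nd th s v Hg Hth Hs Hv x) as Hl.
  destruct (Req_EM_T x (arc_end nd th j)); [|exact Hl].
  unfold lat_in. rewrite (lim_eq (at_left x) (fun s => v (g s)) _ Hl). exact Hl.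
Qed.

(** Lateral values are approached along x + e and y - e. Arc length only shrinks under this move, so
    a constant bound suffices; the chord may grow, but it is continuous and serves as its own
    bound. *)
Lemma arc_dist_inner (g : R -> C) (nd : nat) (th : nat -> R) (s x y : R) :
  contour g -> 0 < s -> x < y -> 0 < arc_dist g nd x y ->
  exists b, filterlim b (at_right 0) (locally (Rpower (arc_dist g nd x y) s)) /\
    at_right 0 (fun e => Rpower (arc_dist g nd (x + e) (y - e)) s <= b e).
Proof.
  intros Hg Hs Hxy. unfold arc_dist. destruct (Nat.eqb nd 1); intros Hpos.
  - exists (fun _ => Rpower (RInt (fun s0 => Cmod (curve_deriv g s0)) x y) s).
    split; [apply filterlim_const|].
    assert (Hd : 0 < (y - x) / 2) by lra. exists (mkposreal _ Hd).
    intros e He Hlt. apply (Rabs_def2 (e - 0)) in He. simpl in He.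
    assert (Hex : forall a b, ex_RInt (fun s0 => Cmod (curve_deriv g s0)) a b).
    { intros a b. apply (ex_RInt_continuous (V := R_CompleteNormedModule)).
      intros z _. apply speed_continuous, Hg. }
    assert (Hge : forall a b, a <= b -> 0 <= RInt (fun s0 => Cmod (curve_deriv g s0)) a b).
    { intros a b Hab. apply RInt_ge_0; [exact Hab | apply Hex|]. intros z _. apply Cmod_ge_0. }
    apply Rle_Rpower_l; [lra|]. split.
    + apply RInt_gt_0; [lra| |].
      * intros z _. apply Cmod_gt_0, (contour_regular g Hg).
      * intros z _. apply speed_continuous, Hg.
    + rewrite <- (RInt_Chasles (V := R_CompleteNormedModule) _ x (x + e) y) by apply Hex.
      rewrite <- (RInt_Chasles (V := R_CompleteNormedModule) _ (x + e) (y - e) y) by apply Hex.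
      pose proof (Hge x (x + e) ltac:(lra)). pose proof (Hge (y - e) y ltac:(lra)).
      unfold plus; simpl. lra.
  - exists (fun e => Rpower (Cmod (g (x + e)%R - g (y - e)%R)%C) s). split.
    + apply (filterlim_comp _ _ _ (fun e => Cmod (g (x + e)%R - g (y - e)%R)%C) (fun z => Rpower z s)
        _ (locally (Cmod (g x - g y)%C))).
      * apply (filterlim_ext (fun e => norm (V := C_R_NormedModule) (g (x + e)%R - g (y - e)%R)%C)).
        { intros e. apply norm_C_R. }
        rewrite <- norm_C_R.
        apply (filterlim_comp _ _ _ (fun e => (g (x + e)%R - g (y - e)%R)%C)
          (norm (V := C_R_NormedModule)) _ (locally (g x - g y)%C)).
        -- apply (filterlim_C_minus (at_right 0)).
           ++ apply (filterlim_comp _ _ _ (fun e => x + e) g _ (at_right x));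
                [apply filterlim_at_right_shift|].
              apply filterlim_at_right_of_continuous, contour_continuous, Hg.
           ++ apply (filterlim_comp _ _ _ (fun e => y - e) g _ (at_left y));
                [apply filterlim_at_left_shift|].
              apply filterlim_at_left_of_continuous, contour_continuous, Hg.
        -- apply (filterlim_norm (V := C_R_NormedModule)).
      * apply (continuous_comp (fun z => s * ln z) exp).
        -- apply (continuous_scal_r (V := R_NormedModule) s ln).
           apply continuity_pt_filterlim, derivable_continuous_pt.
           exists (/ Cmod (g x - g y)%C). apply derivable_pt_lim_ln, Hpos.
        -- apply continuity_pt_filterlim, derivable_continuous_pt, derivable_pt_exp.
    + exists (mkposreal 1 Rlt_0_1). intros e _ _. apply Rle_refl.
Qed.

(** [X_norm] takes real parts of suprema in [Rbar], so their finiteness comes first: for the values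
    by boundedness of integrable functions, for the quotients by carrying the constant of [in_X]
    from the open arc to the lateral values. On open arcs [arc_val] is [v] itself. *)
Lemma X_norm_bounds (g : R -> C) (nd : nat) (th : nat -> R) (s : R) (v : C -> C) :
  contour g -> disc_params nd th -> 0 < s -> in_X g nd th s v ->
  0 <= X_norm g nd th s v /\
  (forall j x, (j < nd)%nat -> th j < x < arc_end nd th j ->
     Cmod (v (g x)) <= X_norm g nd th s v) /\
  (forall j x y, (j < nd)%nat -> th j < x -> x < y -> y < arc_end nd th j ->
     Cmod (v (g x) - v (g y))%C <= X_norm g nd th s v * hpow (arc_dist g nd x y) s).
Proof.
  intros Hg Hth Hs Hv.
  assert (Hex : exists B, forall t, on_contour g t -> Cmod (v t) <= B).
  { apply (integrable_along_bounded g v Hg), (in_X_integrable g nd th s v Hg Hth Hs Hv). }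
  destruct Hex as [B HB].
  destruct (contour_lipschitz g Hg) as [L [HL [HA _]]].
  assert (Hsup : forall j x, (j < nd)%nat -> th j <= x <= arc_end nd th j ->
    Cmod (arc_val g nd th j v x) <= real (arc_sup g nd th j v)).
  { intros j x Hj Hx. apply real_Lub_Rbar_ge with (B := B).
    - exists x. split; [exact Hx | reflexivity].
    - intros r [y [Hy ->]]. destruct (disc_params_bounds nd th j Hth Hj) as [_ [B2 _]].
      destruct (Rlt_dec y (arc_end nd th j)).
      + apply (Cmod_limit_le (at_right y) (fun z => v (g z)) _ (fun _ => B) B).
        * apply (arc_val_right g nd th s v j y Hg Hth Hs Hv Hj). lra.
        * apply filterlim_const.
        * apply filter_forall. intros z. apply HB. exists z; reflexivity.
      + apply (Cmod_limit_le (at_left y) (fun z => v (g z)) _ (fun _ => B) B).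
        * apply (arc_val_left g nd th s v j y Hg Hth Hs Hv Hj). lra.
        * apply filterlim_const.
        * apply filter_forall. intros z. apply HB. exists z; reflexivity. }
  assert (Hhol : forall j x y, (j < nd)%nat -> th j <= x -> x < y -> y <= arc_end nd th j ->
    Cmod (arc_val g nd th j v x - arc_val g nd th j v y)%C / Rpower (arc_dist g nd x y) s
      <= real (arc_holder g nd th s j v)).
  { intros j x y Hj Hx Hxy Hy. destruct (Hv j Hj) as [_ [_ [M HM]]].
    apply real_Lub_Rbar_ge with (B := Rabs M).
    - exists x, y. tauto.
    - intros r [a [b [Ha [Hab [Hb ->]]]]].
      destruct (arc_dist_bounds g nd th L Hg Hth HA j a b Hj Ha Hab Hb) as [[D1 _] _].
      pose proof (Rpower_pos (arc_dist g nd a b) s) as HR.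
      apply Rmult_le_reg_r with (Rpower (arc_dist g nd a b) s); [exact HR|].
      unfold Rdiv. rewrite Rmult_assoc, Rinv_l, Rmult_1_r by lra.
      destruct (arc_dist_inner g nd th s a b Hg Hs Hab D1) as [bd [Hbd1 Hbd2]].
      apply (Cmod_limit_le (at_right 0) (fun e => v (g (a + e)%R) - v (g (b - e)%R))%C _
        (fun e => Rabs M * bd e)).
      + apply (filterlim_C_minus (at_right 0)).
        * apply (filterlim_comp _ _ _ (fun e => a + e) (fun z => v (g z)) _ (at_right a));
            [apply filterlim_at_right_shift|].
          apply (arc_val_right g nd th s v j a Hg Hth Hs Hv Hj). lra.
        * apply (filterlim_comp _ _ _ (fun e => b - e) (fun z => v (g z)) _ (at_left b));
            [apply filterlim_at_left_shift|].
          apply (arc_val_left g nd th s v j b Hg Hth Hs Hv Hj). lra.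
      + apply (filterlim_comp _ _ _ bd (fun z => Rabs M * z) _ (locally (Rpower (arc_dist g nd a b) s)) _ Hbd1).
        apply (continuous_scal_r (V := R_NormedModule) (Rabs M) (fun z => z)), continuous_id.
      + assert (Hd : 0 < (b - a) / 2) by lra.
        generalize (filter_and _ _ (at_right_lt 0 ((b - a) / 2) Hd) Hbd2).
        apply filter_imp. intros e [He1 He2].
        eapply Rle_trans; [apply HM; lra|].
        eapply Rle_trans; [apply Rmult_le_compat_r; [apply Rlt_le, Rpower_pos | apply Rle_abs]|].
        apply Rmult_le_compat_l; [apply Rabs_pos | exact He2]. }
  assert (Hsum : forall j, (j < nd)%nat ->
    real (arc_sup g nd th j v) + real (arc_holder g nd th s j v) <= X_norm g nd th s v).
  { intros j Hj. apply fold_Rmax_ge.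
    apply (in_map (fun j => real (arc_sup g nd th j v) + real (arc_holder g nd th s j v))).
    apply in_seq. lia. }
  assert (Hpos : forall j, (j < nd)%nat ->
    0 <= real (arc_sup g nd th j v) /\ 0 <= real (arc_holder g nd th s j v)).
  { intros j Hj. destruct (disc_params_bounds nd th j Hth Hj) as [_ [B2 _]]. split.
    - eapply Rle_trans; [|apply (Hsup j (th j) Hj); lra]. apply Cmod_ge_0.
    - eapply Rle_trans; [|apply (Hhol j (th j) (arc_end nd th j) Hj); lra].
      apply Rmult_le_pos; [apply Cmod_ge_0 | apply Rlt_le, Rinv_0_lt_compat, Rpower_pos]. }
  assert (Hval : forall j x, (j < nd)%nat -> th j < x < arc_end nd th j ->
    arc_val g nd th j v x = v (g x)).
  { intros j x Hj Hx. unfold arc_val. destruct (Req_EM_T x (th j)); [lra|].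
    destruct (Req_EM_T x (arc_end nd th j)); [lra | reflexivity]. }
  split; [|split].
  - destruct Hth as [H1 _]. destruct (Hpos 0%nat H1). specialize (Hsum 0%nat H1). lra.
  - intros j x Hj Hx. rewrite <- (Hval j x Hj Hx).
    specialize (Hsup j x Hj ltac:(lra)). specialize (Hsum j Hj). destruct (Hpos j Hj). lra.
  - intros j x y Hj Hx Hxy Hy.
    specialize (Hhol j x y Hj ltac:(lra) Hxy ltac:(lra)).
    destruct (arc_dist_bounds g nd th L Hg Hth HA j x y Hj ltac:(lra) Hxy ltac:(lra)) as [[D1 _] _].
    rewrite (Hval j x Hj), (Hval j y Hj) in Hhol by lra.
    specialize (Hsum j Hj). destruct (Hpos j Hj).
    rewrite hpow_Rpower by exact D1.
    pose proof (Rpower_pos (arc_dist g nd x y) s) as HR.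
    apply Rmult_le_reg_r with (/ Rpower (arc_dist g nd x y) s); [apply Rinv_0_lt_compat, HR|].
    rewrite (Rmult_assoc (X_norm g nd th s v)), Rinv_r, Rmult_1_r by lra.
    unfold Rdiv in Hhol. lra.
Qed.

(** The discontinuity points lie on no open arc; their values are limits from the left of values on
    open arcs. *)
Lemma X_norm_sup (g : R -> C) (nd : nat) (th : nat -> R) (s : R) (v : C -> C) :
  contour g -> disc_params nd th -> 0 < s -> in_X g nd th s v ->
  forall t, on_contour g t -> Cmod (v t) <= X_norm g nd th s v.
Proof.
  intros Hg Hth Hs Hv t [x ->].
  destruct (X_norm_bounds g nd th s v Hg Hth Hs Hv) as [_ [HN _]].
  destruct (locate_arc nd th x Hth) as [z [j [Hj Hx]]].
  rewrite <- (contour_period g Hg z x). set (y := x + IZR z * (2 * PI)) in *.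
  apply (Cmod_limit_le (at_left y) (fun w => v (g w)) _ (fun _ => X_norm g nd th s v)).
  - apply (in_X_left g nd th s v Hg Hth Hs Hv).
  - apply filterlim_const.
  - generalize (at_left_gt (th j) y ltac:(lra)). apply filter_imp. intros w Hw.
    apply (HN j w Hj). lra.
Qed.

Lemma jump_spec (g : R -> C) (nd : nat) (th : nat -> R) (s : R) (v : C -> C) (l : C) (j : nat) :
  in_X g nd th s v -> (j < nd)%nat ->
  filterlim (fun y => v (g y)) (at_right (th j)) (locally l) ->
  jump g v (th j) = (l - v (g (th j)))%C.
Proof.
  intros Hv Hj Hl. destruct (Hv j Hj) as [Hl' _].
  unfold jump, lat_out, lat_in.
  rewrite (lim_eq (at_right (th j)) (fun s => v (g s)) l Hl).
  rewrite (lim_eq (at_left (th j)) (fun s => v (g s)) _ Hl'). reflexivity.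
Qed.

Lemma jump_bound (g : R -> C) (nd : nat) (th : nat -> R) (s : R) (v : C -> C) (j : nat) :
  contour g -> disc_params nd th -> 0 < s -> in_X g nd th s v -> (j < nd)%nat ->
  Cmod (jump g v (th j)) <= 2 * X_norm g nd th s v.
Proof.
  intros Hg Hth Hs Hv Hj. destruct (in_X_right g nd th s v Hg Hth Hs Hv (th j)) as [l Hl].
  rewrite (jump_spec g nd th s v l j Hv Hj Hl).
  eapply Rle_trans; [apply Cmod_minus_le|].
  pose proof (X_norm_sup g nd th s v Hg Hth Hs Hv) as HN.
  assert (Cmod l <= X_norm g nd th s v).
  { apply (Cmod_limit_le (at_right (th j)) (fun w => v (g w)) _ (fun _ => X_norm g nd th s v)).
    - exact Hl.
    - apply filterlim_const.
    - apply filter_forall. intros w. apply HN. exists w; reflexivity. }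
  pose proof (HN (g (th j)) ltac:(exists (th j); reflexivity)). lra.
Qed.

(** * The continuous part of the data *)

Lemma sum_n_C_S (a : nat -> C) (n : nat) : sum_n a (S n) = (sum_n a n + a (S n))%C.
Proof. exact (sum_Sn a n). Qed.

Lemma sum_n_C_0 (a : nat -> C) : sum_n a 0 = a 0%nat.
Proof. exact (sum_O a). Qed.

Lemma Cmod_sum_n_le (a : nat -> C) (b : nat -> R) (n : nat) :
  (forall i, (i <= n)%nat -> Cmod (a i) <= b i) -> Cmod (sum_n a n) <= sum_n b n.
Proof.
  induction n as [|n IH]; intros H.
  - rewrite sum_n_C_0, sum_O. apply H. lia.
  - rewrite sum_n_C_S, sum_Sn. eapply Rle_trans; [apply Cmod_triangle|].
    apply Rplus_le_compat; [apply IH; intros i Hi; apply H; lia | apply H; lia].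
Qed.

Lemma sum_n_R_const (b : R) (n : nat) : sum_n (fun _ => b) n = INR (S n) * b.
Proof. rewrite sum_n_const. reflexivity. Qed.

Lemma sum_n_C_minus (a b : nat -> C) (n : nat) :
  (sum_n a n - sum_n b n)%C = sum_n (fun i => a i - b i)%C n.
Proof.
  induction n as [|n IH].
  - rewrite !sum_n_C_0. reflexivity.
  - rewrite !sum_n_C_S, <- IH. ring_C.
Qed.

Lemma sum_n_C_mult_r (a : nat -> C) (z : C) (n : nat) :
  sum_n (fun i => a i * z)%C n = (sum_n a n * z)%C.
Proof.
  induction n as [|n IH].
  - rewrite !sum_n_C_0. reflexivity.
  - rewrite !sum_n_C_S, IH. ring_C.
Qed.

Lemma sum_n_C_delta (a : nat -> C) (i n : nat) : (i <= n)%nat ->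
  sum_n (fun j => a j * RtoC (if Nat.eq_dec j i then 1 else 0))%C n = a i.
Proof.
  assert (H0 : forall n, (n < i)%nat ->
    sum_n (fun j => a j * RtoC (if Nat.eq_dec j i then 1 else 0))%C n = RtoC 0).
  { clear n. induction n as [|n IH]; intros Hn.
    - rewrite sum_n_C_0. destruct (Nat.eq_dec 0 i); [lia | ring_C].
    - rewrite sum_n_C_S, IH by lia. destruct (Nat.eq_dec (S n) i); [lia | ring_C]. }
  induction n as [|n IH]; intros Hn.
  - rewrite sum_n_C_0. destruct (Nat.eq_dec 0 i); [subst; ring_C | lia].
  - rewrite sum_n_C_S. destruct (Nat.eq_dec (S n) i) as [<-|Hne].
    + rewrite H0 by lia. ring_C.
    + rewrite IH by lia. ring_C.
Qed.

(* The values of the generator G_j along the parameter interval, whose two ends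
   are the two sides of the cut. *)
Lemma gen_G_param (g : R -> C) (nd : nat) (th : nat -> R) (j : nat) (x : R) :
  contour g -> disc_params nd th -> (j < nd)%nat -> 0 <= x <= 2 * PI ->
  gen_G g th j (g x) = (if Rle_dec x (th j) then 0 else 1) - x / (2 * PI).
Proof.
  intros Hg [_ [H2 _]] Hj Hx. specialize (H2 j Hj). pose proof PI_RGT_0.
  unfold gen_G, gen_H, gen_R. destruct (Rlt_dec x (2 * PI)).
  - rewrite param_contour by (auto; lra). reflexivity.
  - replace x with (0 + 2 * PI) by lra. rewrite (contour_periodic g Hg).
    rewrite param_contour by (auto; lra).
    destruct (Rle_dec 0 (th j)); [|lra]. destruct (Rle_dec (0 + 2 * PI) (th j)); [lra|].
    field. lra.
Qed.

(** A negative [z] is impossible, z = 0 is settled by the order of the [th], and a positive [z]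
    places the piece before [th 0]. *)
Lemma arc_piece_avoids (nd : nat) (th : nat -> R) (a b : R) (i : nat) :
  disc_params nd th -> arc_piece nd th a b -> (i < nd)%nat -> th i <= a \/ b <= th i.
Proof.
  intros Hth [Ha [Hab [Hb [j [z [Hj [Hz1 Hz2]]]]]]] Hi.
  assert (Hth' := Hth). destruct Hth' as [_ [D2 D3]].
  pose proof (D2 i Hi) as Bi. pose proof (D2 j Hj) as Bj.
  pose proof (D2 0%nat ltac:(lia)) as B0. pose proof PI_RGT_0 as HP.
  destruct (Rle_dec (th i) a) as [|N1]; [left; assumption|].
  destruct (Rle_dec b (th i)) as [|N2]; [right; assumption|]. exfalso.
  assert (Hle : forall p q, (p <= q)%nat -> (q < nd)%nat -> th p <= th q).
  { intros p q Hpq Hq. destruct (Nat.eq_dec p q) as [->|]; [lra|].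
    apply Rlt_le, D3; lia. }
  pose proof (Hle 0%nat i ltac:(lia) Hi) as H0i.
  assert (Hend : arc_end nd th j <= th 0%nat + 2 * PI).
  { unfold arc_end. destruct (Nat.ltb_spec (S j) nd); [|lra].
    pose proof (D2 (S j) ltac:(lia)). lra. }
  destruct (Z.lt_trichotomy z 0) as [Hz|[->|Hz]].
  - assert (IZR z <= -1) by (apply IZR_le; lia).
    assert (IZR z * (2 * PI) <= -1 * (2 * PI)) by (apply Rmult_le_compat_r; lra). lra.
  - destruct (Nat.le_gt_cases i j) as [Hij|Hij].
    + pose proof (Hle i j Hij Hj). lra.
    + pose proof (Hle (S j) i ltac:(lia) Hi). unfold arc_end in Hz2.
      destruct (Nat.ltb_spec (S j) nd); [lra | lia].
  - assert (1 <= IZR z) by (apply IZR_le; lia).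
    assert (1 * (2 * PI) <= IZR z * (2 * PI)) by (apply Rmult_le_compat_r; lra). lra.
Qed.

(** Along a piece, H_j can change only at the left end, because x = th j still carries the value 0.
    The rest of the increment is the linear ramp R. *)
Lemma jump_part_increment (g : R -> C) (nd : nat) (th : nat -> R) (f : C -> C) (a b x y : R) :
  contour g -> disc_params nd th -> arc_piece nd th a b -> a <= x -> x < y -> y <= b ->
  (jump_part g nd th f (g y) - jump_part g nd th f (g x))%C =
  (sum_n (fun j => jump g f (th j) * RtoC (if Req_EM_T x (th j) then 1 else 0))%C (nd - 1) -
   sum_n (fun j => jump g f (th j)) (nd - 1) * RtoC ((y - x) / (2 * PI)))%C.
Proof.
  intros Hg Hth Hp Hx Hxy Hy.
  unfold jump_part. rewrite sum_n_C_minus, <- sum_n_C_mult_r, sum_n_C_minus.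
  apply sum_n_ext_loc. intros j Hj.
  assert (Hth' := Hth). destruct Hth' as [D1 _]. assert (Hjn : (j < nd)%nat) by lia.
  pose proof (arc_piece_avoids nd th a b j Hth Hp Hjn) as Hav.
  destruct Hp as [Ha [Hab [Hb _]]].
  rewrite !(gen_G_param g nd th j) by (auto; lra).
  transitivity (jump g f (th j) * RtoC ((if Req_EM_T x (th j) then 1 else 0) - (y - x) / (2 * PI)))%C.
  2: { rewrite RtoC_minus. ring_C. }
  transitivity (jump g f (th j) * RtoC ((if Rle_dec y (th j) then 0 else 1) - y / (2 * PI) -
     ((if Rle_dec x (th j) then 0 else 1) - x / (2 * PI))))%C.
  { rewrite (RtoC_minus (_ - y / _)). ring_C. }
  f_equal. f_equal. pose proof PI_RGT_0.
  destruct (Req_EM_T x (th j)); destruct (Rle_dec y (th j)); destruct (Rle_dec x (th j));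
    try lra; field; lra.
Qed.

Lemma jump_sum_bound (g : R -> C) (nd : nat) (th : nat -> R) (s : R) (v : C -> C) :
  contour g -> disc_params nd th -> 0 < s -> in_X g nd th s v ->
  Cmod (sum_n (fun j => jump g v (th j)) (nd - 1)) <= INR nd * (2 * X_norm g nd th s v).
Proof.
  intros Hg Hth Hs Hv. assert (Hth' := Hth). destruct Hth' as [D1 _].
  eapply Rle_trans.
  - apply (Cmod_sum_n_le _ (fun _ => 2 * X_norm g nd th s v)). intros i Hi.
    apply (jump_bound g nd th s v i Hg Hth Hs Hv). lia.
  - rewrite sum_n_R_const. replace (S (nd - 1)) with nd by lia. lra.
Qed.

(** At the left end of a piece the value of [v] is the incoming one and belongs to the previous arc,
    so the outgoing limit [l] takes its place. *)
Lemma in_X_piece_holder (g : R -> C) (nd : nat) (th : nat -> R) (s L : R) (v : C -> C)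
  (a b x y : R) (l : C) :
  contour g -> disc_params nd th -> 0 < s <= 1 -> in_X g nd th s v -> 1 <= L ->
  (forall x y, -4 * PI <= x -> x <= y -> y <= 8 * PI ->
    RInt (fun s => Cmod (curve_deriv g s)) x y <= L * (y - x)) ->
  arc_piece nd th a b -> a <= x -> x < y -> y <= b ->
  filterlim (fun w => v (g w)) (at_right x) (locally l) ->
  Cmod (l - v (g y))%C <= X_norm g nd th s v * (L * hpow (y - x) s).
Proof.
  intros Hg Hth Hs Hv HL HA Hp Hx Hxy Hy Hl.
  destruct (X_norm_bounds g nd th s v Hg Hth (proj1 Hs) Hv) as [HN0 [_ HN]].
  destruct Hp as [Ha [Hab [Hb [j [z [Hj [Hz1 Hz2]]]]]]].
  apply (Cmod_limit_le (at_right 0) (fun e => v (g (x + e)%R) - v (g (y - e)%R))%C _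
    (fun _ => X_norm g nd th s v * (L * hpow (y - x) s))).
  - apply (filterlim_C_minus (at_right 0)).
    + apply (filterlim_comp _ _ _ (fun e => x + e) (fun w => v (g w)) _ (at_right x));
        [apply filterlim_at_right_shift | exact Hl].
    + apply (filterlim_comp _ _ _ (fun e => y - e) (fun w => v (g w)) _ (at_left y));
        [apply filterlim_at_left_shift|].
      apply (in_X_left g nd th s v Hg Hth (proj1 Hs) Hv).
  - apply filterlim_const.
  - assert (Hd : 0 < (y - x) / 2) by lra.
    generalize (at_right_lt 0 ((y - x) / 2) Hd). apply filter_imp. intros e He.
    rewrite <- (contour_period g Hg z (x + e)), <- (contour_period g Hg z (y - e)).
    eapply Rle_trans; [apply (HN j); [exact Hj | lra | lra | lra]|].
    apply Rmult_le_compat_l; [exact HN0|].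
    destruct (arc_dist_bounds g nd th L Hg Hth HA j (x + e + IZR z * (2 * PI))
      (y - e + IZR z * (2 * PI)) Hj) as [[D1 D2] _]; try lra.
    apply Rle_trans with (hpow (L * (y - x)) s).
    + apply hpow_le; [lra|]. eapply Rle_trans; [apply D2|]. apply Rmult_le_compat_l; lra.
    + rewrite hpow_mult by lra. apply Rmult_le_compat_r; [apply hpow_ge_0|].
      rewrite hpow_Rpower by lra. rewrite <- (Rpower_1 L) at 2 by lra.
      apply Rle_Rpower; lra.
Qed.

Lemma in_X_right_cases (g : R -> C) (nd : nat) (th : nat -> R) (s : R) (v : C -> C) (x : R) :
  contour g -> disc_params nd th -> 0 < s -> in_X g nd th s v -> 0 <= x < 2 * PI ->
  continuous (fun y => v (g y)) x \/ exists i, (i < nd)%nat /\ x = th i.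
Proof.
  intros Hg Hth Hs Hv Hx. destruct (locate_arc nd th x Hth) as [z [j [Hj Hz]]].
  destruct (Rlt_dec (x + IZR z * (2 * PI)) (arc_end nd th j)) as [Hlt|Hge].
  - left. apply (in_X_continuous g nd th s v Hg Hth Hs Hv z j x Hj). lra.
  - right. assert (E : x + IZR z * (2 * PI) = arc_end nd th j) by lra.
    assert (Ex : exists i z', (i < nd)%nat /\ x + IZR z' * (2 * PI) = th i).
    { unfold arc_end in E. destruct (Nat.ltb_spec (S j) nd).
      - exists (S j), z. split; [lia | exact E].
      - exists 0%nat, (z - 1)%Z. split; [lia|]. rewrite minus_IZR. lra. }
    destruct Ex as [i [z' [Hi E']]]. exists i. split; [exact Hi|].
    destruct Hth as [_ [D2 _]]. specialize (D2 i Hi). pose proof PI_RGT_0.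
    assert (z' = 0)%Z as ->; [|lra].
    assert (-1 < IZR z' < 1) as [H1 H2].
    { split; apply Rmult_lt_reg_r with (2 * PI); lra. }
    apply (lt_IZR (-1)) in H1. apply (lt_IZR z' 1) in H2. lia.
Qed.

Lemma th_injective (nd : nat) (th : nat -> R) (i j : nat) : disc_params nd th ->
  (i < nd)%nat -> (j < nd)%nat -> th i = th j -> i = j.
Proof.
  intros [_ [_ D3]] Hi Hj E. destruct (Nat.lt_trichotomy i j) as [H|[H|H]]; [|exact H|].
  - specialize (D3 i j H Hj). lra.
  - specialize (D3 j i H Hi). lra.
Qed.

(** On one piece, the step of [jump_part] at its left end replaces f by its outgoing limit there;
    then the Hölder estimate of the arc applies, and the ramp is Lipschitz. Since y = 2 PI is
    allowed, the estimate reaches the cut from both sides. *)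
Lemma cont_part_holder (g : R -> C) (nd : nat) (th : nat -> R) (s : R) :
  contour g -> disc_params nd th -> 0 < s <= 1 ->
  exists A, 0 <= A /\ forall f, in_X g nd th s f ->
  forall x y, 0 <= x -> x < y -> y <= 2 * PI ->
  Cmod (cont_part g nd th f (g x) - cont_part g nd th f (g y))%C
    <= A * X_norm g nd th s f * hpow (y - x) s.
Proof.
  intros Hg Hth Hs. destruct (contour_lipschitz g Hg) as [L [HL [HA _]]].
  pose proof (pos_INR nd) as Hnd. pose proof (pos_INR (nd + 1)) as Hnd1.
  (* [L] belongs to the arc estimate; 2 nd bounds the ramp, whose slope is a sum of nd jumps of size
     at most 2 [X_norm]. The nd + 1 pieces give the remaining factor. *)
  set (A0 := L + 2 * INR nd).
  exists (INR (nd + 1) * A0). split.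
  { apply Rmult_le_pos; [exact Hnd1 | unfold A0; lra]. }
  intros f Hf.
  destruct (X_norm_bounds g nd th s f Hg Hth (proj1 Hs) Hf) as [HN0 _].
  set (N := X_norm g nd th s f) in *.
  apply (arc_piece_chain nd th (fun i a b => forall x y, a <= x -> x < y -> y <= b ->
    Cmod (cont_part g nd th f (g x) - cont_part g nd th f (g y))%C
    <= INR i * A0 * N * hpow (y - x) s) Hth).
  - intros a b Hp x y Hx Hxy Hy. simpl (INR 1). rewrite Rmult_1_l.
    assert (Hp' := Hp). destruct Hp' as [Ha [Hab [Hb _]]].
    (* At most one step is located at [x], and it is exactly the jump of [f] there. It is zero when
       [f] happens to be continuous at a point of [th]. *)
    assert (Hl : exists l, filterlim (fun w => f (g w)) (at_right x) (locally l) /\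
      sum_n (fun j => jump g f (th j) * RtoC (if Req_EM_T x (th j) then 1 else 0))%C (nd - 1) =
        (l - f (g x))%C).
    { destruct (in_X_right_cases g nd th s f x Hg Hth (proj1 Hs) Hf ltac:(lra)) as [Hc|[i [Hi ->]]].
      - destruct (classic (exists i, (i < nd)%nat /\ x = th i)) as [[i [Hi ->]]|Hno].
        + exists (f (g (th i))). split; [apply (filterlim_at_right_of_continuous (fun w => f (g w))), Hc|].
          rewrite (sum_n_ext_loc _ (fun j => jump g f (th j) * RtoC (if Nat.eq_dec j i then 1 else 0))%C).
          * rewrite sum_n_C_delta by lia. apply (jump_spec g nd th s f _ i Hf Hi).
            apply (filterlim_at_right_of_continuous (fun w => f (g w))), Hc.
          * intros j Hj. f_equal. f_equal.
            destruct (Req_EM_T (th i) (th j)) as [E|E]; destruct (Nat.eq_dec j i) as [E'|E']; try reflexivity.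
            -- exfalso. apply E'. symmetry. apply (th_injective nd th i j Hth Hi); [lia | exact E].
            -- subst. tauto.
        + exists (f (g x)). split; [apply (filterlim_at_right_of_continuous (fun w => f (g w))), Hc|].
          rewrite Cminus_diag.
          rewrite (sum_n_ext_loc _ (fun j => RtoC 0 * RtoC 0)%C).
          * rewrite (sum_n_C_mult_r (fun _ => RtoC 0)). ring_C.
          * intros j Hj. destruct (Req_EM_T x (th j)) as [E|E]; [|ring_C].
            exfalso. apply Hno. exists j. destruct Hth as [D1 _]. split; [lia | exact E].
      - destruct (Hf i Hi) as [_ [[l Hl] _]]. exists l. split; [exact Hl|].
        rewrite (sum_n_ext_loc _ (fun j => jump g f (th j) * RtoC (if Nat.eq_dec j i then 1 else 0))%C).
        + rewrite sum_n_C_delta by lia. apply (jump_spec g nd th s f l i Hf Hi Hl).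
        + intros j Hj. f_equal. f_equal.
          destruct (Req_EM_T (th i) (th j)) as [E|E]; destruct (Nat.eq_dec j i) as [E'|E']; try reflexivity.
          -- exfalso. apply E'. symmetry. apply (th_injective nd th i j Hth Hi); [lia | exact E].
          -- subst. tauto. }
    destruct Hl as [l [Hl Hsum]].
    pose proof (jump_part_increment g nd th f a b x y Hg Hth Hp Hx Hxy Hy) as HJ.
    rewrite Hsum in HJ.
    set (S0 := sum_n (fun j => jump g f (th j)) (nd - 1)) in *.
    replace (cont_part g nd th f (g x) - cont_part g nd th f (g y))%C with
      ((l - f (g y)) - S0 * RtoC ((y - x) / (2 * PI)))%C.
    2: { unfold cont_part.
      replace (f (g x) - jump_part g nd th f (g x) - (f (g y) - jump_part g nd th f (g y)))%C
        with (f (g x) - f (g y) + (jump_part g nd th f (g y) - jump_part g nd th f (g x)))%C by ring.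
      rewrite HJ. ring. }
    eapply Rle_trans; [apply Cmod_minus_le|].
    pose proof (in_X_piece_holder g nd th s L f a b x y l Hg Hth Hs Hf HL HA Hp Hx Hxy Hy Hl) as H1.
    fold N in H1.
    pose proof (jump_sum_bound g nd th s f Hg Hth (proj1 Hs) Hf) as H2. fold S0 N in H2.
    rewrite Cmod_mult, Cmod_R. pose proof PI_RGT_0. pose proof PI2_1.
    (* With q = (y - x) / (2 PI) <= 1 the chain is q <= q^s <= (y - x)^s. *)
    assert (H3 : Rabs ((y - x) / (2 * PI)) <= hpow (y - x) s).
    { assert (Hq : 0 < (y - x) / (2 * PI)) by (apply Rdiv_lt_0_compat; lra).
      assert (Hq' : (y - x) / (2 * PI) * (2 * PI) = y - x) by (field; lra).
      assert (Hq1 : (y - x) / (2 * PI) <= 1).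
      { apply Rmult_le_reg_r with (2 * PI); lra. }
      rewrite Rabs_right by lra. set (q := (y - x) / (2 * PI)) in *.
      apply Rle_trans with (hpow q s).
      - rewrite hpow_Rpower by exact Hq. rewrite <- (Rpower_1 q) at 1 by exact Hq.
        unfold Rpower.
        assert (ln q <= 0) by (rewrite <- ln_1; apply Rcomplements.ln_le; lra).
        destruct (Rle_lt_or_eq_dec (1 * ln q) (s * ln q)) as [Hlt|Heq].
        + nra.
        + apply Rlt_le, exp_increasing, Hlt.
        + rewrite Heq. apply Rle_refl.
      - apply hpow_le; [lra|]. nra. }
    pose proof (hpow_ge_0 (y - x) s) as Hh.
    apply Rle_trans with (N * (L * hpow (y - x) s) + INR nd * (2 * N) * hpow (y - x) s).
    + apply Rplus_le_compat; [exact H1|].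
      apply Rmult_le_compat; [apply Cmod_ge_0 | apply Rabs_pos | exact H2 | exact H3].
    + apply Req_le. unfold A0. ring.
  (* Two points on different sides of [b] cost the sum of both constants, since each partial
     distance is at most y - x. *)
  - intros i j a b c Hab Hbc P1 P2 x y Hx Hxy Hy.
    assert (HA0 : 0 <= A0) by (unfold A0; lra).
    pose proof (pos_INR i) as Hi. pose proof (pos_INR j) as Hj.
    assert (HAN : 0 <= A0 * N) by (apply Rmult_le_pos; assumption).
    rewrite plus_INR. 
    assert (Hh : forall r, r <= y - x -> hpow r s <= hpow (y - x) s).
    { intros r Hr. apply hpow_le; lra. }
    pose proof (hpow_ge_0 (y - x) s) as Hh0.
    assert (Hk : forall p r, 0 <= p -> r <= y - x -> p * A0 * N * hpow r s <= p * (A0 * N * hpow (y - x) s)).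
    { intros p r Hp Hr. replace (p * A0 * N * hpow r s) with (p * (A0 * N * hpow r s)) by ring.
      apply Rmult_le_compat_l; [exact Hp|]. apply Rmult_le_compat_l; [exact HAN|]. apply Hh, Hr. }
    assert (HZ : 0 <= A0 * N * hpow (y - x) s) by (apply Rmult_le_pos; assumption).
    replace ((INR i + INR j) * A0 * N * hpow (y - x) s) with
      (INR i * (A0 * N * hpow (y - x) s) + INR j * (A0 * N * hpow (y - x) s)) by ring.
    assert (Hi' := Rmult_le_pos _ _ Hi HZ). assert (Hj' := Rmult_le_pos _ _ Hj HZ).
    destruct (Rle_dec y b) as [Hyb|Hyb]; [|destruct (Rle_dec b x) as [Hbx|Hbx]].
    + specialize (P1 x y Hx Hxy Hyb). specialize (Hk (INR i) (y - x) Hi (Rle_refl _)). lra.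
    + specialize (P2 x y Hbx Hxy Hy). specialize (Hk (INR j) (y - x) Hj (Rle_refl _)). lra.
    + specialize (P1 x b Hx ltac:(lra) ltac:(lra)). specialize (P2 b y ltac:(lra) ltac:(lra) Hy).
      pose proof (Hk (INR i) (b - x) Hi ltac:(lra)). pose proof (Hk (INR j) (y - b) Hj ltac:(lra)).
      eapply Rle_trans; [apply (Cmod_minus_triangle _ (cont_part g nd th f (g b)))|]. lra.
Qed.

(** Stencils near the cut leave [0, 2 PI]; the detour through the cut point costs the factor 2. *)
Lemma cont_part_holder_periodic (g : R -> C) (nd : nat) (th : nat -> R) (s : R) :
  contour g -> disc_params nd th -> 0 < s <= 1 ->
  exists A, 0 <= A /\ forall f, in_X g nd th s f ->
  forall x y, 0 <= x <= 2 * PI -> - (2 * PI) <= y <= 4 * PI ->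
  Cmod (cont_part g nd th f (g x) - cont_part g nd th f (g y))%C
    <= A * X_norm g nd th s f * hpow (Rabs (x - y)) s.
Proof.
  intros Hg Hth Hs. destruct (cont_part_holder g nd th s Hg Hth Hs) as [A [HA H]].
  exists (2 * A). split; [lra|]. intros f Hf.
  destruct (X_norm_bounds g nd th s f Hg Hth (proj1 Hs) Hf) as [HN0 _].
  specialize (H f Hf). set (F := fun x => cont_part g nd th f (g x)).
  set (B := A * X_norm g nd th s f) in *.
  assert (HB : 0 <= B) by (apply Rmult_le_pos; assumption).
  replace (2 * A * X_norm g nd th s f) with (2 * B) by (unfold B; ring).
  assert (Hsym : forall x y d, 0 <= x <= 2 * PI -> 0 <= y <= 2 * PI -> Rabs (x - y) <= d ->
    Cmod (F x - F y)%C <= B * hpow d s).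
  { intros x y d Hx Hy Hd.
    apply Rle_trans with (B * hpow (Rabs (x - y)) s).
    2: { apply Rmult_le_compat_l; [exact HB|]. apply hpow_le; lra. }
    destruct (Rtotal_order x y) as [Hlt|[->|Hgt]].
    - rewrite Rabs_left by lra. replace (- (x - y)) with (y - x) by ring. apply H; lra.
    - rewrite Cminus_diag, Cmod_0. apply Rmult_le_pos; [exact HB | apply hpow_ge_0].
    - rewrite Rabs_right by lra. rewrite Cmod_minus_sym. apply H; lra. }
  assert (HF : forall x, F (x + 2 * PI) = F x).
  { intros x. unfold F. rewrite (contour_periodic g Hg). reflexivity. }
  intros x y Hx Hy. change (Cmod (F x - F y)%C <= 2 * B * hpow (Rabs (x - y)) s).
  pose proof (hpow_ge_0 (Rabs (x - y)) s). pose proof PI_RGT_0.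
  assert (0 <= B * hpow (Rabs (x - y)) s) by (apply Rmult_le_pos; assumption).
  destruct (Rlt_dec y 0) as [Hy0|Hy0]; [|destruct (Rlt_dec (2 * PI) y) as [Hy1|Hy1]].
  - assert (E : Rabs (x - y) = x - y) by (apply Rabs_right; lra).
    pose proof (Hsym x 0 (Rabs (x - y)) Hx ltac:(lra)) as E1.
    rewrite (Rabs_right (x - 0)) in E1 by lra. specialize (E1 ltac:(lra)).
    pose proof (Hsym (0 + 2 * PI) (y + 2 * PI) (Rabs (x - y)) ltac:(lra) ltac:(lra)) as E2.
    rewrite (Rabs_right (0 + 2 * PI - _)) in E2 by lra. specialize (E2 ltac:(lra)).
    rewrite !HF in E2.
    eapply Rle_trans; [apply (Cmod_minus_triangle _ (F 0))|]. lra.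
  - assert (E : Rabs (x - y) = y - x) by (rewrite Rabs_left; lra).
    pose proof (Hsym x (0 + 2 * PI) (Rabs (x - y)) Hx ltac:(lra)) as E1.
    rewrite (Rabs_left1 (x - _)) in E1 by lra. specialize (E1 ltac:(lra)).
    pose proof (Hsym 0 (y - 2 * PI) (Rabs (x - y)) ltac:(lra) ltac:(lra)) as E2.
    rewrite (Rabs_left1 (0 - _)) in E2 by lra. specialize (E2 ltac:(lra)).
    rewrite HF in E1. rewrite <- (HF (y - 2 * PI)) in E2.
    replace (y - 2 * PI + 2 * PI) with y in E2 by ring.
    eapply Rle_trans; [apply (Cmod_minus_triangle _ (F 0))|]. lra.
  - pose proof (Hsym x y (Rabs (x - y)) Hx ltac:(lra) (Rle_refl _)). lra.
Qed.

(** J_f is the difference of [f] and f_C, one integrable piecewise and the other continuous, so the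
    steps are not treated separately. *)
Lemma jump_part_integrable (g : R -> C) (nd : nat) (th : nat -> R) (s : R) (f : C -> C) :
  contour g -> disc_params nd th -> 0 < s <= 1 -> in_X g nd th s f ->
  integrable_along g (jump_part g nd th f).
Proof.
  intros Hg Hth Hs Hf.
  apply (integrable_along_ext g (fun t => f t - cont_part g nd th f t)%C).
  { intros x _. unfold cont_part. ring. }
  apply integrable_along_minus.
  { apply (in_X_integrable g nd th s f Hg Hth (proj1 Hs) Hf). }
  destruct (cont_part_holder_periodic g nd th s Hg Hth Hs) as [A [HA H]].
  specialize (H f Hf).
  destruct (X_norm_bounds g nd th s f Hg Hth (proj1 Hs) Hf) as [HN0 _].
  apply (integrable_along_continuous g _ (fun x => cont_part g nd th f (g x))); [|reflexivity].
  intros x Hx. apply (filterlim_C (locally x)). intros eps He.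
  set (B := A * X_norm g nd th s f) in *.
  assert (HB : 0 <= B) by (apply Rmult_le_pos; assumption).
  assert (He' : 0 < eps / (B + 1)) by (apply Rdiv_lt_0_compat; lra).
  destruct (hpow_small s _ (proj1 Hs) He') as [d [Hd Hsm]].
  assert (Hd' : 0 < Rmin d 1) by (apply Rmin_case; lra).
  exists (mkposreal _ Hd'). intros y Hy.
  assert (Hy' : Rabs (x - y) < Rmin d 1) by (rewrite Rabs_minus_sym; exact Hy).
  pose proof (Rmin_l d 1). pose proof (Rmin_r d 1). pose proof PI2_1.
  assert (Hy'' := Hy'). apply Rabs_def2 in Hy''.
  rewrite Cmod_minus_sym.
  eapply Rle_lt_trans; [apply H; lra|].
  specialize (Hsm (Rabs (x - y)) ltac:(lra)).
  pose proof (hpow_ge_0 (Rabs (x - y)) s).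
  apply Rle_lt_trans with ((B + 1) * hpow (Rabs (x - y)) s); [apply Rmult_le_compat_r; lra|].
  apply Rlt_le_trans with ((B + 1) * (eps / (B + 1))); [apply Rmult_lt_compat_l; lra|].
  apply Req_le. field. lra.
Qed.

(** * Stability of the second-kind equation in the supremum norm *)

(** Weaker than a subsequence: the indices r need not increase. The bound n <= r is what Cauchy
    conditions and the growth of the extracted indices use. *)
Definition tail_subseq (s' s : nat -> nat) (N : nat) : Prop :=
  forall n, (N <= n)%nat -> exists r, (n <= r)%nat /\ s' n = s r.

Lemma tail_subseq_trans (s1 s2 s3 : nat -> nat) (N : nat) :
  tail_subseq s1 s2 N -> tail_subseq s2 s3 0 -> tail_subseq s1 s3 N.
Proof.
  intros H1 H2 n Hn. destruct (H1 n Hn) as [r [Hr ->]].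
  destruct (H2 r ltac:(lia)) as [r' [Hr' ->]]. exists r'. split; [lia | reflexivity].
Qed.

(** From index k on, the diagonal is a tail of the refinement made for [P k], and the properties are
    stable under passing to tails. *)
Lemma diagonal_subsequence (P : nat -> (nat -> nat) -> Prop) :
  (forall k s, exists s', tail_subseq s' s 0 /\ P k s') ->
  (forall k s s' N, P k s -> tail_subseq s' s N -> P k s') ->
  exists s, (forall n, (n <= s n)%nat) /\ forall k, P k s.
Proof.
  intros Hex Hst.
  set (next := fun k s => proj1_sig (constructive_indefinite_description _ (Hex k s))).
  assert (Hnext : forall k s, tail_subseq (next k s) s 0 /\ P k (next k s)).
  { intros k s. apply (proj2_sig (constructive_indefinite_description _ (Hex k s))). }
  set (S_ := fix S_ k := match k with O => (fun n => n) | S k' => next k' (S_ k') end).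
  assert (Hsub : forall d k, tail_subseq (S_ (d + k)%nat) (S_ k) 0).
  { induction d as [|d IH]; intros k.
    - intros n _. exists n. split; [lia | reflexivity].
    - apply tail_subseq_trans with (S_ (d + k)%nat); [apply (Hnext (d + k)%nat) | apply IH]. }
  (* The shift by one matters: [P k] holds from the refinement [S_ (S k)] on. *)
  exists (fun n => S_ (S n) n). split.
  - intros n. destruct (Hsub (S n) 0%nat n ltac:(lia)) as [r [Hr E]].
    rewrite Nat.add_0_r in E. rewrite E. exact Hr.
  - intros k. apply (Hst k (S_ (S k)) _ k); [apply Hnext|].
    intros n Hn. destruct (Hsub (n - k)%nat (S k) n ltac:(lia)) as [r [Hr E]].
    exists r. split; [exact Hr|]. rewrite <- E. f_equal. lia.
Qed.

Definition cauchy_along (u : nat -> R) (s : nat -> nat) : Prop :=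
  forall eps, 0 < eps -> exists N, forall p q, (N <= p)%nat -> (N <= q)%nat ->
    Rabs (u (s p) - u (s q)) < eps.

Lemma cauchy_along_tail (u : nat -> R) (s s' : nat -> nat) (N : nat) :
  cauchy_along u s -> tail_subseq s' s N -> cauchy_along u s'.
Proof.
  intros Hc Ht eps He. destruct (Hc eps He) as [N1 HN1]. exists (N + N1)%nat.
  intros p q Hp Hq. destruct (Ht p ltac:(lia)) as [r [Hr ->]].
  destruct (Ht q ltac:(lia)) as [r' [Hr' ->]]. apply HN1; lia.
Qed.

Lemma bounded_cauchy_subsequence (u : nat -> R) (M : R) (s : nat -> nat) :
  (forall n, Rabs (u n) <= M) ->
  exists s', tail_subseq s' s 0 /\ cauchy_along u s'.
Proof.
  intros HM.
  destruct (Bolzano_Weierstrass (fun n => u (s n)) (fun c => - M <= c <= M)) as [l Hl].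
  { apply compact_P3. }
  { intros n. apply Rabs_le_between, HM. }
  assert (Hp : forall n, exists p, (n <= p)%nat /\ Rabs (u (s p) - l) < / INR (S n)).
  { intros n. assert (Hd : 0 < / INR (S n)) by (apply Rinv_0_lt_compat, lt_0_INR; lia).
    apply (Hl (fun x => Rabs (x - l) < / INR (S n)) n).
    exists (mkposreal _ Hd). intros x Hx. exact Hx. }
  set (p := fun n => proj1_sig (constructive_indefinite_description _ (Hp n))).
  assert (Hp' : forall n, (n <= p n)%nat /\ Rabs (u (s (p n)) - l) < / INR (S n)).
  { intros n. apply (proj2_sig (constructive_indefinite_description _ (Hp n))). }
  exists (fun n => s (p n)). split.
  - intros n _. exists (p n). split; [apply Hp' | reflexivity].
  - intros eps He. destruct (nfloor_ex (2 / eps)) as [N HN].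
    { apply Rlt_le, Rdiv_lt_0_compat; lra. }
    exists N. assert (Hs : forall n, (N <= n)%nat -> Rabs (u (s (p n)) - l) < eps / 2).
    { intros n Hn. eapply Rlt_le_trans; [apply Hp'|].
      assert (Hn' : 2 / eps < INR (S n)).
      { apply Rlt_le_trans with (INR N + 1); [lra|]. rewrite <- S_INR. apply le_INR. lia. }
      replace (eps / 2) with (/ (2 / eps)) by (field; lra).
      apply Rlt_le, Rinv_lt_contravar; [|exact Hn'].
      apply Rmult_lt_0_compat; [apply Rdiv_lt_0_compat; lra | apply lt_0_INR; lia]. }
    intros a b Ha Hb. pose proof (Hs a Ha). pose proof (Hs b Hb).
    replace (u (s (p a)) - u (s (p b))) with ((u (s (p a)) - l) - (u (s (p b)) - l)) by ring.
    eapply Rle_lt_trans; [apply Rabs_triang|]. rewrite Rabs_Ropp. lra.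
Qed.

Lemma Cmod_le_parts (z : C) : Cmod z <= Rabs (fst z) + Rabs (snd z).
Proof.
  replace z with (RtoC (fst z) + Ci * RtoC (snd z))%C at 1.
  - eapply Rle_trans; [apply Cmod_triangle|].
    rewrite Cmod_mult, Cmod_Ci, !Cmod_R. lra.
  - destruct z as [a b]. apply injective_projections; simpl; ring.
Qed.

Lemma Cmod_ge_parts (z : C) : Rabs (fst z) <= Cmod z /\ Rabs (snd z) <= Cmod z.
Proof.
  pose proof (Rmax_Cmod z). pose proof (Rmax_l (Rabs (fst z)) (Rabs (snd z))).
  pose proof (Rmax_r (Rabs (fst z)) (Rabs (snd z))). lra.
Qed.

(* Block s = sqrt k runs through the multiples of 2 PI / (s + 1). *)
Definition grid_point (k : nat) : R :=
  Rmin (2 * PI) (INR (k - Nat.sqrt k * Nat.sqrt k) * (2 * PI / INR (S (Nat.sqrt k)))).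

Lemma grid_point_bounds (k : nat) : 0 <= grid_point k <= 2 * PI.
Proof.
  pose proof PI_RGT_0. unfold grid_point. split; [|apply Rmin_l].
  apply Rmin_case; [lra|]. apply Rmult_le_pos; [apply pos_INR|].
  apply Rlt_le, Rdiv_lt_0_compat; [lra | apply lt_0_INR; lia].
Qed.

Lemma grid_dense (d : R) : 0 < d ->
  exists K, forall x, 0 <= x <= 2 * PI -> exists k, (k <= K)%nat /\ Rabs (x - grid_point k) < d.
Proof.
  intros Hd. pose proof PI_RGT_0 as HP.
  destruct (nfloor_ex (2 * PI / d)) as [N HN].
  { apply Rlt_le, Rdiv_lt_0_compat; lra. }
  set (s := S N).
  assert (Hs0 : 0 < INR (S s)) by (apply lt_0_INR; lia).
  assert (Hstep : 2 * PI / INR (S s) < d).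
  { apply Rmult_lt_reg_r with (INR (S s)); [exact Hs0|].
    replace (2 * PI / INR (S s) * INR (S s)) with (2 * PI) by (field; lra).
    assert (2 * PI / d < INR (S s)).
    { unfold s. rewrite !S_INR. lra. }
    apply Rmult_lt_reg_r with (/ d); [apply Rinv_0_lt_compat; lra|].
    replace (d * INR (S s) * / d) with (INR (S s)) by (field; lra). lra. }
  exists (s * s + S s)%nat. intros x Hx.
  set (w := 2 * PI / INR (S s)) in *.
  assert (Hw : 0 < w) by (apply Rdiv_lt_0_compat; lra).
  destruct (nfloor_ex (x / w)) as [i Hi].
  { apply Rmult_le_pos; [lra | apply Rlt_le, Rinv_0_lt_compat, Hw]. }
  assert (Hxw : x / w * w = x) by (field; lra).
  assert (Hww : INR (S s) * w = 2 * PI) by (unfold w; field; lra).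
  assert (Hi' : INR i * w <= x < INR i * w + w).
  { set (q := x / w) in *. split; [|]; nra. }
  assert (His : (i <= S s)%nat).
  { apply INR_le. apply Rmult_le_reg_r with w; lra. }
  exists (s * s + i)%nat. split; [lia|].
  (* As s >= 1, the offset satisfies i <= s + 1 <= 2 s, so s^2 + i stays below (s + 1)^2 and inside
     its block. *)
  assert (Esq : Nat.sqrt (s * s + i) = s).
  { apply Nat.sqrt_unique. unfold s in *. simpl. lia. }
  unfold grid_point. rewrite Esq. replace (s * s + i - s * s)%nat with i by lia.
  fold w. rewrite Rmin_right by lra. rewrite Rabs_right by lra. lra.
Qed.

(** Diagonal extraction gives convergence at every point of a countable dense grid; equicontinuity
    then lets finitely many grid points control the whole interval. *)
Lemma arzela_ascoli (z : nat -> R -> C) (B : R) :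
  (forall n x, 0 <= x <= 2 * PI -> Cmod (z n x) <= B) ->
  (forall eps, 0 < eps -> exists d, 0 < d /\ forall n x y, 0 <= x <= 2 * PI -> 0 <= y <= 2 * PI ->
     Rabs (x - y) < d -> Cmod (z n x - z n y)%C < eps) ->
  exists s, (forall n, (n <= s n)%nat) /\
    forall eps, 0 < eps -> exists N, forall p q x, (N <= p)%nat -> (N <= q)%nat ->
      0 <= x <= 2 * PI -> Cmod (z (s p) x - z (s q) x)%C < eps.
Proof.
  intros HB Heq.
  destruct (diagonal_subsequence (fun k s =>
    cauchy_along (fun n => fst (z n (grid_point k))) s /\
    cauchy_along (fun n => snd (z n (grid_point k))) s)) as [s [Hs Hc]].
  - intros k s.
    assert (Hb : forall n, Cmod (z n (grid_point k)) <= B).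
    { intros n. apply HB, grid_point_bounds. }
    destruct (bounded_cauchy_subsequence (fun n => fst (z n (grid_point k))) B s) as [s1 [H1 H1c]].
    { intros n. eapply Rle_trans; [apply Cmod_ge_parts | apply Hb]. }
    destruct (bounded_cauchy_subsequence (fun n => snd (z n (grid_point k))) B s1) as [s2 [H2 H2c]].
    { intros n. eapply Rle_trans; [apply Cmod_ge_parts | apply Hb]. }
    exists s2. split; [exact (tail_subseq_trans _ _ _ _ H2 H1)|]. split; [|exact H2c].
    exact (cauchy_along_tail _ _ _ _ H1c H2).
  - intros k s s' N [H1 H2] Ht. split; eapply cauchy_along_tail; eassumption.
  - exists s. split; [exact Hs|]. intros eps He.
    destruct (Heq (eps / 4) ltac:(lra)) as [d [Hd Hd']].
    destruct (grid_dense d Hd) as [K HK].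
    assert (HN : forall K', exists N, forall k p q, (k <= K')%nat -> (N <= p)%nat -> (N <= q)%nat ->
      Cmod (z (s p) (grid_point k) - z (s q) (grid_point k))%C < eps / 4).
    { assert (H1 : forall k, exists N, forall p q, (N <= p)%nat -> (N <= q)%nat ->
        Cmod (z (s p) (grid_point k) - z (s q) (grid_point k))%C < eps / 4).
      { intros k. destruct (Hc k) as [C1 C2].
        destruct (C1 (eps / 8) ltac:(lra)) as [N1 HN1]. destruct (C2 (eps / 8) ltac:(lra)) as [N2 HN2].
        exists (N1 + N2)%nat. intros p q Hp Hq.
        eapply Rle_lt_trans; [apply Cmod_le_parts|].
        specialize (HN1 p q ltac:(lia) ltac:(lia)). specialize (HN2 p q ltac:(lia) ltac:(lia)).
        simpl. unfold Rminus in HN1, HN2. lra. }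
      induction K' as [|K' [N IH]].
      - destruct (H1 0%nat) as [N HN]. exists N. intros k p q Hk.
        replace k with 0%nat by lia. apply HN.
      - destruct (H1 (S K')) as [N' HN']. exists (N + N')%nat. intros k p q Hk Hp Hq.
        destruct (Nat.eq_dec k (S K')) as [->|Hne]; [apply HN'; lia | apply IH; lia]. }
    destruct (HN K) as [N HN']. exists N. intros p q x Hp Hq Hx.
    destruct (HK x Hx) as [k [Hk Hkx]].
    pose proof (grid_point_bounds k) as Hb.
    pose proof (Hd' (s p) x (grid_point k) Hx Hb Hkx) as E1.
    pose proof (Hd' (s q) x (grid_point k) Hx Hb Hkx) as E2.
    specialize (HN' k p q Hk Hp Hq).
    eapply Rle_lt_trans; [apply (Cmod_minus_triangle _ (z (s p) (grid_point k)))|].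
    eapply Rle_lt_trans; [apply Rplus_le_compat_l, (Cmod_minus_triangle _ (z (s q) (grid_point k)))|].
    rewrite (Cmod_minus_sym (z (s q) (grid_point k))). lra.
Qed.

(** * Hölder functions on the contour and approximate kernel elements *)

Lemma contour_diameter (g : R -> C) : contour g ->
  exists D, 1 <= D /\ forall t s, on_contour g t -> on_contour g s -> Cmod (t - s)%C <= D.
Proof.
  intros Hg. destruct (contour_lipschitz g Hg) as [L [HL [_ [HLip _]]]].
  pose proof PI2_1.
  exists (L * (2 * PI)). split.
  { rewrite <- (Rmult_1_l 1). apply Rmult_le_compat; lra. }
  intros t s Ht Hs.
  destruct (on_contour_param g t Hg Ht) as [H1 H2]. destruct (on_contour_param g s Hg Hs) as [H3 H4].
  rewrite <- H2, <- H4. eapply Rle_trans; [apply HLip; lra|].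
  apply Rmult_le_compat_l; [lra|]. apply Rabs_le. lra.
Qed.

Lemma holder_continuous (g : R -> C) (v : C -> C) (M mu : R) : contour g -> 0 < mu ->
  (forall t s, on_contour g t -> on_contour g s -> Cmod (v t - v s)%C <= M * hpow (Cmod (t - s)%C) mu) ->
  forall x, continuous (fun y => v (g y)) x.
Proof.
  intros Hg Hmu HM x. apply (filterlim_C (locally x)). intros eps He.
  pose proof (Rabs_pos M). pose proof (Rle_abs M).
  assert (He' : 0 < eps / (Rabs M + 1)) by (apply Rdiv_lt_0_compat; lra).
  destruct (hpow_small mu _ Hmu He') as [d [Hd Hsm]].
  pose proof (contour_continuous g Hg x) as Hc. unfold continuous in Hc.
  rewrite (filterlim_C (locally x)) in Hc.
  generalize (Hc d Hd). apply filter_imp. intros y Hy.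
  eapply Rle_lt_trans; [apply HM; [exists y | exists x]; reflexivity|].
  specialize (Hsm _ Hy). pose proof (hpow_ge_0 (Cmod (g y - g x)%C) mu).
  apply Rle_lt_trans with ((Rabs M + 1) * hpow (Cmod (g y - g x)%C) mu).
  { apply Rmult_le_compat_r; lra. }
  apply Rlt_le_trans with ((Rabs M + 1) * (eps / (Rabs M + 1))).
  { apply Rmult_lt_compat_l; lra. }
  apply Req_le. field. lra.
Qed.

(** Brings images under K into the space where injectivity is assumed: chords are at most arc
    distances, and the exponent is lowered on a bounded set. *)
Lemma holder_in_X (g : R -> C) (nd : nat) (th : nat -> R) (v : C -> C) (M beta mu : R) :
  contour g -> disc_params nd th -> 0 < beta <= mu -> mu <= 1 ->
  (forall t s, on_contour g t -> on_contour g s -> Cmod (v t - v s)%C <= M * hpow (Cmod (t - s)%C) mu) ->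
  in_X g nd th beta v.
Proof.
  intros Hg Hth Hb Hmu HM j Hj.
  pose proof (holder_continuous g v M mu Hg ltac:(lra) HM) as Hc.
  split; [apply (filterlim_at_left_of_continuous (fun y => v (g y))), Hc|].
  split.
  { exists (v (g (th j))). apply (filterlim_at_right_of_continuous (fun y => v (g y))), Hc. }
  destruct (contour_diameter g Hg) as [D [HD HDiam]].
  destruct (contour_lipschitz g Hg) as [L [HL [HA _]]].
  exists (Rabs M * D). intros x y Hx Hxy Hy.
  destruct (arc_dist_bounds g nd th L Hg Hth HA j x y Hj ltac:(lra) Hxy ltac:(lra)) as [[D1 _] D3].
  assert (Ox : on_contour g (g x)) by (exists x; reflexivity).
  assert (Oy : on_contour g (g y)) by (exists y; reflexivity).
  eapply Rle_trans; [apply HM; assumption|].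
  rewrite <- hpow_Rpower by exact D1.
  pose proof (hpow_ge_0 (Cmod (g x - g y)%C) mu).
  apply Rle_trans with (Rabs M * hpow (Cmod (g x - g y)%C) mu).
  { apply Rmult_le_compat_r; [assumption | apply Rle_abs]. }
  rewrite Rmult_assoc. apply Rmult_le_compat_l; [apply Rabs_pos|].
  apply Rle_trans with (D * hpow (Cmod (g x - g y)%C) beta).
  - apply hpow_exponent_le; try lra. apply HDiam; assumption.
  - apply Rmult_le_compat_l; [lra|]. apply hpow_le; lra.
Qed.

Lemma C_cauchy_limit (u : nat -> C) :
  (forall eps, 0 < eps -> exists N, forall p q, (N <= p)%nat -> (N <= q)%nat -> Cmod (u p - u q)%C < eps) ->
  exists l, forall eps, 0 < eps -> exists N, forall n, (N <= n)%nat -> Cmod (u n - l)%C < eps.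
Proof.
  intros Hc.
  destruct (proj1 (filterlim_locally_cauchy (U := C_R_CompleteNormedModule) (F := eventually) u)) as [l Hl].
  - intros eps. destruct (Hc eps (cond_pos eps)) as [N HN].
    exists (fun n => (N <= n)%nat). split; [exists N; auto|].
    intros p q Hp Hq. apply (norm_compat1 (V := C_R_NormedModule)).
    rewrite norm_C_R. apply HN; assumption.
  - exists l. intros eps He. exact (proj1 (filterlim_C eventually u l) Hl eps He).
Qed.

(** The estimate fails with constant n + 1 for some v; dividing v by its supremum S makes the
    residual r / S <= 1 / (n + 1). The supremum may not be attained, hence the lower bound 1/2
    instead of 1. *)
Lemma not_stable_sequence (g : R -> C) (k : C -> C -> C) (mu : R) (lambda : C) :
  contour g -> kernel_regular g k mu ->
  ~ (exists Cst, 0 <= Cst /\ forall v r, integrable_along g v ->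
      (forall t, on_contour g t -> Cmod (v t - lambda * opK g k v t)%C <= r) ->
      forall t, on_contour g t -> Cmod (v t) <= Cst * r) ->
  forall n : nat, exists w, integrable_along g w /\
    (forall t, on_contour g t -> Cmod (w t) <= 1) /\
    (forall t, on_contour g t -> Cmod (w t - lambda * opK g k w t)%C <= / INR (S n)) /\
    (exists t, on_contour g t /\ / 2 <= Cmod (w t)).
Proof.
  intros Hg Hk Hno n. apply NNPP. intros Hn. apply Hno.
  assert (Hn0 : 0 < INR (S n)) by (apply lt_0_INR; lia).
  exists (INR (S n)). split; [lra|]. intros v r Hv Hr t0 Ht0.
  apply Rnot_lt_le. intros Hlt. apply Hn.
  destruct (integrable_along_bounded g v Hg Hv) as [B HB].
  destruct (completeness (fun x => exists t, on_contour g t /\ x = Cmod (v t))) as [S [HS1 HS2]].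
  { exists B. intros x [t [Ht ->]]. apply HB, Ht. }
  { exists (Cmod (v t0)), t0. auto. }
  assert (Hr0 : 0 <= r).
  { eapply Rle_trans; [apply Cmod_ge_0 | apply (Hr t0 Ht0)]. }
  assert (HSle : forall t, on_contour g t -> Cmod (v t) <= S).
  { intros t Ht. apply HS1. exists t. auto. }
  pose proof (HSle t0 Ht0) as HSt0.
  assert (HS : 0 < S).
  { apply Rlt_le_trans with (Cmod (v t0)); [|exact HSt0].
    eapply Rle_lt_trans; [|exact Hlt]. apply Rmult_le_pos; lra. }
  assert (Hex : exists t, on_contour g t /\ S / 2 < Cmod (v t)).
  { apply NNPP. intros Hne. assert (S <= S / 2); [|lra].
    apply HS2. intros x [t [Ht ->]]. apply Rnot_lt_le. intros H. apply Hne. exists t. auto. }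
  assert (Habs : Cmod (RtoC (/ S)) = / S).
  { rewrite Cmod_R. apply Rabs_right. apply Rle_ge, Rlt_le, Rinv_0_lt_compat, HS. }
  assert (HiS : 0 < / S) by (apply Rinv_0_lt_compat, HS).
  exists (fun t => RtoC (/ S) * v t)%C. split; [|split; [|split]].
  - apply integrable_along_scal, Hv.
  - intros t Ht. rewrite Cmod_mult, Habs.
    replace 1 with (/ S * S) by (field; lra). apply Rmult_le_compat_l; [lra | apply HSle, Ht].
  - intros t Ht. rewrite (opK_scal g k mu) by assumption.
    replace (RtoC (/ S) * v t - lambda * (RtoC (/ S) * opK g k v t))%C
      with (RtoC (/ S) * (v t - lambda * opK g k v t))%C by ring.
    rewrite Cmod_mult, Habs.
    apply Rle_trans with (/ S * r).
    { apply Rmult_le_compat_l; [lra | apply Hr, Ht]. }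
    apply Rmult_le_reg_l with S; [exact HS|].
    replace (S * (/ S * r)) with r by (field; lra).
    apply Rmult_le_reg_r with (INR (Datatypes.S n)); [exact Hn0|].
    rewrite Rmult_assoc, Rinv_l, Rmult_1_r by lra. lra.
  - destruct Hex as [t [Ht Hgt]]. exists t. split; [exact Ht|].
    rewrite Cmod_mult, Habs. apply Rmult_le_reg_l with S; [exact HS|].
    replace (S * (/ S * Cmod (v t))) with (Cmod (v t)) by (field; lra). lra.
Qed.

(* Normalized near-solutions w_n have equi-Hölder images K w_n; a limit of a
   subsequence would be a nonzero element of the kernel. *)
Lemma second_kind_stability (g : R -> C) (nd : nat) (th : nat -> R) (k : C -> C -> C)
  (beta mu : R) (lambda : C) :
  contour g -> disc_params nd th -> 0 < beta <= mu -> mu <= 1 -> kernel_regular g k mu ->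
  (forall v : C -> C, in_X g nd th beta v ->
     (forall t : C, on_contour g t -> (v t - lambda * opK g k v t)%C = RtoC 0) ->
     forall t : C, on_contour g t -> v t = RtoC 0) ->
  exists Cst, 0 <= Cst /\ forall v r, integrable_along g v ->
    (forall t, on_contour g t -> Cmod (v t - lambda * opK g k v t)%C <= r) ->
    forall t, on_contour g t -> Cmod (v t) <= Cst * r.
Proof.
  intros Hg Hth Hb Hmu Hk Hker. apply NNPP. intros Hno.
  pose proof (not_stable_sequence g k mu lambda Hg Hk Hno) as Hw.
  set (w := fun n => proj1_sig (constructive_indefinite_description _ (Hw n))).
  assert (Hw' : forall n, integrable_along g (w n) /\
    (forall t, on_contour g t -> Cmod (w n t) <= 1) /\
    (forall t, on_contour g t -> Cmod (w n t - lambda * opK g k (w n) t)%C <= / INR (S n)) /\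
    (exists t, on_contour g t /\ / 2 <= Cmod (w n t))).
  { intros n. apply (proj2_sig (constructive_indefinite_description _ (Hw n))). }
  clearbody w.
  destruct (opK_smoothing g k mu Hg Hk) as [A [HA HK]].
  destruct (contour_lipschitz g Hg) as [L [HL [_ [HLip _]]]].
  assert (Hon : forall x, on_contour g (g x)) by (intros x; exists x; reflexivity).
  destruct (arzela_ascoli (fun n x => opK g k (w n) (g x)) (A * 1)) as [s [Hs Hcau]].
  { intros n x _. destruct (Hw' n) as [W1 [W2 _]]. apply (HK (w n) 1 W1 W2), Hon. }
  { intros eps He. assert (He' : 0 < eps / A) by (apply Rdiv_lt_0_compat; lra).
    destruct (hpow_small mu _ ltac:(lra) He') as [d [Hd Hsm]].
    exists (d / L). split; [apply Rdiv_lt_0_compat; lra|].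
    intros n x y Hx Hy Hxy. destruct (Hw' n) as [W1 [W2 _]]. pose proof PI_RGT_0.
    eapply Rle_lt_trans; [apply (HK (w n) 1 W1 W2); apply Hon|].
    assert (Hdist : Cmod (g x - g y)%C < d).
    { eapply Rle_lt_trans; [apply HLip; lra|].
      replace d with (L * (d / L)) by (field; lra). apply Rmult_lt_compat_l; lra. }
    specialize (Hsm _ Hdist). rewrite Rmult_1_r.
    replace eps with (A * (eps / A)) by (field; lra). apply Rmult_lt_compat_l; lra. }
  assert (Hcau' : forall eps, 0 < eps -> exists N, forall p q t, (N <= p)%nat -> (N <= q)%nat ->
    on_contour g t -> Cmod (opK g k (w (s p)) t - opK g k (w (s q)) t)%C < eps).
  { intros eps He. destruct (Hcau eps He) as [N HN]. exists N. intros p q t Hp Hq Ht.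
    destruct (on_contour_param g t Hg Ht) as [H1 H2]. rewrite <- H2. apply HN; [exact Hp | exact Hq | lra]. }
  (* The limit is chosen for every [t], on or off the contour, so that [Z] is a total function. *)
  assert (Hlim : forall t, exists l, on_contour g t -> forall eps, 0 < eps -> exists N, forall n,
    (N <= n)%nat -> Cmod (opK g k (w (s n)) t - l)%C < eps).
  { intros t. destruct (classic (on_contour g t)) as [Ht|Ht].
    - destruct (C_cauchy_limit (fun n => opK g k (w (s n)) t)) as [l Hl].
      { intros eps He. destruct (Hcau' eps He) as [N HN]. exists N. intros p q Hp Hq. apply HN; assumption. }
      exists l. intros _. exact Hl.
    - exists (RtoC 0). intros H; contradiction. }
  set (Z := fun t => proj1_sig (constructive_indefinite_description _ (Hlim t))).
  assert (HZ : forall t, on_contour g t -> forall eps, 0 < eps -> exists N, forall n,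
    (N <= n)%nat -> Cmod (opK g k (w (s n)) t - Z t)%C < eps).
  { intros t. apply (proj2_sig (constructive_indefinite_description _ (Hlim t))). }
  clearbody Z.
  assert (HZu : forall eps, 0 < eps -> exists N, forall n t, (N <= n)%nat -> on_contour g t ->
    Cmod (opK g k (w (s n)) t - Z t)%C <= eps).
  { intros eps He. destruct (Hcau' (eps / 2) ltac:(lra)) as [N HN]. exists N. intros n t Hn Ht.
    destruct (HZ t Ht (eps / 2) ltac:(lra)) as [N' HN'].
    specialize (HN n (N + N')%nat t Hn ltac:(lia) Ht). specialize (HN' (N + N')%nat ltac:(lia)).
    eapply Rle_trans; [apply (Cmod_minus_triangle _ (opK g k (w (s (N + N')%nat)) t))|]. lra. }
  assert (HZh : forall t r, on_contour g t -> on_contour g r ->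
    Cmod (Z t - Z r)%C <= A * hpow (Cmod (t - r)%C) mu).
  { intros t r Ht Hr. apply Rnot_lt_le. intros Hlt.
    set (gap := Cmod (Z t - Z r)%C - A * hpow (Cmod (t - r)%C) mu) in *.
    assert (Hgap : 0 < gap / 4) by (unfold gap; lra).
    destruct (HZu _ Hgap) as [N HN].
    pose proof (HN N t (Nat.le_refl N) Ht) as E1. pose proof (HN N r (Nat.le_refl N) Hr) as E2.
    destruct (Hw' (s N)) as [W1 [W2 _]].
    pose proof (proj2 (HK (w (s N)) 1 W1 W2) t r Ht Hr) as E3.
    pose proof (Cmod_minus_triangle (Z t) (opK g k (w (s N)) t) (Z r)) as E4.
    pose proof (Cmod_minus_triangle (opK g k (w (s N)) t) (opK g k (w (s N)) r) (Z r)) as E5.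
    rewrite (Cmod_minus_sym (Z t) (opK g k (w (s N)) t)) in E4. rewrite Rmult_1_r in E3. unfold gap in *. lra. }
  (* Since the residuals of w_n tend to 0, the w_n themselves converge to lambda Z. This form of the
     limit makes it Hölder although the w_n are merely bounded. *)
  set (v := fun t => (lambda * Z t)%C).
  assert (Hvh : forall t r, on_contour g t -> on_contour g r ->
    Cmod (v t - v r)%C <= (Cmod lambda * A) * hpow (Cmod (t - r)%C) mu).
  { intros t r Ht Hr. unfold v. replace (lambda * Z t - lambda * Z r)%C with (lambda * (Z t - Z r))%C by ring.
    rewrite Cmod_mult, Rmult_assoc. apply Rmult_le_compat_l; [apply Cmod_ge_0 | apply HZh; assumption]. }
  assert (Hvi : integrable_along g v).
  { apply (integrable_along_continuous g v (fun x => v (g x))); [|reflexivity].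
    intros x _. apply (holder_continuous g v _ mu Hg ltac:(lra) Hvh). }
  assert (Hwv : forall eps, 0 < eps -> exists N, forall n t, (N <= n)%nat -> on_contour g t ->
    Cmod (w (s n) t - v t)%C <= eps).
  { intros eps He. pose proof (Cmod_ge_0 lambda) as Hl.
    assert (He' : 0 < eps / (2 * (Cmod lambda + 1))) by (apply Rdiv_lt_0_compat; lra).
    destruct (HZu _ He') as [N HN].
    destruct (nfloor_ex (2 / eps)) as [N2 HN2].
    { apply Rlt_le, Rdiv_lt_0_compat; lra. }
    exists (N + N2)%nat. intros n t Hn Ht.
    specialize (HN n t ltac:(lia) Ht).
    destruct (Hw' (s n)) as [_ [_ [W3 _]]]. specialize (W3 t Ht).
    assert (Hinv : / INR (S (s n)) <= eps / 2).
    { replace (eps / 2) with (/ (2 / eps)) by (field; lra).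
      apply Rinv_le_contravar; [apply Rdiv_lt_0_compat; lra|].
      apply Rle_trans with (INR N2 + 1); [lra|]. rewrite <- S_INR. apply le_INR.
      pose proof (Hs n). lia. }
    eapply Rle_trans; [apply (Cmod_minus_triangle _ (lambda * opK g k (w (s n)) t)%C)|].
    unfold v. replace (lambda * opK g k (w (s n)) t - lambda * Z t)%C
      with (lambda * (opK g k (w (s n)) t - Z t))%C by ring.
    rewrite Cmod_mult.
    assert (Cmod lambda * Cmod (opK g k (w (s n)) t - Z t)%C <=
      (Cmod lambda + 1) * (eps / (2 * (Cmod lambda + 1)))).
    { apply Rmult_le_compat; [exact Hl | apply Cmod_ge_0 | lra | exact HN]. }
    replace ((Cmod lambda + 1) * (eps / (2 * (Cmod lambda + 1)))) with (eps / 2) in * by (field; lra).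
    lra. }
  (* K w_n tends to Z by construction and to K v because K is bounded in the supremum norm. *)
  assert (HKv : forall t, on_contour g t -> opK g k v t = Z t).
  { intros t Ht. assert (E : Cmod (opK g k v t - Z t)%C <= 0).
    { apply Rnot_lt_le. intros Hlt. set (gap := Cmod (opK g k v t - Z t)%C) in *.
      destruct (Hwv (gap / (4 * A))) as [N HN]; [apply Rdiv_lt_0_compat; lra|].
      destruct (HZu (gap / 4)) as [N' HN']; [lra|].
      specialize (HN' (N + N')%nat t ltac:(lia) Ht).
      destruct (Hw' (s (N + N')%nat)) as [W1 _].
      pose proof (HK (fun t => w (s (N + N')%nat) t - v t)%C (gap / (4 * A))
        (integrable_along_minus g _ _ W1 Hvi)
        (fun t Ht => HN (N + N')%nat t ltac:(lia) Ht)) as [E1 _].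
      specialize (E1 t Ht). rewrite (opK_minus g k mu) in E1 by assumption.
      replace (A * (gap / (4 * A))) with (gap / 4) in E1 by (field; lra).
      pose proof (Cmod_minus_triangle (opK g k v t) (opK g k (w (s (N + N')%nat)) t) (Z t)) as E2.
      rewrite (Cmod_minus_sym (opK g k v t) (opK g k (w (s (N + N')%nat)) t)) in E2.
      fold gap in E2. lra. }
    pose proof (Cmod_ge_0 (opK g k v t - Z t)%C).
    assert (E0 : (opK g k v t - Z t)%C = RtoC 0) by (apply Cmod_eq_0; lra).
    replace (opK g k v t) with ((opK g k v t - Z t) + Z t)%C by ring. rewrite E0. ring. }
  assert (Hv0 : forall t, on_contour g t -> v t = RtoC 0).
  { apply Hker.
    - apply (holder_in_X g nd th v _ beta mu Hg Hth Hb Hmu Hvh).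
    - intros t Ht. rewrite HKv by exact Ht. unfold v. ring. }
  (* Some w_n is within 1/4 of v = 0 everywhere, against a value of modulus at least 1/2. *)
  destruct (Hwv (/ 4) ltac:(lra)) as [N HN].
  destruct (Hw' (s N)) as [_ [_ [_ [t [Ht Hge]]]]].
  specialize (HN N t (Nat.le_refl N) Ht). rewrite (Hv0 t Ht) in HN.
  replace (w (s N) t - RtoC 0)%C with (w (s N) t) in HN by ring. lra.
Qed.

Ltac ring_R := unfold plus, mult; simpl; match goal with |- @eq _ ?a ?b => change (@eq R a b); ring end.

(** * Spline interpolation *)

(* [D] is the (m-1)-th difference of the truncated power, so that sums of
   translates of [N] telescope. *)
Record bspline_shape (N D : R -> R) : Prop := {
  shape_nonneg : forall x, 0 <= N x;
  shape_support : forall x, 2 <= Rabs x -> N x = 0;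
  shape_center : 2 / 3 <= N 0;
  shape_continuous : forall x, continuous N x;
  shape_difference : forall x, N x = D x - D (x - 1);
  shape_right : forall x, 1 <= x -> D x = 1;
  shape_left : forall x, x <= -2 -> D x = 0
}.

(** * Explicit cardinal B-splines of orders 2, 3 and 4 *)

Lemma cardinal_bspline_2 (x : R) : cardinal_bspline 2 x =
  Rmax 0 (x + 1) - 2 * Rmax 0 x + Rmax 0 (x - 1).
Proof.
  unfold cardinal_bspline, Binomial.C. simpl.
  replace (x + (1 + 1) / 2 - 0) with (x + 1) by field.
  replace (x + (1 + 1) / 2 - 1) with x by field.
  replace (x + (1 + 1) / 2 - (1 + 1)) with (x - 1) by field.
  field.
Qed.

Lemma cardinal_bspline_3 (x : R) : cardinal_bspline 3 x =
  (Rmax 0 (x + 3/2) ^ 2 - 3 * Rmax 0 (x + 1/2) ^ 2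
    + 3 * Rmax 0 (x - 1/2) ^ 2 - Rmax 0 (x - 3/2) ^ 2) / 2.
Proof.
  unfold cardinal_bspline, Binomial.C. simpl.
  replace (x + (1 + 1 + 1) / 2 - 0) with (x + 3/2) by field.
  replace (x + (1 + 1 + 1) / 2 - 1) with (x + 1/2) by field.
  replace (x + (1 + 1 + 1) / 2 - (1 + 1)) with (x - 1/2) by field.
  replace (x + (1 + 1 + 1) / 2 - (1 + 1 + 1)) with (x - 3/2) by field.
  field.
Qed.

Lemma cardinal_bspline_4 (x : R) : cardinal_bspline 4 x =
  (Rmax 0 (x + 2) ^ 3 - 4 * Rmax 0 (x + 1) ^ 3 + 6 * Rmax 0 x ^ 3
    - 4 * Rmax 0 (x - 1) ^ 3 + Rmax 0 (x - 2) ^ 3) / 6.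
Proof.
  unfold cardinal_bspline, Binomial.C. simpl.
  replace (x + (1 + 1 + 1 + 1) / 2 - 0) with (x + 2) by field.
  replace (x + (1 + 1 + 1 + 1) / 2 - 1) with (x + 1) by field.
  replace (x + (1 + 1 + 1 + 1) / 2 - (1 + 1)) with x by field.
  replace (x + (1 + 1 + 1 + 1) / 2 - (1 + 1 + 1)) with (x - 1) by field.
  replace (x + (1 + 1 + 1 + 1) / 2 - (1 + 1 + 1 + 1)) with (x - 2) by field.
  field.
Qed.

Lemma continuous_Rplus (f1 f2 : R -> R) (x : R) :
  continuous f1 x -> continuous f2 x -> continuous (fun y => f1 y + f2 y) x.
Proof. exact (continuous_plus (V := R_NormedModule) f1 f2 x). Qed.

Lemma continuous_Rminus (f1 f2 : R -> R) (x : R) :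
  continuous f1 x -> continuous f2 x -> continuous (fun y => f1 y - f2 y) x.
Proof. exact (continuous_minus (V := R_NormedModule) f1 f2 x). Qed.

Lemma continuous_Rmult (f1 f2 : R -> R) (x : R) :
  continuous f1 x -> continuous f2 x -> continuous (fun y => f1 y * f2 y) x.
Proof. exact (continuous_mult (K := R_AbsRing) f1 f2 x). Qed.

Lemma cardinal_bspline_continuous (m : nat) (x : R) : continuous (cardinal_bspline m) x.
Proof.
  apply continuity_pt_filterlim. unfold cardinal_bspline, Rdiv.
  apply (continuity_pt_mult _ (fun _ => / INR (fact (m - 1)))); [|apply continuity_pt_const; intros ? ?; reflexivity].
  apply (continuity_pt_finite_SF (fun i x => (-1) ^ i * Binomial.C m i
    * Rmax 0 (x + INR m * / 2 - INR i) ^ (m - 1))).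
  intros i _.
  apply (continuity_pt_mult (fun _ => (-1) ^ i * Binomial.C m i)
    (fun x => Rmax 0 (x + INR m * / 2 - INR i) ^ (m - 1))); [apply continuity_pt_const; intros ? ?; reflexivity|].
  apply (continuity_pt_comp (fun x => Rmax 0 (x + INR m * / 2 - INR i)) (fun y => y ^ (m - 1))).
  - apply (continuity_pt_ext (fun x => ((x + INR m * / 2 - INR i) + Rabs (x + INR m * / 2 - INR i)) * / 2)).
    { intros y. unfold Rmax. destruct (Rle_dec 0 (y + INR m * / 2 - INR i)).
      - rewrite Rabs_right by lra. field.
      - rewrite Rabs_left by lra. field. }
    apply continuity_pt_filterlim. match goal with |- filterlim ?f _ _ => change (continuous f x) end.
    apply continuous_Rmult; [|apply continuous_const].
    assert (Ha : continuous (fun y => y + INR m * / 2 - INR i) x).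
    { apply continuous_Rminus; [|apply continuous_const].
      apply continuous_Rplus; [apply continuous_id | apply continuous_const]. }
    apply continuous_Rplus; [exact Ha|].
    apply (continuous_comp (fun y => y + INR m * / 2 - INR i) Rabs); [exact Ha|].
    apply continuity_pt_filterlim, Rcontinuity_abs.
  - apply derivable_continuous_pt, derivable_pt_pow.
Qed.

Ltac split_truncations := unfold Rmax; repeat (destruct Rle_dec; try lra).

Lemma Rabs_ge_cases (x a : R) : a <= Rabs x -> x <= - a \/ a <= x.
Proof. unfold Rabs. destruct (Rcase_abs x); lra. Qed.

Lemma bspline_shape_2 : exists D, bspline_shape (cardinal_bspline 2) D.
Proof.
  exists (fun y => Rmax 0 (y + 1) - Rmax 0 y). constructor.
  - intros x. rewrite cardinal_bspline_2. split_truncations.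
  - intros x Hx. rewrite cardinal_bspline_2. destruct (Rabs_ge_cases x 2 Hx); split_truncations.
  - rewrite cardinal_bspline_2. split_truncations.
  - apply cardinal_bspline_continuous.
  - intros x. rewrite cardinal_bspline_2. replace (x - 1 + 1) with x by ring. ring.
  - intros x Hx. split_truncations.
  - intros x Hx. split_truncations.
Qed.

Lemma bspline_shape_3 : exists D, bspline_shape (cardinal_bspline 3) D.
Proof.
  exists (fun y => (Rmax 0 (y + 3/2) ^ 2 - 2 * Rmax 0 (y + 1/2) ^ 2 + Rmax 0 (y - 1/2) ^ 2) / 2).
  constructor.
  - intros x. rewrite cardinal_bspline_3. split_truncations; nra.
  - intros x Hx. rewrite cardinal_bspline_3. destruct (Rabs_ge_cases x 2 Hx); split_truncations; nra.
  - rewrite cardinal_bspline_3. split_truncations.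
  - apply cardinal_bspline_continuous.
  - intros x. rewrite cardinal_bspline_3.
    replace (x - 1 + 3/2) with (x + 1/2) by field. replace (x - 1 + 1/2) with (x - 1/2) by field.
    replace (x - 1 - 1/2) with (x - 3/2) by field. field.
  - intros x Hx. split_truncations; field.
  - intros x Hx. split_truncations; field.
Qed.

Lemma bspline_shape_4 : exists D, bspline_shape (cardinal_bspline 4) D.
Proof.
  exists (fun y => (Rmax 0 (y + 2) ^ 3 - 3 * Rmax 0 (y + 1) ^ 3 + 3 * Rmax 0 y ^ 3
    - Rmax 0 (y - 1) ^ 3) / 6).
  constructor.
  - intros x. rewrite cardinal_bspline_4.
    assert (Hp : forall t, 0 <= t -> 0 <= t ^ 3) by (intros; apply pow_le; assumption).
    (* With t = x + 1, six times the spline on [-1, 0] is (t + 1)^3 - 4 t^3, which is this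
       polynomial; by symmetry t = 1 - x serves [0, 1]. The cubes in [Hp] are the two outer
       pieces. *)
    assert (Hq : forall t, 0 <= t <= 1 -> 0 <= 1 + 3 * t + 3 * t ^ 2 - 3 * t ^ 3) by (intros; nra).
    pose proof (Hp (x + 2)). pose proof (Hp (2 - x)). pose proof (Hq (x + 1)). pose proof (Hq (1 - x)).
    split_truncations; simpl in *; nra.
  - intros x Hx. rewrite cardinal_bspline_4.
    destruct (Rabs_ge_cases x 2 Hx); split_truncations; try field; simpl; nra.
  - rewrite cardinal_bspline_4. split_truncations.
  - apply cardinal_bspline_continuous.
  - intros x. rewrite cardinal_bspline_4.
    replace (x - 1 + 2) with (x + 1) by field. replace (x - 1 + 1) with x by field.
    replace (x - 1 - 1) with (x - 2) by field. field.
  - intros x Hx. split_truncations; try field; replace x with 1 by lra; field.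
  - intros x Hx. split_truncations; try field; replace x with (-2) by lra; field.
Qed.

(** The values at 0 are 1, 3/4, 2/3 and the support radii 1, 3/2, 2, so the common constants are
    those of order 4. *)
Lemma cardinal_bspline_shape (m : nat) : m = 2%nat \/ m = 3%nat \/ m = 4%nat ->
  exists D, bspline_shape (cardinal_bspline m) D.
Proof.
  intros [->|[->| ->]]; [apply bspline_shape_2 | apply bspline_shape_3 | apply bspline_shape_4].
Qed.

(** * The periodized basis and its partition of unity *)

Lemma Series_finite (u : nat -> R) (K : nat) :
  (forall n, (K < n)%nat -> u n = 0) -> Series u = sum_n u K.
Proof.
  intros H. apply is_series_unique. unfold is_series.
  apply (filterlim_ext_loc (fun _ => sum_n u K)); [|apply filterlim_const].
  exists K. intros n Hn. induction Hn as [|n Hn IH]; [reflexivity|].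
  rewrite sum_Sn, <- IH, H by lia. symmetry. apply Rplus_0_r.
Qed.

Lemma mesh_pos (n : nat) : (0 < n)%nat -> 0 < mesh n /\ INR n * mesh n = 2 * PI.
Proof.
  intros Hn. assert (0 < INR n) by (apply lt_0_INR; lia). pose proof PI_RGT_0. unfold mesh.
  split; [apply Rdiv_lt_0_compat; lra | field; lra].
Qed.

(** For s in (-1, n) and j < n the difference s - j lies in (-n, n), so with support radius 2 and n
    >= 4 only the shifts by -n, 0 and n contribute. *)
Definition periodized (N : R -> R) (n j : nat) (s : R) : R :=
  N (s - INR j) + N (s - INR j - INR n) + N (s - INR j + INR n).

Lemma bspline_basis_param (g : R -> C) (m n : nat) (rho : R) (D : R -> R) (j : nat) (x : R) :
  contour g -> bspline_shape (cardinal_bspline m) D -> (4 <= n)%nat -> 0 <= rho < mesh n ->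
  (j < n)%nat -> 0 <= x < 2 * PI ->
  bspline_basis g m n rho j (g x) = periodized (cardinal_bspline m) n j ((x - rho) / mesh n).
Proof.
  intros Hg HN Hn Hrho Hj Hx.
  destruct (mesh_pos n ltac:(lia)) as [Hh Hnh].
  unfold bspline_basis. rewrite param_contour by assumption.
  assert (Hn4 : 4 <= INR n) by (replace 4 with (INR 4) by (simpl; lra); apply le_INR; lia).
  assert (Hj' : 0 <= INR j <= INR n - 1).
  { split; [apply pos_INR|]. assert (INR (S j) <= INR n) by (apply le_INR; lia). rewrite S_INR in *. lra. }
  replace ((x - node n rho j) / mesh n) with ((x - rho) / mesh n - INR j)
    by (unfold node; field; lra).
  set (s := (x - rho) / mesh n).
  assert (Hs : -1 < s < INR n).
  { assert (E : s * mesh n = x - rho) by (unfold s; field; lra).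
    split; apply Rmult_lt_reg_r with (mesh n); lra. }
  assert (Hz : forall l : Z, (2 <= Z.abs l)%Z -> cardinal_bspline m (s - INR j - IZR l * INR n) = 0).
  { intros l Hl. apply (shape_support _ _ HN).
    destruct (Z.abs_spec l) as [[H1 H2]|[H1 H2]].
    - assert (2 <= IZR l) by (apply IZR_le; lia).
      assert (2 * INR n <= IZR l * INR n) by (apply Rmult_le_compat_r; lra).
      rewrite Rabs_left by lra. lra.
    - assert (IZR l <= -2) by (apply IZR_le; lia).
      assert (IZR l * INR n <= -2 * INR n) by (apply Rmult_le_compat_r; lra).
      rewrite Rabs_right by lra. lra. }
  unfold series_Z.
  (* The nonnegative half keeps the shifts 0 and 1; the other half, whose index l stands for -(l +
     1), keeps only -1. *)
  rewrite (Series_finite (fun l => cardinal_bspline m (s - INR j - IZR (Z.of_nat l) * INR n)) 1).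
  2: { intros l Hl. apply Hz. lia. }
  rewrite (Series_finite (fun l => cardinal_bspline m (s - INR j - IZR (- Z.of_nat (S l)) * INR n)) 0).
  2: { intros l Hl. apply Hz. lia. }
  rewrite sum_Sn, !sum_O. unfold plus; simpl. unfold periodized.
  replace (s - INR j - 0 * INR n) with (s - INR j) by ring.
  replace (s - INR j - 1 * INR n) with (s - INR j - INR n) by ring.
  replace (s - INR j - -1 * INR n) with (s - INR j + INR n) by ring. reflexivity.
Qed.

Lemma translates_sum (N D : R -> R) (y : R) (n : nat) : bspline_shape N D ->
  sum_n (fun j => N (y - INR j)) n = D y - D (y - INR (S n)).
Proof.
  intros HN. induction n as [|n IH].
  - rewrite sum_O. simpl. rewrite (shape_difference _ _ HN), Rminus_0_r. reflexivity.
  - rewrite sum_Sn, IH, (shape_difference _ _ HN (y - INR (S n))), (S_INR (S n)).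
    replace (y - INR (S n) - 1) with (y - (INR (S n) + 1)) by ring. ring_R.
Qed.

(** The three blocks of translates telescope to D(s + n) - D(s - 2 n) = 1 - 0. *)
Lemma periodized_partition (N D : R -> R) (n : nat) (s : R) : bspline_shape N D ->
  (4 <= n)%nat -> -1 < s < INR n -> sum_n (fun j => periodized N n j s) (n - 1) = 1.
Proof.
  intros HN Hn Hs.
  assert (Hn4 : 4 <= INR n) by (replace 4 with (INR 4) by (simpl; lra); apply le_INR; lia).
  unfold periodized.
  rewrite (sum_n_ext _ (fun j => plus (plus (N (s - INR j)) (N ((s - INR n) - INR j))) (N ((s + INR n) - INR j)))).
  2: { intros j. unfold plus; simpl. f_equal; [f_equal|]; f_equal; ring. }
  rewrite !sum_n_plus, !(translates_sum N D) by exact HN.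
  replace (S (n - 1)) with n by lia. unfold plus; simpl.
  rewrite (shape_right _ _ HN (s + INR n)) by lra.
  rewrite (shape_left _ _ HN (s - INR n - INR n)) by lra.
  replace (s + INR n - INR n) with s by ring. ring_R.
Qed.

Lemma periodized_nonneg (N D : R -> R) (n j : nat) (s : R) : bspline_shape N D ->
  0 <= periodized N n j s.
Proof.
  intros HN. unfold periodized. pose proof (shape_nonneg _ _ HN (s - INR j)).
  pose proof (shape_nonneg _ _ HN (s - INR j - INR n)).
  pose proof (shape_nonneg _ _ HN (s - INR j + INR n)). lra.
Qed.

Lemma periodized_center (N D : R -> R) (n j : nat) : bspline_shape N D ->
  2 / 3 <= periodized N n j (INR j).
Proof.
  intros HN. unfold periodized. replace (INR j - INR j) with 0 by ring.
  pose proof (shape_center _ _ HN).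
  pose proof (shape_nonneg _ _ HN (0 - INR n)).
  pose proof (shape_nonneg _ _ HN (0 + INR n)). lra.
Qed.

(** * Coefficients of the interpolating spline and the interpolation error *)

Lemma exists_max (a : nat -> R) (n : nat) :
  exists i, (i <= n)%nat /\ forall j, (j <= n)%nat -> a j <= a i.
Proof.
  induction n as [|n [i [Hi IH]]].
  - exists 0%nat. split; [lia|]. intros j Hj. replace j with 0%nat by lia. lra.
  - destruct (Rle_dec (a i) (a (S n))) as [H|H].
    + exists (S n). split; [lia|]. intros j Hj. destruct (Nat.eq_dec j (S n)) as [->|]; [lra|].
      eapply Rle_trans; [apply IH; lia | exact H].
    + exists i. split; [lia|]. intros j Hj. destruct (Nat.eq_dec j (S n)) as [->|]; [lra|].
      apply IH. lia.
Qed.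

Lemma sum_n_remove (b : nat -> R) (i n : nat) : (i <= n)%nat ->
  sum_n (fun j => if Nat.eq_dec j i then 0 else b j) n = sum_n b n - b i.
Proof.
  intros Hi. assert (H : forall n, sum_n (fun j => if Nat.eq_dec j i then 0 else b j) n =
    sum_n b n - (if le_dec i n then b i else 0)).
  { clear. induction n as [|n IH].
    - rewrite !sum_O. cbv beta. destruct (Nat.eq_dec 0 i) as [<-|]; destruct le_dec; try lia; ring_R.
    - rewrite !sum_Sn, IH. cbv beta.
      destruct (Nat.eq_dec (S n) i) as [<-|]; destruct le_dec; destruct le_dec; try lia; ring_R. }
  rewrite H. destruct le_dec; [reflexivity | lia].
Qed.

Lemma sum_n_C_RtoC (b : nat -> R) (n : nat) : sum_n (fun j => RtoC (b j)) n = RtoC (sum_n b n).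
Proof.
  induction n as [|n IH].
  - rewrite sum_n_C_0, sum_O. reflexivity.
  - rewrite sum_n_C_S, IH, sum_Sn. unfold plus; simpl. symmetry. apply RtoC_plus.
Qed.

Lemma sum_n_R_mult_l (M : R) (w : nat -> R) (n : nat) :
  sum_n (fun j => M * w j) n = M * sum_n w n.
Proof.
  induction n as [|n IH].
  - rewrite !sum_O. reflexivity.
  - rewrite !sum_Sn, IH. symmetry. apply Rmult_plus_distr_l.
Qed.

(** A convex combination is as close to [c] as its farthest point; restricting to nonzero weights
    keeps the spline estimate local. *)
Lemma weighted_sum_bound (z : nat -> C) (w : nat -> R) (c : C) (M : R) (n : nat) :
  (forall j, (j <= n)%nat -> 0 <= w j) -> sum_n w n = 1 ->
  (forall j, (j <= n)%nat -> w j <> 0 -> Cmod (z j - c)%C <= M) ->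
  Cmod (sum_n (fun j => z j * RtoC (w j))%C n - c)%C <= M.
Proof.
  intros Hw H1 HM.
  assert (E : c = sum_n (fun j => c * RtoC (w j))%C n).
  { rewrite (sum_n_ext _ (fun j => RtoC (w j) * c)%C) by (intros j; ring_C).
    rewrite (sum_n_C_mult_r (fun j => RtoC (w j))), sum_n_C_RtoC, H1. ring_C. }
  rewrite E at 1. rewrite sum_n_C_minus.
  eapply Rle_trans.
  - apply (Cmod_sum_n_le _ (fun j => M * w j)). intros j Hj. specialize (Hw j Hj).
    replace (z j * w j - c * w j)%C with ((z j - c) * RtoC (w j))%C by ring.
    rewrite Cmod_mult, Cmod_R, Rabs_right by lra.
    destruct (Req_dec (w j) 0) as [->|Hne].
    + lra.
    + apply Rmult_le_compat_r; [exact Hw | apply HM; assumption].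
  - rewrite sum_n_R_mult_l, H1. lra.
Qed.

(* At the node where |c_i - Q_i| is largest, the collocation equation is
   diagonally dominant because B_i(t_i) >= 2/3. *)
Lemma coefficient_bound (Q c : nat -> C) (b : nat -> nat -> R) (om : R) (n : nat) :
  (forall i j, (i <= n)%nat -> (j <= n)%nat -> 0 <= b i j) ->
  (forall i, (i <= n)%nat -> sum_n (b i) n = 1) ->
  (forall i, (i <= n)%nat -> 2 / 3 <= b i i) ->
  (forall i j, (i <= n)%nat -> (j <= n)%nat -> b i j <> 0 -> Cmod (Q i - Q j)%C <= om) ->
  (forall i, (i <= n)%nat -> sum_n (fun j => c j * RtoC (b i j))%C n = Q i) ->
  forall j, (j <= n)%nat -> Cmod (c j - Q j)%C <= om.
Proof.
  intros Hb H1 Hd HQ Hc.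
  destruct (exists_max (fun j => Cmod (c j - Q j)%C) n) as [i [Hi Hmax]].
  set (d := Cmod (c i - Q i)%C) in *.
  assert (Hd0 : 0 <= d) by apply Cmod_ge_0.
  assert (Hom : 0 <= om).
  { eapply Rle_trans; [apply Cmod_ge_0 | apply (HQ i i Hi Hi)]. specialize (Hd i Hi). lra. }
  (* The row sums are 1, so c_i is its own average with the weights of row i; in the difference the
     diagonal term vanishes. *)
  assert (E : (c i - Q i)%C = sum_n (fun j => (c i - c j) * RtoC (b i j))%C n).
  { rewrite (sum_n_ext _ (fun j => RtoC (b i j) * c i - c j * RtoC (b i j))%C) by (intros j; ring_C).
    rewrite <- sum_n_C_minus, (Hc i Hi).
    rewrite (sum_n_C_mult_r (fun j => RtoC (b i j))), sum_n_C_RtoC, (H1 i Hi). ring_C. }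
  (* Each difference c_i - c_j with nonzero weight is at most 2 d + om, and the off-diagonal weights
     add up to 1 - b_ii <= 1/3. Hence d <= (2 d + om) / 3, that is d <= om. *)
  assert (Hle : d <= (2 * d + om) * (1 - b i i)).
  { unfold d at 1. rewrite E. eapply Rle_trans.
    - apply (Cmod_sum_n_le _ (fun j => (2 * d + om) * (if Nat.eq_dec j i then 0 else b i j))).
      intros j Hj. destruct (Nat.eq_dec j i) as [->|Hne].
      + rewrite Cminus_diag, Cmult_0_l, Cmod_0. lra.
      + pose proof (Hb i j Hi Hj) as Hbij.
        rewrite Cmod_mult, Cmod_R, Rabs_right by lra.
        destruct (Req_dec (b i j) 0) as [->|Hb0]; [lra|].
        apply Rmult_le_compat_r; [exact Hbij|].
        replace (c i - c j)%C with ((c i - Q i) - (c j - Q j) + (Q i - Q j))%C by ring.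
        eapply Rle_trans; [apply Cmod_triangle|].
        pose proof (Cmod_minus_le (c i - Q i) (c j - Q j)).
        specialize (Hmax j Hj). specialize (HQ i j Hi Hj Hb0). fold d in H. simpl in Hmax. lra.
    - rewrite sum_n_R_mult_l, sum_n_remove, (H1 i Hi) by exact Hi. apply Rle_refl. }
  assert (Hdom : d <= om).
  { specialize (Hd i Hi).
    assert ((2 * d + om) * (1 - b i i) <= (2 * d + om) * (1 / 3)) by (apply Rmult_le_compat_l; lra).
    lra. }
  intros j Hj. eapply Rle_trans; [apply (Hmax j Hj) | exact Hdom].
Qed.

Lemma node_bounds (n : nat) (rho : R) (i : nat) : (i < n)%nat -> 0 <= rho < mesh n ->
  0 <= node n rho i < 2 * PI.
Proof.
  intros Hi Hrho. destruct (mesh_pos n ltac:(lia)) as [Hh Hnh]. unfold node.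
  pose proof (pos_INR i). assert (INR (S i) <= INR n) by (apply le_INR; lia). rewrite S_INR in *.
  assert ((INR i + 1) * mesh n <= INR n * mesh n) by (apply Rmult_le_compat_r; lra).
  assert (0 <= INR i * mesh n) by (apply Rmult_le_pos; lra). lra.
Qed.

(** At each point the spline is a convex combination of coefficients whose nodes lie within 2 h,
    modulo the period. Each coefficient is within [om] of the value of q at its node, and that value
    is within [om] of q at the point. Only the oscillation of q enters, which suits a merely Hölder
    q. *)
Lemma spline_interpolation_error (g : R -> C) (m n : nat) (rho : R) (u q : C -> C) (om : R) :
  contour g -> m = 2%nat \/ m = 3%nat \/ m = 4%nat -> (4 <= n)%nat -> 0 <= rho < mesh n ->
  in_spline_space g m n rho u ->
  (forall i, (i < n)%nat -> u (g (node n rho i)) = q (g (node n rho i))) ->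
  (forall x y, 0 <= x <= 2 * PI -> - (2 * PI) <= y <= 4 * PI -> Rabs (x - y) <= 2 * mesh n ->
    Cmod (q (g x) - q (g y))%C <= om) ->
  forall t, on_contour g t -> Cmod (u t - q t)%C <= 2 * om.
Proof.
  intros Hg Hm Hn Hrho [c Hu] Hint Hosc.
  destruct (cardinal_bspline_shape m Hm) as [D HN].
  destruct (mesh_pos n ltac:(lia)) as [Hh Hnh].
  set (N := cardinal_bspline m) in *.
  set (s := fun x => (x - rho) / mesh n).
  assert (Hs : forall x, 0 <= x < 2 * PI -> -1 < s x < INR n).
  { intros x Hx. assert (E : s x * mesh n = x - rho) by (unfold s; field; lra).
    split; apply Rmult_lt_reg_r with (mesh n); lra. }
  assert (Hux : forall x, 0 <= x < 2 * PI ->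
    u (g x) = sum_n (fun j => c j * RtoC (periodized N n j (s x)))%C (n - 1)).
  { intros x Hx. rewrite Hu by (exists x; reflexivity). apply sum_n_ext_loc. intros j Hj.
    f_equal. f_equal. apply (bspline_basis_param g m n rho D); try assumption. lia. }
  assert (Hnear : forall x j, 0 <= x < 2 * PI -> (j < n)%nat -> periodized N n j (s x) <> 0 ->
    Cmod (q (g x) - q (g (node n rho j)))%C <= om).
  { intros x j Hx Hj Hne.
    pose proof (node_bounds n rho j Hj Hrho) as Hnb.
    (* [l] selects the copy of node [j] close to [x]. It may lie in a neighbouring period, which is
       why [Hosc] admits y between -2 PI and 4 PI. *)
    assert (Hl : exists l : Z, (-1 <= l <= 1)%Z /\
      Rabs (x - (node n rho j + IZR l * (2 * PI))) <= 2 * mesh n).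
    { assert (Hsup : forall l : Z, N (s x - INR j - IZR l * INR n) <> 0 ->
        Rabs (x - (node n rho j + IZR l * (2 * PI))) <= 2 * mesh n).
      { intros l Hl. rewrite <- Hnh. unfold node.
        replace (x - (rho + INR j * mesh n + IZR l * (INR n * mesh n)))
          with ((s x - INR j - IZR l * INR n) * mesh n) by (unfold s; field; lra).
        rewrite Rabs_mult, (Rabs_right (mesh n)) by lra. apply Rmult_le_compat_r; [lra|].
        apply Rnot_lt_le. intros Hlt. apply Hl, (shape_support _ _ HN). lra. }
      unfold periodized in Hne.
      destruct (Req_dec (N (s x - INR j)) 0) as [E0|E0].
      2: { exists 0%Z. split; [lia|]. apply Hsup. rewrite Rmult_0_l, Rminus_0_r. exact E0. }
      destruct (Req_dec (N (s x - INR j - INR n)) 0) as [E1|E1].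
      2: { exists 1%Z. split; [lia|]. apply Hsup. rewrite Rmult_1_l. exact E1. }
      exists (-1)%Z. split; [lia|]. apply Hsup.
      replace (s x - INR j - -1 * INR n) with (s x - INR j + INR n) by ring. lra. }
    destruct Hl as [l [Hl1 Hl2]].
    rewrite <- (contour_period g Hg l (node n rho j)). pose proof PI_RGT_0.
    assert (-1 <= IZR l <= 1) as [L1 L2] by (split; apply IZR_le; lia).
    apply Hosc; [lra | | exact Hl2]. split; nra. }
  assert (Hnode : forall i, (i <= n - 1)%nat -> 0 <= node n rho i < 2 * PI).
  { intros i Hi. apply node_bounds; [lia | exact Hrho]. }
  assert (Hcb : forall j, (j <= n - 1)%nat -> Cmod (c j - q (g (node n rho j)))%C <= om).
  { apply (coefficient_bound (fun j => q (g (node n rho j))) c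
      (fun i j => periodized N n j (s (node n rho i)))).
    - intros i j Hi Hj. apply (periodized_nonneg N D n j _ HN).
    - intros i Hi. apply (periodized_partition N D n _ HN Hn), Hs, Hnode, Hi.
    - intros i Hi. replace (s (node n rho i)) with (INR i) by (unfold s, node; field; lra).
      apply (periodized_center N D n i HN).
    - intros i j Hi Hj Hne. apply Hnear; [apply Hnode, Hi | lia | exact Hne].
    - intros i Hi. rewrite <- Hux by (apply Hnode, Hi). apply Hint. lia. }
  intros t Ht. destruct (on_contour_param g t Hg Ht) as [Hx Et].
  rewrite <- Et. set (x := param g t) in *. rewrite (Hux x Hx).
  apply weighted_sum_bound.
  - intros j Hj. apply (periodized_nonneg N D n j _ HN).
  - apply (periodized_partition N D n _ HN Hn), Hs, Hx.
  - intros j Hj Hne. specialize (Hcb j Hj). specialize (Hnear x j Hx ltac:(lia) Hne).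
    rewrite Cmod_minus_sym in Hnear.
    pose proof (Cmod_minus_triangle (c j) (q (g (node n rho j))) (q (g x))). lra.
Qed.

(** Continuity is shown for the periodized formula in the parameter, because [param] itself jumps at
    the cut. *)
Lemma spline_integrable (g : R -> C) (m n : nat) (rho : R) (u : C -> C) :
  contour g -> m = 2%nat \/ m = 3%nat \/ m = 4%nat -> (4 <= n)%nat -> 0 <= rho < mesh n ->
  in_spline_space g m n rho u -> integrable_along g u.
Proof.
  intros Hg Hm Hn Hrho [c Hu].
  destruct (cardinal_bspline_shape m Hm) as [D HN].
  apply (integrable_along_continuous g u (fun x =>
    sum_n (fun j => c j * RtoC (periodized (cardinal_bspline m) n j ((x - rho) / mesh n)))%C (n - 1))).
  2: { intros x Hx. rewrite Hu by (exists x; reflexivity). apply sum_n_ext_loc. intros j Hj.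
    f_equal. f_equal. apply (bspline_basis_param g m n rho D); try assumption; [lia | lra]. }
  intros x _.
  assert (Hterm : forall j, continuous
    (fun x => c j * RtoC (periodized (cardinal_bspline m) n j ((x - rho) / mesh n)))%C x).
  { intros j. apply (filterlim_C_mult (locally x)); [apply filterlim_const|].
    apply (filterlim_C_pair (locally x)); [|apply filterlim_const].
    assert (Haff : forall d, continuous (fun x => (x - rho) / mesh n - INR j + d) x).
    { intros d. apply continuous_Rplus; [|apply continuous_const].
      apply continuous_Rminus; [|apply continuous_const].
      apply continuous_Rmult; [|apply continuous_const].
      apply continuous_Rminus; [apply continuous_id | apply continuous_const]. }
    assert (HNc : forall d, continuous (fun x => cardinal_bspline m ((x - rho) / mesh n - INR j + d)) x).
    { intros d. apply (continuous_comp (fun x => (x - rho) / mesh n - INR j + d) (cardinal_bspline m));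
        [apply Haff | apply (shape_continuous _ _ HN)]. }
    change (continuous (fun x => periodized (cardinal_bspline m) n j ((x - rho) / mesh n)) x).
    unfold periodized.
    apply continuous_Rplus; [|apply HNc].
    apply continuous_Rplus; [|apply (HNc (- INR n))].
    apply (continuous_ext (fun x => cardinal_bspline m ((x - rho) / mesh n - INR j + 0))); [|apply HNc].
    intros y. rewrite Rplus_0_r. reflexivity. }
  clear Hu. induction (n - 1)%nat as [|k IH].
  - apply (continuous_ext (fun x => c 0%nat * RtoC (periodized (cardinal_bspline m) n 0 ((x - rho) / mesh n)))%C);
      [|apply Hterm]. intros y. symmetry. apply sum_n_C_0.
  - apply (continuous_ext (fun x => plus (G := C_R_NormedModule) (sum_n (fun j => c j * RtoC (periodized (cardinal_bspline m) n j ((x - rho) / mesh n)))%C k)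
      (c (S k) * RtoC (periodized (cardinal_bspline m) n (S k) ((x - rho) / mesh n)))%C)).
    { intros y. symmetry. apply sum_n_C_S. }
    apply (continuous_plus (V := C_R_NormedModule)); [apply IH | apply Hterm].
Qed.

(** * The error estimate *)

(** With PI <= 4 this yields h <= 2, hence h^mu <= 2 h^alpha in the estimate of lambda K phi. *)
Lemma mesh_le_half_PI (n : nat) : (4 <= n)%nat -> mesh n <= PI / 2.
Proof.
  intros Hn. destruct (mesh_pos n ltac:(lia)) as [Hh Hnh]. pose proof PI_RGT_0.
  assert (4 <= INR n) by (replace 4 with (INR 4) by (simpl; lra); apply le_INR; lia).
  nra.
Qed.

Lemma holder_contour_param (g : R -> C) (L : R) (v : C -> C) (M mu : R) : 0 <= M -> 0 < mu ->
  (forall x y, -4 * PI <= x <= 8 * PI -> -4 * PI <= y <= 8 * PI ->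
    Cmod (g x - g y)%C <= L * Rabs (x - y)) ->
  (forall t s, on_contour g t -> on_contour g s -> Cmod (v t - v s)%C <= M * hpow (Cmod (t - s)%C) mu) ->
  forall x y d, -4 * PI <= x <= 8 * PI -> -4 * PI <= y <= 8 * PI -> L * Rabs (x - y) <= d ->
  Cmod (v (g x) - v (g y))%C <= M * hpow d mu.
Proof.
  intros HM Hmu HL Hv x y d Hx Hy Hd.
  eapply Rle_trans; [apply Hv; [exists x | exists y]; reflexivity|].
  apply Rmult_le_compat_l; [exact HM|]. apply hpow_le; [lra|].
  eapply Rle_trans; [apply HL; assumption | exact Hd].
Qed.

Lemma sup_norm_le (g : R -> C) (v : C -> C) (B : R) :
  (forall t, on_contour g t -> Cmod (v t) <= B) -> Rbar_le (sup_norm g v) (Finite B).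
Proof. intros H. apply Lub_Rbar_le. intros r [t [Ht ->]]. apply H, Ht. Qed.

Lemma holder_norm_le (g : R -> C) (s : R) (v : C -> C) (B1 B2 : R) :
  (forall t, on_contour g t -> Cmod (v t) <= B1) ->
  (forall t t', on_contour g t -> on_contour g t' ->
     Cmod (v t - v t')%C <= B2 * hpow (Cmod (t - t')%C) s) ->
  Rbar_le (holder_norm g s v) (Finite (B1 + B2)).
Proof.
  intros H1 H2. unfold holder_norm.
  assert (E1 := sup_norm_le g v B1 H1).
  match goal with |- Rbar_le (Rbar_plus _ ?l) _ => assert (E2 : Rbar_le l (Finite B2)) end.
  { apply Lub_Rbar_le. intros r [t [t' [Ht [Ht' [Hne ->]]]]].
    assert (Hpos : 0 < Cmod (t - t')%C).
    { apply Cmod_gt_0. intros E. apply Hne. replace t with ((t - t') + t')%C by ring. rewrite E. ring. }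
    pose proof (Rpower_pos (Cmod (t - t')%C) s).
    apply Rmult_le_reg_r with (Rpower (Cmod (t - t')%C) s); [assumption|].
    unfold Rdiv. rewrite Rmult_assoc, Rinv_l, Rmult_1_r by lra.
    rewrite <- (hpow_Rpower _ s Hpos). apply H2; assumption. }
  destruct (sup_norm g v) as [a| |]; [|elim E1|];
    match goal with |- Rbar_le (Rbar_plus _ ?l) _ => destruct l as [b| |] end;
    simpl in *; try tauto; lra.
Qed.

(** Linearity gives K e = K phi - K u - K J_f, with e the collocation error. Substituting this
    removes K u and K J_f from the collocation equation. *)
Lemma collocation_residual (g : R -> C) (k : C -> C -> C) (mu : R) (lambda : C)
  (nd : nat) (th : nat -> R) (m n : nat) (rho alpha : R) (f phi u : C -> C) (i : nat) :
  contour g -> disc_params nd th -> kernel_regular g k mu -> 0 < alpha <= 1 ->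
  in_X g nd th alpha f -> integrable_along g phi -> integrable_along g u ->
  (forall t, on_contour g t -> (phi t - lambda * opK g k phi t)%C = f t) ->
  is_collocation_spline g k lambda nd th m n rho f u -> (i < n)%nat ->
  let t := g (node n rho i) in
  u t = (cont_part g nd th f t + lambda * opK g k phi t
    - lambda * opK g k (fun s => phi s - (u s + jump_part g nd th f s)) t)%C.
Proof.
  intros Hg Hth Hk Ha Hf Hphi Hu Heq [_ Hcol] Hi t.
  assert (Ht : on_contour g t) by (exists (node n rho i); reflexivity).
  specialize (Hcol i Hi). cbv zeta in Hcol. fold t in Hcol.
  pose proof (jump_part_integrable g nd th alpha f Hg Hth Ha Hf) as HJ.
  assert (HE : opK g k (fun s => phi s - (u s + jump_part g nd th f s))%C t =
    (opK g k phi t - opK g k u t - opK g k (jump_part g nd th f) t)%C).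
  { rewrite <- (opK_minus g k mu phi u) by assumption.
    rewrite <- (opK_minus g k mu (fun s => phi s - u s)%C) by
      (assumption || (apply integrable_along_minus; assumption)).
    f_equal. apply functional_extensionality. intros s. ring. }
  rewrite HE.
  replace (u t) with ((u t - lambda * opK g k u t) + lambda * opK g k u t)%C by ring.
  rewrite Hcol. ring.
Qed.

Theorem theorem9p2 (g : R -> C) (nd : nat) (th : nat -> R)
  (alpha beta mu : R) (k : C -> C -> C) (lambda : C)
  (m : nat) (eta : R) (rho : nat -> R)
  (Hg : contour g) (Hth : disc_params nd th)
  (Hexp : 0 < beta /\ beta < alpha /\ alpha < mu /\ mu <= 1)
  (Hk : kernel_regular g k mu)
  (Hker : forall v : C -> C, in_X g nd th beta v ->
     (forall t : C, on_contour g t -> (v t - lambda * opK g k v t)%C = RtoC 0) ->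
     forall t : C, on_contour g t -> v t = RtoC 0)
  (Hm : m = 2%nat \/ m = 3%nat \/ m = 4%nat)
  (Heta : 0 < eta /\ eta < 1 / (2 * INR nd))
  (Hrho : forall n : nat, (4 <= n)%nat ->
     admissible_phase nd th eta n (rho n)) :
  exists Clambda h0 : R, 0 < h0 /\
    forall (n : nat) (f phi u : C -> C),
      (4 <= n)%nat -> mesh n < h0 ->
      in_X g nd th alpha f ->
      in_X g nd th beta phi ->
      (forall t : C, on_contour g t ->
         (phi t - lambda * opK g k phi t)%C = f t) ->
      is_collocation_spline g k lambda nd th m n (rho n) f u ->
      let phi_h := fun t : C => (u t + jump_part g nd th f t)%C in
      let phi_it := fun t : C => (f t + lambda * opK g k phi_h t)%C in
      let bound :=
        Finite (Clambda * Rpower (mesh n) alpha * X_norm g nd th alpha f) in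
      Rbar_le (sup_norm g (fun t => (phi t - phi_h t)%C)) bound /\
      Rbar_le (holder_norm g mu (fun t => (phi t - phi_it t)%C)) bound /\
      Rbar_le (sup_norm g (fun t => (phi t - phi_it t)%C)) bound /\
      (forall sigma : R, 0 < sigma -> sigma <= mu ->
         Rbar_le (holder_norm g sigma (fun t => (phi t - phi_it t)%C)) bound).
Proof.
  destruct Hexp as [E1 [E2 [E3 E4]]].
  destruct (second_kind_stability g nd th k beta mu lambda Hg Hth ltac:(lra) E4 Hk Hker)
    as [Cs [HCs Hstab]].
  destruct (opK_smoothing g k mu Hg Hk) as [A [HA HK]].
  destruct (cont_part_holder_periodic g nd th alpha Hg Hth ltac:(lra)) as [Ac [HAc Hcont]].
  destruct (contour_lipschitz g Hg) as [L [HL [_ [HLip _]]]].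
  destruct (contour_diameter g Hg) as [D [HD HDiam]].
  pose proof PI2_1 as HPI. pose proof PI_RGT_0 as HPI0.
  set (La := Cmod lambda). assert (HLa : 0 <= La) by apply Cmod_ge_0.
  set (L2 := 2 * L).
  (* [h0] makes the contribution of [lambda K e] to the residual absorbable. *)
  set (eps := / (4 * Cs * La * A + 1)).
  assert (HCLA : 0 <= Cs * La * A) by (repeat apply Rmult_le_pos; lra).
  assert (Heps : 0 < eps) by (apply Rinv_0_lt_compat; lra).
  destruct (hpow_small mu eps ltac:(lra) Heps) as [d0 [Hd0 Hsmall]].
  (* The outer 2 pays for the absorption, [Cs] for stability and the next 2 for interpolation.
     Inside, 2 [Ac] is the oscillation of f_C over distance 2 h and the other term that of lambda K
     phi, with one factor [L2] to spare. *)
  set (C1 := 2 * Cs * (2 * (2 * Ac + La * A * Cs * (L2 * (L2 * 2))))).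
  (* One constant for all four bounds: C1 for the collocation error, La A C1 for the supremum of the
     iterated error, and La A C1 D for its Hölder seminorm, where [D] lowers the exponent from mu to
     sigma. *)
  set (C2 := C1 + (La * A * C1 + La * A * C1 * D)).
  exists C2, (d0 / L2).
  assert (HL2 : 2 <= L2) by (unfold L2; lra).
  split; [apply Rdiv_lt_0_compat; lra|].
  intros n f phi u Hn Hmesh Hf Hphi Heq Hcol phi_h phi_it.
  destruct (mesh_pos n ltac:(lia)) as [Hh _]. pose proof (mesh_le_half_PI n Hn) as Hh2.
  destruct (X_norm_bounds g nd th alpha f Hg Hth ltac:(lra) Hf) as [HN0 _].
  pose proof (X_norm_sup g nd th alpha f Hg Hth ltac:(lra) Hf) as HN.
  set (h := mesh n) in *. set (F := X_norm g nd th alpha f) in *.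
  destruct (Hrho n Hn) as [Hr _]. fold h in Hr.
  pose proof (in_X_integrable g nd th beta phi Hg Hth E1 Hphi) as Iphi.
  pose proof (proj1 Hcol) as Hspl.
  pose proof (spline_integrable g m n (rho n) u Hg Hm Hn Hr Hspl) as Iu.
  pose proof (jump_part_integrable g nd th alpha f Hg Hth ltac:(lra) Hf) as IJ.
  set (e := fun t => (phi t - phi_h t)%C).
  assert (Ie : integrable_along g e).
  { apply (integrable_along_ext g (fun t => (phi t - u t) - jump_part g nd th f t)%C).
    - intros x _. unfold e, phi_h. ring.
    - apply integrable_along_minus; [apply integrable_along_minus|]; assumption. }
  assert (Iphih : integrable_along g phi_h).
  { apply (integrable_along_ext g (fun t => phi t - e t)%C).
    - intros x _. unfold e. ring.
    - apply integrable_along_minus; assumption. }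
  (* The stability estimate is used twice: here it bounds phi by the data, later it bounds the error
     by its residual. *)
  assert (Hphib : forall t, on_contour g t -> Cmod (phi t) <= Cs * F).
  { apply (Hstab phi F Iphi). intros t Ht. rewrite Heq by exact Ht. apply HN, Ht. }
  destruct (HK phi (Cs * F) Iphi Hphib) as [_ HKphi].
  (* [E] has to be finite and the least bound: the residual is estimated through [E], stability
     turns this into a new bound of e, and minimality makes it an inequality for [E] itself. *)
  assert (Hsup : exists E, 0 <= E /\ (forall t, on_contour g t -> Cmod (e t) <= E) /\
    forall B, (forall t, on_contour g t -> Cmod (e t) <= B) -> E <= B).
  { destruct (integrable_along_bounded g e Hg Ie) as [B HB].
    destruct (completeness (fun x => exists t, on_contour g t /\ x = Cmod (e t))) as [S [HS1 HS2]].
    - exists B. intros x [t [Ht ->]]. apply HB, Ht.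
    - exists (Cmod (e (g 0))), (g 0). split; [exists 0; reflexivity | reflexivity].
    - exists S. assert (HS : forall t, on_contour g t -> Cmod (e t) <= S).
      { intros t Ht. apply HS1. exists t. auto. }
      split; [|split; [exact HS|]].
      + eapply Rle_trans; [apply Cmod_ge_0 | apply (HS (g 0)); exists 0; reflexivity].
      + intros B' HB'. apply HS2. intros x [t [Ht ->]]. apply HB', Ht. }
  destruct Hsup as [E [HE0 [HE HEmin]]].
  destruct (HK e E Ie HE) as [HKe1 HKe2].
  set (q := fun t => (cont_part g nd th f t + lambda * opK g k phi t - lambda * opK g k e t)%C).
  set (P := hpow h alpha). assert (HP : 0 <= P) by apply hpow_ge_0.
  (* Oscillations of f_C, lambda K phi and lambda K e over parameter distance 2 h. The last summand
     keeps its power of h unconverted, since its smallness is what absorbs [E]. *)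
  set (om := Ac * F * (2 * P) + La * (A * (Cs * F) * (L2 * (2 * P))) + La * (A * E * hpow (L2 * h) mu)).
  assert (Hosc : forall x y, 0 <= x <= 2 * PI -> - (2 * PI) <= y <= 4 * PI -> Rabs (x - y) <= 2 * h ->
    Cmod (q (g x) - q (g y))%C <= om).
  { intros x y Hx Hy Hxy.
    assert (Hd : L * Rabs (x - y) <= L2 * h).
    { unfold L2. replace (2 * L * h) with (L * (2 * h)) by ring. apply Rmult_le_compat_l; lra. }
    unfold q. 
    replace (cont_part g nd th f (g x) + lambda * opK g k phi (g x) - lambda * opK g k e (g x) -
      (cont_part g nd th f (g y) + lambda * opK g k phi (g y) - lambda * opK g k e (g y)))%C
    with ((cont_part g nd th f (g x) - cont_part g nd th f (g y)) +
      lambda * (opK g k phi (g x) - opK g k phi (g y)) -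
      lambda * (opK g k e (g x) - opK g k e (g y)))%C by ring.
    eapply Rle_trans; [apply Cmod_minus_le|].
    eapply Rle_trans; [apply Rplus_le_compat_r, Cmod_triangle|].
    rewrite !Cmod_mult. fold La. unfold om.
    assert (HAF : 0 <= A * (Cs * F)) by (repeat apply Rmult_le_pos; lra).
    apply Rplus_le_compat; [apply Rplus_le_compat|].
    - eapply Rle_trans; [apply (Hcont f Hf x y Hx Hy)|]. fold F.
      apply Rmult_le_compat_l; [apply Rmult_le_pos; lra|].
      apply Rle_trans with (hpow (2 * h) alpha); [apply hpow_le; lra|].
      rewrite hpow_mult by lra. apply Rmult_le_compat_r; [apply hpow_ge_0|].
      rewrite hpow_Rpower by lra. rewrite <- (Rpower_1 2) at 2 by lra. apply Rle_Rpower; lra.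
    - apply Rmult_le_compat_l; [exact HLa|].
      eapply Rle_trans; [apply (holder_contour_param g L _ _ mu HAF ltac:(lra) HLip HKphi x y (L2 * h)); lra|].
      apply Rmult_le_compat_l; [exact HAF|].
      rewrite hpow_mult by lra.
      apply Rmult_le_compat; [apply hpow_ge_0 | apply hpow_ge_0 | |].
      + rewrite hpow_Rpower by lra. rewrite <- (Rpower_1 L2) at 2 by lra. apply Rle_Rpower; lra.
      + apply hpow_exponent_le; try lra. pose proof PI_4. lra.
    - apply Rmult_le_compat_l; [exact HLa|].
      apply (holder_contour_param g L _ _ mu); try assumption; try lra.
      apply Rmult_le_pos; lra. }
  assert (Hint : forall i, (i < n)%nat -> u (g (node n (rho n) i)) = q (g (node n (rho n) i))).
  { intros i Hi. apply (collocation_residual g k mu lambda nd th m n (rho n) alpha f phi u i); auto; lra. }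
  pose proof (spline_interpolation_error g m n (rho n) u q om Hg Hm Hn Hr Hspl Hint Hosc) as Herr.
  assert (Hres : forall t, on_contour g t -> Cmod (e t - lambda * opK g k e t)%C <= 2 * om).
  { intros t Ht. rewrite <- Cmod_opp.
    replace (- (e t - lambda * opK g k e t))%C with (u t - q t)%C; [apply Herr, Ht|].
    unfold q, e, phi_h, cont_part. rewrite <- (Heq t Ht). ring. }
  pose proof (HEmin _ (Hstab e (2 * om) Ie Hres)) as HEle.
  assert (HEb : E <= C1 * P * F).
  { specialize (Hsmall (L2 * h)).
    assert (Hlt : L2 * h < d0).
    { replace d0 with (L2 * (d0 / L2)) by (field; lra). apply Rmult_lt_compat_l; lra. }
    specialize (Hsmall Hlt). pose proof (hpow_ge_0 (L2 * h) mu) as Hg0.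
    (* The 4 in [eps] makes this coefficient of [E] at most 1/2; the 1 added there keeps the
       denominator positive when Cs La A = 0. *)
    assert (Habs : 2 * (Cs * La * A * hpow (L2 * h) mu) <= / 2).
    { assert (Hee : (4 * (Cs * La * A) + 1) * eps = 1).
      { unfold eps. field. lra. }
      assert (Cs * La * A * hpow (L2 * h) mu <= Cs * La * A * eps).
      { apply Rmult_le_compat_l; lra. }
      lra. }
    assert (Hmain : E <= 2 * (Cs * La * A * hpow (L2 * h) mu) * E
      + Cs * (2 * (Ac * F * (2 * P) + La * (A * (Cs * F) * (L2 * (2 * P)))))).
    { eapply Rle_trans; [exact HEle|]. apply Req_le. unfold om. ring. }
    assert (Hab2 : 2 * (Cs * La * A * hpow (L2 * h) mu) * E <= / 2 * E) by (apply Rmult_le_compat_r; lra).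
    assert (Hfin : 2 * (Cs * (2 * (Ac * F * (2 * P) + La * (A * (Cs * F) * (L2 * (2 * P)))))) <= C1 * P * F).
    { unfold C1.
      replace (2 * (Cs * (2 * (Ac * F * (2 * P) + La * (A * (Cs * F) * (L2 * (2 * P)))))))
        with (2 * Cs * (2 * (2 * Ac + La * A * Cs * (L2 * 2))) * P * F) by ring.
      apply Rmult_le_compat_r; [exact HN0|]. apply Rmult_le_compat_r; [exact HP|].
      apply Rmult_le_compat_l; [lra|]. apply Rmult_le_compat_l; [lra|].
      apply Rplus_le_compat_l. apply Rmult_le_compat_l; [repeat apply Rmult_le_pos; lra|]. nra. }
    lra. }
  assert (HC1 : 0 <= C1).
  { unfold C1. assert (0 <= La * A * Cs * (L2 * (L2 * 2))) by (repeat apply Rmult_le_pos; lra).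
    repeat apply Rmult_le_pos; lra. }
  assert (HX : 0 <= C1 * P * F) by (apply Rmult_le_pos; [apply Rmult_le_pos|]; assumption).
  assert (HLAX : 0 <= La * A * (C1 * P * F)) by (apply Rmult_le_pos; [apply Rmult_le_pos; lra | exact HX]).
  assert (HLAXD : La * A * (C1 * P * F) <= La * A * (C1 * P * F) * D).
  { rewrite <- (Rmult_1_r (La * A * (C1 * P * F))) at 1. apply Rmult_le_compat_l; lra. }
  replace (Rpower h alpha) with P by (apply hpow_Rpower; exact Hh).
  assert (Hbd : C2 * P * F = C1 * P * F + (La * A * (C1 * P * F) + La * A * (C1 * P * F) * D))
    by (unfold C2; ring).
  rewrite Hbd. cbv zeta.
  assert (Hit : forall t, on_contour g t -> (phi t - phi_it t)%C = (lambda * opK g k e t)%C).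
  { intros t Ht. unfold phi_it, e. rewrite (opK_minus g k mu) by assumption.
    rewrite <- (Heq t Ht). ring. }
  assert (Hits : forall t, on_contour g t -> Cmod (phi t - phi_it t)%C <= La * A * (C1 * P * F)).
  { intros t Ht. rewrite Hit, Cmod_mult, Rmult_assoc by exact Ht.
    apply Rmult_le_compat_l; [exact HLa|]. eapply Rle_trans; [apply HKe1, Ht|].
    apply Rmult_le_compat_l; lra. }
  assert (Hhold : forall sigma, 0 < sigma -> sigma <= mu ->
    Rbar_le (holder_norm g sigma (fun t => (phi t - phi_it t)%C))
      (Finite (C1 * P * F + (La * A * (C1 * P * F) + La * A * (C1 * P * F) * D)))).
  { intros sigma Hs1 Hs2.
    apply Rbar_le_trans with (Finite (La * A * (C1 * P * F) + La * A * (C1 * P * F) * D)); [|simpl; lra].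
    apply holder_norm_le; [exact Hits|].
    intros t t' Ht Ht'. rewrite !Hit by assumption.
    replace (lambda * opK g k e t - lambda * opK g k e t')%C
      with (lambda * (opK g k e t - opK g k e t'))%C by ring.
    rewrite Cmod_mult. fold La.
    apply Rle_trans with (La * (A * (C1 * P * F) * (D * hpow (Cmod (t - t')%C) sigma))).
    - apply Rmult_le_compat_l; [exact HLa|].
      eapply Rle_trans; [apply HKe2; assumption|].
      apply Rmult_le_compat; [apply Rmult_le_pos; lra | apply hpow_ge_0 | apply Rmult_le_compat_l; lra |].
      apply hpow_exponent_le; try lra. apply HDiam; assumption.
    - apply Req_le. ring. }
  split; [|split; [|split]].
  - apply sup_norm_le. intros t Ht. eapply Rle_trans; [apply HE, Ht|]. lra.
  - apply Hhold; lra.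
  - apply sup_norm_le. intros t Ht. eapply Rle_trans; [apply Hits, Ht|]. lra.
  - exact Hhold.
Qed.
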